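(* Let $\mathbf{F}$, $\mathbf{A}$, $\mathbf{W}$ satisfy the standing assumptions listed in the context, and suppose that the SDE $\mathrm{d}\mathbf{X}_t=\mathbf{F}(\mathbf{X}_t)\,\mathrm{d}t+\mathbf{A}\,\mathrm{d}\mathbf{W}_t$ admits an invariant probability measure $\mu$ on $\mathbb{R}^d$. Let $\mathbf{X}_0\sim\mu$ be independent of $\mathbf{W}$, let $\mathbf{X}=(\mathbf{X}_t)_{t\ge0}$ be the corresponding solution process with $d$-th component $X=(X_t)_{t\ge0}$, and assume that the ergodicity condition $$\lim_{N\to\infty}\frac1N\sum_{n=0}^{N-1}\mathbf{1}_B(\mathbf{X}_{n\delta})=\mu(B)\quad\text{in probability, for all } B\in\mathcal{B}(\mathbb{R}^d)\text{ and all }\delta>0$$ is fulfilled. Then it holds that $$\lim_{\delta\to0}\;\lim_{J\to\infty}\frac1J\sum_{j=1}^{J}T_{j,\delta}(X)=2\quad P\text{-almost surely}.\qquad( * )$$ Furthermore, for $\mu$-almost all $\mathbf{x}\in\mathbb{R}^d$, $( * )$ also holds for the $d$-th component $X^{\mathbf{x}}=(X^{\mathbf{x}}_t)_{t\ge0}$ of the solution process $\mathbf{X}^{\mathbf{x}}=(\mathbf{X}^{\mathbf{x}}_t)_{t\ge0}$ with initial condition $\mathbf{X}^{\mathbf{x}}_0=\mathbf{x}$ $P$-a.s., in place of $X$.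
   Context: All random variables and processes live on a common probability space $(\Omega,\mathcal{A},P)$; $\mathbb{N}=\{1,2,\dots\}$; $\mathcal{B}(\mathbb{R}^d)$ is the Borel $\sigma$-algebra and $\mathbf{1}_B$ the indicator function of $B$. Let $d,m\in\mathbb{N}$ and let $\mathbf{W}=(\mathbf{W}_t)_{t\ge0}$ be an $m$-dimensional standard Brownian motion. Standing assumptions: (i) $\mathbf{F}=(F_1,\dots,F_d):\mathbb{R}^d\to\mathbb{R}^d$ is locally Lipschitz continuous and its $d$-th component $F:=F_d$ has polynomial growth: there are constants $C,p>0$ with $|F(\mathbf{x})|\le C(1+\|\mathbf{x}\|^p)$ for all $\mathbf{x}\in\mathbb{R}^d$. (ii) $\mathbf{A}=(A_{ij})\in\mathbb{R}^{d\times m}$ is such that $A:=(\sum_{j=1}^m A_{dj}^2)^{1/2}>0$. (iii) For every random variable $\mathbf{X}_0:\Omega\to\mathbb{R}^d$ independent of $\mathbf{W}$ there exists a process $\mathbf{X}=(\mathbf{X}_t)_{t\ge0}$ with continuous sample paths that solves the SDE in the sense that for every $t\ge 0$ it holds $P$-a.s. that $\mathbf{X}_t=\mathbf{X}_0+\int_0^t\mathbf{F}(\mathbf{X}_s)\,\mathrm{d}s+\mathbf{A}\mathbf{W}_t$. The SDE is said to admit an invariant probability measure $\mu$ on $\mathbb{R}^d$ if the initial condition $\mathbf{X}_0\sim\mu$ implies that the corresponding solution process is stationary. For a real-valued process $X=(X_t)_{t\ge0}$, $\delta>0$ and $j\in\mathbb{N}$ put $\Delta X_{j,\delta}:=X_{j\delta}-X_{(j-1)\delta}$.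 Occurrence times of sign changes of the increments: $R_{1,\delta}(X):=\min\{n\in\mathbb{N}:\Delta X_{n+1,\delta}\Delta X_{n,\delta}<0\}$ and, for $j\ge2$, $R_{j,\delta}(X):=\min\{n\in\mathbb{N},\,n>R_{j-1,\delta}(X):\Delta X_{n+1,\delta}\Delta X_{n,\delta}<0\}$, with $\min\emptyset:=\infty$. Lengths of monotone runs: $T_{1,\delta}(X):=R_{1,\delta}(X)$ and $T_{j,\delta}(X):=R_{j,\delta}(X)-R_{j-1,\delta}(X)$ for $j\ge2$. *)

(* Defs.v *)
From HB Require Import structures.
From mathcomp Require Import all_boot all_order all_algebra.
From mathcomp Require Import all_classical all_reals all_analysis.

Set Implicit Arguments.
Unset Strict Implicit.
Unset Printing Implicit Defensive.

Import Order.TTheory GRing.Theory Num.Theory.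
Import numFieldNormedType.Exports.

Local Open Scope classical_set_scope.
Local Open Scope ring_scope.

(* R^n, as column vectors, with its Borel sigma-algebra. The norm `|x| of
   MathComp-Analysis on column vectors is the maximum norm; the assumptions
   below that involve a norm do not depend on which norm is used. *)
Definition borel_cV (R : realType) (n : nat) :=
  g_sigma_algebraType (@open 'cV[R]_n).

Section processes.
Context (R : realType) (dsp : measure_display) (T : measurableType dsp).
Variable P : probability T R.

Definition random_vector (n : nat) (Y : T -> 'cV[R]_n) : Prop :=
  measurable_fun [set: T] (Y : T -> borel_cV R n).

Definition has_law (n : nat) (Y : T -> 'cV[R]_n)
    (mu : probability (borel_cV R n) R) : Prop :=
  forall B : set (borel_cV R n), measurable B -> P (Y @^-1` B) = mu B.

Definition sigma_vector (n : nat) (Y : T -> 'cV[R]_n) : set (set T) :=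
  [set Y @^-1` B | B in (measurable : set (set (borel_cV R n)))].

Definition sigma_process (n : nat) (I : set R) (W : R -> T -> 'cV[R]_n) :
    set (set T) :=
  <<s \bigcup_(t in I) sigma_vector (W t) >>.

Definition independent (G H : set (set T)) : Prop :=
  forall E1 E2, G E1 -> H E2 -> P (E1 `&` E2) = (P E1 * P E2)%E.

Definition independent_of_process (n k : nat) (Y : T -> 'cV[R]_n)
    (W : R -> T -> 'cV[R]_k) : Prop :=
  independent (sigma_vector Y) (sigma_process [set t | 0 <= t] W).

(* Processes indexed by t >= 0 are functions on R of which only the values at
   t >= 0 are ever used. *)
Definition continuous_path (n : nat) (x : R -> 'cV[R]_n) : Prop :=
  {within [set t | 0 <= t], continuous x}.

(* The second parameter of [normal_prob] is the standard deviation. *)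
Definition standard_brownian_motion (n : nat) (W : R -> T -> 'cV[R]_n) : Prop :=
  [/\ forall t, 0 <= t -> random_vector (W t),
      {ae P, forall w, W 0 w = 0},
      {ae P, forall w, continuous_path (W ^~ w)},
      forall s t, 0 <= s -> s < t ->
        forall B : 'I_n -> set R, (forall i, measurable (B i)) ->
        P [set w | forall i, B i ((W t w - W s w) i 0)] =
        (\prod_(i < n) normal_prob 0 (Num.sqrt (t - s)) (B i))%E
    & forall s t, 0 <= s -> s < t ->
        independent (sigma_vector (fun w => W t w - W s w))
                    (sigma_process [set u | 0 <= u <= s] W)].

Definition stationary (n : nat) (X : R -> T -> 'cV[R]_n) : Prop :=
  forall (h : R) (k : nat) (t : 'I_k -> R), 0 <= h -> (forall i, 0 <= t i) ->
  forall B : set (k.-tuple (borel_cV R n)), measurable B ->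
    P [set w | B [tuple X (t i + h) w | i < k]] =
    P [set w | B [tuple X (t i) w | i < k]].

Section sde.
Context (d m : nat).
Variables (F : 'cV[R]_d -> 'cV[R]_d) (A : 'M[R]_(d, m)).
Variable W : R -> T -> 'cV[R]_m.

Definition sde_solution (X : R -> T -> 'cV[R]_d) : Prop :=
  [/\ forall t, 0 <= t -> random_vector (X t),
      forall w, continuous_path (X ^~ w)
    & forall t, 0 <= t -> {ae P, forall w,
        X t w = X 0 w
          + \col_i (\int[lebesgue_measure]_(s in `[0, t]) (F (X s w) i 0))
          + A *m W t w}].

Definition sde_solvable : Prop :=
  forall X0 : T -> 'cV[R]_d, random_vector X0 -> independent_of_process X0 W ->
  exists2 X : R -> T -> 'cV[R]_d, X 0 = X0 & sde_solution X.

Definition sde_invariant_probability (mu : probability (borel_cV R d) R) :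
    Prop :=
  forall X : R -> T -> 'cV[R]_d, sde_solution X ->
    independent_of_process (X 0) W -> has_law (X 0) mu -> stationary X.

End sde.

Definition ergodicity_condition (d : nat) (mu : probability (borel_cV R d) R)
    (X : R -> T -> 'cV[R]_d) : Prop :=
  forall B : set (borel_cV R d), measurable B ->
  forall delta : R, 0 < delta -> forall eps : R, 0 < eps ->
    P [set w | eps < `| N%:R^-1 * (\sum_(0 <= n < N) \1_B (X (n%:R * delta) w))
                        - fine (mu B) |] @[N --> \oo] --> 0%E.

End processes.

Section drift_assumptions.
Context (R : realType) (d : nat).

Definition locally_lipschitz (F : 'cV[R]_d -> 'cV[R]_d) : Prop :=
  forall x : 'cV[R]_d,
    exists2 U : set 'cV[R]_d, nbhs x U & [lipschitz F y | y in U].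

Definition polynomial_growth (f : 'cV[R]_d -> R) : Prop :=
  exists C p : R, [/\ 0 < C, 0 < p & forall x, `|f x| <= C * (1 + `|x| `^ p)].

End drift_assumptions.

Section monotone_runs.
Context (R : realType).
Variables (x : R -> R) (delta : R).

Definition increment (j : nat) : R := x (j%:R * delta) - x (j.-1%:R * delta).

(* R_{j,delta}, with R_{0,delta} := 0. The infimum in the extended reals of a
   set of natural numbers is its minimum, and is +oo when the set is empty. *)
Fixpoint run_end (j : nat) : \bar R :=
  if j is k.+1 then
    ereal_inf [set n%:R%:E | n in [set n : nat |
      [/\ (0 < n)%N, (run_end k < n%:R%:E)%E
        & increment n.+1 * increment n < 0]]]
  else 0%E.

(* T_{j,delta} for j >= 1. The case distinction only serves to set
   +oo - +oo := +oo. *)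
Definition run_length (j : nat) : \bar R :=
  if run_end j == +oo%E then +oo%E else (run_end j - run_end j.-1)%E.

Definition mean_run_length (J : nat) : \bar R :=
  ((J%:R^-1)%:E * \sum_(1 <= j < J.+1) run_length j)%E.

End monotone_runs.

(* For a single path x, the iterated limit of the mean run lengths, first
   J -> oo and then delta -> 0+, exists and equals 2. *)
Definition mean_run_length_limit_is_2 (R : realType) (x : R -> R) : Prop :=
  (\forall delta \near (0 : R)^'+, cvgn (mean_run_length x delta)) /\
  limn (mean_run_length x delta) @[delta --> (0 : R)^'+] --> 2%:E.

(* Main.v *)
Require Import Defs.
From HB Require Import structures.
From mathcomp Require Import all_boot all_order all_algebra.
From mathcomp Require Import all_classical all_reals all_analysis.
From mathcomp Require Import measurable_realfun ring lra zify.

Set Implicit Arguments.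
Unset Strict Implicit.
Unset Printing Implicit Defensive.

Import Order.TTheory GRing.Theory Num.Theory.
Import numFieldNormedType.Exports.

Local Open Scope classical_set_scope.
Local Open Scope ring_scope.

(** The sign changes of the increments of a path with step [delta] occur with a
    frequency; if this frequency is [p > 0], then the J-th sign change occurs
    after about [J / p] steps, so the mean run length is [1 / p]
    ([mean_run_length_cvg]).  Over a short step the increments of the last
    coordinate are, up to an error of order [delta], increments of a Brownian
    motion, of order [Num.sqrt delta]; two successive ones are nearly
    independent and symmetric, so that they have opposite signs with
    probability close to [1 / 2] ([turn_prob_cvg]).  If the frequency were always
    the probability, the limit would be [2].

    The difficulty is that the limits are to exist almost surely for all small
    [delta] at once, whereas ergodicity is assumed for each [delta] separately,
    in probability only, and for the values of the process at single times
    instead of events that involve several times.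

    From one time to path events: solutions are limits of Euler's scheme and
    thus measurable functions of their starting point and of the Brownian
    increments ([solution_mapE]), which yields the Markov property with a kernel
    [path_kernel].  The indicators of a path event, seen along a lattice, minus
    the kernel at the current state are orthogonal when far apart, so only the
    average of the kernel matters, which the ergodicity condition controls
    ([law_of_large_numbers]).

    From probability to almost sure: the maximal ergodic inequality, for a
    stationary sequence and a rare event, turns the weak law into an almost sure
    asymptotic upper bound of the visit frequency ([visits_upper]).

    From one [delta] to all: near a fixed [delta0], a sign change with step
    [delta] at the time [(n + m) delta] forces a nearly negative turn for some
    step close to [delta0] at a time close to [k h + m delta0], with a lattice
    point [k h] close to [n delta].  The latter condition does not depend on
    [delta], so one null set serves for all [delta] near [delta0], and countably
    many for all [delta > 0] ([turn_count_visits], [all_turn_frequencies]).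
    This gives upper bounds for the frequency of the turns of either sign; as
    flat increments have probability zero ([increment_neq0]), the two upper
    bounds add up to nearly [1], and the frequency converges.

    For the solutions started from a point [x]: the same null set of paths serves
    for them, as its probability under the stationary law is the integral over
    [x] of the kernel, which therefore vanishes almost everywhere
    ([path_event_null]); by uniqueness in law every solution from [x] avoids the
    null set ([path_kernel_start]). *)

(** * Independence of sigma-algebras *)

Section law_of_random_element.
Context {d d'} {T : measurableType d} {S : measurableType d'} {R : realType}.

Definition mfun_of (f : T -> S) (mf : measurable_fun [set: T] f) :
    {mfun T >-> S} :=
  MeasurableFun.Pack (MeasurableFun.Class (isMeasurableFun.Build _ _ _ _ _ mf)).

Definition law (P : probability T R) (f : T -> S)
    (mf : measurable_fun [set: T] f) : probability S R :=
  distribution P (mfun_of mf).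

Lemma preimage_measurable (f : T -> S) (B : set S) :
  measurable_fun [set: T] f -> measurable B -> measurable (f @^-1` B).
Proof. by move=> mf mB; rewrite -[_ @^-1` _]setTI; exact: mf. Qed.

End law_of_random_element.

Section level_sets.
Context {d} {T : measurableType d} {R : realType} (f : T -> R).
Hypothesis mf : measurable_fun [set: T] f.

Let meas (i : interval R) : measurable (f @^-1` [set` i]).
Proof. exact: (preimage_measurable mf (measurable_itv i)). Qed.

Lemma measurable_gt_set a : measurable [set w | a < f w].
Proof.
have := meas `]a, +oo[; congr (measurable _).
by apply/seteqP; split => w /=; rewrite in_itv/= andbT.
Qed.

Lemma measurable_ge_set a : measurable [set w | a <= f w].
Proof.
have := meas `[a, +oo[; congr (measurable _).
by apply/seteqP; split => w /=; rewrite in_itv/= andbT.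
Qed.

Lemma measurable_lt_set a : measurable [set w | f w < a].
Proof. by have := meas `]-oo, a[. Qed.

Lemma measurable_le_set a : measurable [set w | f w <= a].
Proof. by have := meas `]-oo, a]. Qed.

Lemma measurable_eq_set (g : T -> R) : measurable_fun [set: T] g ->
  measurable [set w | f w = g w].
Proof.
move=> mg; have := preimage_measurable (measurable_funB mf mg) (measurable_set1 0).
congr (measurable _); apply/seteqP; split => w /=.
  by move/eqP; rewrite subr_eq0 => /eqP.
by move->; rewrite subrr.
Qed.

End level_sets.

Lemma measurable_norm_le_set {d} {T : measurableType d} {R : realType} (f : T -> R) :
  measurable_fun [set: T] f -> forall a, measurable [set w | `|f w| <= a].
Proof.
by move=> mf a; apply: (measurable_le_set (f := fun w => `|f w|)); exact: measurableT_comp.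
Qed.

Section pi_lambda.
Context {d} {T : measurableType d} {R : realType}.
Local Open Scope ereal_scope.

(** The pi-lambda theorem; the whole space is added to the generators to provide
    the covering by sets of finite measure. *)
Lemma finite_measure_eq_pi (m1 m2 : {measure set T -> \bar R}) G :
  setI_closed G -> G `<=` measurable -> m1 setT < +oo -> m1 setT = m2 setT ->
  (forall A, G A -> m1 A = m2 A) -> forall A, <<s G >> A -> m1 A = m2 A.
Proof.
move=> GI Gm m1T m12T m12 A sA.
pose G' := G `|` [set setT].
apply: (@g_sigma_algebra_measure_unique _ _ _ G' _ (fun=> setT)) => //.
- by move=> B [/Gm//|->].
- by move=> _; right.
- by rewrite bigcup_const.
- move=> B C [GB|->] [GC|->]; rewrite ?setTI ?setIT; [left|left|left|right] => //.
  exact: GI.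
- by move=> B [/m12//|->].
- by apply: sub_sigma_algebra2 sA => B GB; left.
Qed.

Variable P : probability T R.

(** For fixed [E], both sides are finite measures of [A] with the same mass. *)
Lemma indep_event_pi E G : measurable E -> setI_closed G -> G `<=` measurable ->
  (forall A, G A -> P (E `&` A) = P E * P A) ->
  forall A, <<s G >> A -> P (E `&` A) = P E * P A.
Proof.
move=> mE GI Gm h A sA.
have PE0 : (0 <= fine (P E))%R by rewrite fine_ge0.
have PEE : (fine (P E))%:E = P E by rewrite fineK// fin_num_measure.
have sc B : mscale (NngNum PE0) P B = P E * P B.
  by rewrite -[in RHS]PEE.
have := @finite_measure_eq_pi (mrestr P mE) (mscale (NngNum PE0) P) G GI Gm.
rewrite /= /mrestr setTI !sc probability_setT mule1 => /(_ _ erefl) H.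
rewrite setIC -sc; apply: H => //.
- by rewrite -PEE ltry.
- by move=> B GB; rewrite sc setIC h.
Qed.

Lemma independentC G H : independent P G H -> independent P H G.
Proof. by move=> h E1 E2 hE gE; rewrite setIC h// muleC. Qed.

Lemma independent_pi G H : G `<=` measurable -> H `<=` measurable ->
  setI_closed H -> independent P G H -> independent P G <<s H >>.
Proof.
move=> Gm Hm HI h E A GE HA; apply: (indep_event_pi (G := H)) => //.
- exact: Gm.
- by move=> B; exact: h.
Qed.

Lemma sub_independent G G' H H' : G `<=` G' -> H `<=` H' ->
  independent P G' H' -> independent P G H.
Proof. by move=> GG HH h E A /GG GE /HH HE; exact: h. Qed.

Lemma sigma_sub_measurable (G : set (set T)) :
  G `<=` measurable -> <<s G >> `<=` measurable.
Proof.
move=> Gm; apply: smallest_sub => //; split => //.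
- by move=> A mA; exact: measurableD.
- by move=> F mF; exact: bigcupT_measurable.
Qed.

End pi_lambda.

(** For [Y] independent of the sigma-algebra generated by [H], the pair of [Y]
    and the identity has the product law; integrating a function of the pair may
    therefore be done with two independent copies of the sample point. *)
Section joint_law.
Context {d d'} {T : measurableType d} {S : measurableType d'} {R : realType}.
Variables (P : probability T R) (Y : T -> S) (H : set (set T)).
Hypothesis mY : measurable_fun [set: T] Y.
Hypothesis Hm : H `<=` measurable.
Hypothesis indepYH :
  independent P [set Y @^-1` B | B in measurable] <<s H >>.
Local Open Scope ereal_scope.

Local Notation TH := (g_sigma_algebraType H).

Let mid : measurable_fun [set: T] (fun w => w : TH).
Proof. by move=> _ B mB; rewrite setTI; exact: (sigma_sub_measurable Hm). Qed.

Let mpair : measurable_fun [set: T] (fun w => (Y w, w) : S * TH).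
Proof. exact: measurable_fun_pair. Qed.

Lemma indep_pair_integral (phi : S * TH -> \bar R) :
  measurable_fun [set: S * TH] phi -> (forall z, 0 <= phi z) ->
  \int[P]_w phi (Y w, w) = \int[P]_w \int[P]_w' phi (Y w, w').
Proof.
move=> mphi phi0.
transitivity (\int[law P mpair]_z phi z).
  by rewrite ge0_integral_pushforward.
transitivity (\int[law P mY \x law P mid]_z phi z).
  apply: eq_measure_integral => A mA _; apply/esym.
  apply: product_measure_unique => // B C mB mC.
  transitivity (P (Y @^-1` B `&` C)); first by [].
  by apply: indepYH => //; exists B.
rewrite fubini_tonelli1// /fubini_F.
rewrite ge0_integral_pushforward//=; last 2 first.
- exact: (@measurable_fun_fubini_tonelli_F _ _ _ _ _ (law P mid)).
- by move=> y _; exact: integral_ge0.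
apply: eq_integral => w _ /=.
rewrite ge0_integral_pushforward//=.
by apply: measurableT_comp => //; exact: pair1_measurable.
Qed.

Lemma measurable_fun_pair_integral (phi : S * TH -> \bar R) :
  measurable_fun [set: S * TH] phi -> (forall z, 0 <= phi z) ->
  measurable_fun [set: S] (fun y => \int[P]_w phi (y, w)).
Proof.
move=> mphi phi0.
have := @measurable_fun_fubini_tonelli_F _ _ _ _ _ (law P mid) phi mphi phi0.
apply: eq_measurable_fun => y _; rewrite /fubini_F ge0_integral_pushforward//=.
by apply: measurableT_comp => //; exact: pair1_measurable.
Qed.

End joint_law.

(** * Borel sets of R^n and the path space *)

Section borel_vectors.
Context {R : realType}.

Lemma measurable_coord n (i : 'I_n) :
  measurable_fun [set: borel_cV R n] (fun x : borel_cV R n => x i 0).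
Proof.
apply: (measurability _ (RGenOpens.measurableE R)) => _ [_ [a [b ->] <-]].
rewrite setTI; apply: sub_sigma_algebra.
by apply: open_comp; [move=> x _; exact: coord_continuous | exact: interval_open].
Qed.

Context {d} {T : measurableType d}.

(** R^n is second countable: an open set is the union of the rational cubes
    it contains, so that coordinatewise measurability suffices. *)
Lemma random_vector_coord n (f : T -> 'cV[R]_n) :
  (forall i, measurable_fun [set: T] (fun w => f w i 0)) -> random_vector f.
Proof.
move=> mf; apply: (@measurability _ _ T (borel_cV R n) setT f open) => // _ [U oU <-].
rewrite setTI.
pose cube (p : 'cV[rat]_n * nat) : set 'cV[R]_n :=
  [set x | forall i, `|x i 0 - ratr (p.1 i 0)| < p.2.+1%:R^-1].
have -> : f @^-1` U = \bigcup_(p in [set p | cube p `<=` U]) (f @^-1` cube p).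
  apply/seteqP; split=> [w Ufw|w [p /= pU]]; last exact: pU.
  have /nbhs_ballP[e /= e0 eU] : nbhs (f w) U by exact: open_nbhs_nbhs.
  have [k _ /(_ k (leqnn k))/= ke] := near_infty_natSinv_lt (PosNum (divr_gt0 e0 (ltr0n R 2))).
  have k0 : 0 < k.+1%:R^-1 :> R by rewrite invr_gt0.
  rewrite /bigcup/= /cube/=; set u := k.+1%:R^-1 in ke k0.
  have /choice[q qP] : forall i, exists q : rat, `|f w i 0 - ratr q| < u.
    move=> i; have : f w i 0 - u < f w i 0 + u by lra.
    move=> /rat_in_itvoo[q]; rewrite in_itv/= => /andP[q1 q2]; exists q.
    by rewrite ltr_norml; apply/andP; split; lra.
  exists (\col_i q i, k) => /= [x xP|i]; last by rewrite mxE.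
  apply: eU; split=> // i j; rewrite (ord1 j) /ball/=.
  have := qP i; have := xP i; rewrite /= mxE -/u !ltr_norml.
  by move=> /andP[? ?] /andP[? ?]; apply/andP; split; lra.
rewrite bigcup_mkcond; apply: countable_bigcupT_measurable => // p.
case: ifPn => // _.
have -> : f @^-1` cube p = \bigcap_(i in [set: 'I_n])
    ((fun w => f w i 0) @^-1` ball (ratr (p.1 i 0) : R) p.2.+1%:R^-1).
  apply/seteqP; split=> w /= h i; first by move=> _; rewrite /ball/= distrC.
  by have := h i I; rewrite /ball/= distrC.
apply: fin_bigcap_measurable => // i _; rewrite -[X in measurable X]setTI.
apply: mf => //; apply: open_measurable; exact: ball_open.
Qed.

Lemma measurable_coord_of n (f : T -> 'cV[R]_n) i :
  random_vector f -> measurable_fun [set: T] (fun w => f w i 0).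
Proof. by move=> mf; exact: (measurableT_comp (measurable_coord i) mf). Qed.

Lemma random_vectorD n (f g : T -> 'cV[R]_n) :
  random_vector f -> random_vector g -> random_vector (fun w => f w + g w).
Proof.
move=> mf mg; apply: random_vector_coord => i; under eq_fun do rewrite mxE.
by apply: measurable_funD; exact: measurable_coord_of.
Qed.

Lemma random_vectorZ n (c : R) (f : T -> 'cV[R]_n) :
  random_vector f -> random_vector (fun w => c *: f w).
Proof.
move=> mf; apply: random_vector_coord => i; under eq_fun do rewrite mxE.
by apply: measurable_funM => //; exact: measurable_coord_of.
Qed.

Lemma random_vectorB n (f g : T -> 'cV[R]_n) :
  random_vector f -> random_vector g -> random_vector (fun w => f w - g w).
Proof.
move=> mf mg; apply: random_vector_coord => i; under eq_fun do rewrite !mxE.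
by apply: measurable_funB; exact: measurable_coord_of.
Qed.

Lemma random_vector_mulmx n m (A : 'M[R]_(n, m)) (f : T -> 'cV[R]_m) :
  random_vector f -> random_vector (fun w => A *m f w).
Proof.
move=> mf; apply: random_vector_coord => i; under eq_fun do rewrite mxE.
apply: measurable_sum => j.
by apply: measurable_funM => //; exact: measurable_coord_of.
Qed.

Lemma random_vector_continuous n m (F : 'cV[R]_n -> 'cV[R]_m)
    (f : T -> 'cV[R]_n) :
  (forall U, open U -> open (F @^-1` U)) ->
  random_vector f -> random_vector (fun w => F (f w)).
Proof.
move=> cF mf.
have mF : @measurable_fun _ _ (borel_cV R n) (borel_cV R m) setT F.
  apply: (@measurability _ _ (borel_cV R n) (borel_cV R m) setT F open) => //.
  move=> _ [U oU <-]; rewrite setTI; apply: sub_sigma_algebra.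
  exact: cF.
exact: (measurableT_comp mF mf).
Qed.

End borel_vectors.

Lemma cV_norm_coord (R : realType) n (x : 'cV[R]_n) i : `|x i 0| <= `|x|.
Proof.
rewrite [leRHS]/Num.norm /= mx_normrE.
by apply/bigmax_geP; right => /=; exists (i, 0).
Qed.

Lemma cV_norm_le (R : realType) n (x : 'cV[R]_n) c :
  0 <= c -> (forall i, `|x i 0| <= c) -> `|x| <= c.
Proof.
move=> c0 h; rewrite [leLHS]/Num.norm /= mx_normrE.
by apply/bigmax_leP; split => // -[i j] _ /=; rewrite (ord1 j).
Qed.

(** Cylinder sets form a pi-system generating the sigma-algebra of a process. *)
Section cylinders.
Context {R : realType} {T : pointedType} {n : nat}.
Variables (I : set R) (X : R -> T -> 'cV[R]_n).

Inductive cylinder : set (set T) :=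
| cylinderT : cylinder setT
| cylinderI t (B : set (borel_cV R n)) A :
    I t -> measurable B -> cylinder A -> cylinder (X t @^-1` B `&` A).

Lemma cylinder_setI : setI_closed cylinder.
Proof.
move=> A B cA cB; elim: cA => [|t C D It mC cD cDB]; first by rewrite setTI.
by rewrite -setIA; exact: cylinderI.
Qed.

End cylinders.

Section sigma_process.
Context {R : realType} {d} {T : measurableType d} {n : nat}.
Variables (I : set R) (X : R -> T -> 'cV[R]_n).

Lemma sigma_process_cylinder : sigma_process I X = <<s cylinder I X >>.
Proof.
apply/seteqP; split.
  apply: smallest_sub; first exact: smallest_sigma_algebra.
  move=> _ [t It [B mB <-]]; rewrite -[X t @^-1` B]setIT.
  apply: sub_sigma_algebra; apply: cylinderI => //; exact: cylinderT.
apply: smallest_sub; first exact: smallest_sigma_algebra.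
pose G := \bigcup_(t in I) sigma_vector (X t).
move=> A; elim => [|t B C It mB _ sC].
  exact: (@measurableT _ (g_sigma_algebraType G)).
apply: (@measurableI _ (g_sigma_algebraType G)) => //.
by apply: sub_sigma_algebra; exists t => //; exists B.
Qed.

Lemma setI_closed_sigma_process : setI_closed (sigma_process I X).
Proof.
exact: (@measurableI _ (g_sigma_algebraType (\bigcup_(t in I) sigma_vector (X t)))).
Qed.

Lemma sigma_vector_process t : I t -> sigma_vector (X t) `<=` sigma_process I X.
Proof. by move=> It A XA; apply: sub_sigma_algebra; exists t. Qed.

Hypothesis mX : forall t, I t -> random_vector (X t).

Lemma sigma_process_measurable : sigma_process I X `<=` measurable.
Proof.
apply: sigma_sub_measurable => _ [t It [B mB <-]].
exact: (preimage_measurable (mX It)).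
Qed.

End sigma_process.

Lemma sub_sigma_process (R : realType) d (T : measurableType d) n
    (I J : set R) (X : R -> T -> 'cV[R]_n) :
  I `<=` J -> sigma_process I X `<=` sigma_process J X.
Proof. by move=> IJ; apply: sub_sigma_algebra2 => A [t /IJ Jt XA]; exists t. Qed.

Section path_space.
Context {R : realType} {n : nat}.

Definition coordinate (t : R) (x : R -> 'cV[R]_n) := x t.

(** Only the times [t >= 0] are observed, and no regularity of the paths is
    built in, so that every process has its paths in this space. *)
Definition path_space :=
  g_sigma_algebraType (cylinder [set t : R | 0 <= t] coordinate).

Definition path_until (c : R) : set (set (R -> 'cV[R]_n)) :=
  <<s cylinder [set t : R | 0 <= t <= c] coordinate >>.

Definition shift_path (h : R) (x : R -> 'cV[R]_n) : R -> 'cV[R]_n :=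
  fun t => x (t + h).

Lemma measurable_coordinate t : 0 <= t ->
  @measurable_fun _ _ path_space (borel_cV R n) setT (coordinate t).
Proof.
move=> t0 _ B mB; rewrite setTI -[_ @^-1` _]setIT; apply: sub_sigma_algebra.
by apply: cylinderI => //; exact: cylinderT.
Qed.

Lemma measurable_path {d} {T : measurableType d} (X : R -> T -> 'cV[R]_n) :
  (forall t, 0 <= t -> random_vector (X t)) ->
  @measurable_fun _ _ T path_space setT (fun w t => X t w).
Proof.
move=> mX; apply: (@measurability _ _ T path_space setT _
  (cylinder [set t : R | 0 <= t] coordinate)) => // _ [A cA <-].
rewrite setTI; elim: cA => [|t B C t0 mB _ mC]; first by rewrite preimage_setT.
by rewrite preimage_setI; apply: measurableI => //; exact: (preimage_measurable (mX t t0)).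
Qed.

Lemma path_until_sub c : path_until c `<=` (measurable : set (set path_space)).
Proof.
rewrite /path_until; apply: sub_sigma_algebra2 => A; elim; first exact: cylinderT.
by move=> t B C /= /andP[t0 _] mB _ cC; exact: cylinderI.
Qed.

(** The law of a process on path space is determined by its cylinders. *)
Lemma path_law_eq {d d'} {T : measurableType d} {T' : measurableType d'}
    (P : probability T R) (P' : probability T' R)
    (X : R -> T -> 'cV[R]_n) (Y : R -> T' -> 'cV[R]_n) :
  (forall t, 0 <= t -> random_vector (X t)) ->
  (forall t, 0 <= t -> random_vector (Y t)) ->
  (forall A, cylinder [set t : R | 0 <= t] coordinate A ->
     P [set w | A (X ^~ w)] = P' [set w | A (Y ^~ w)]) ->
  forall A : set path_space, measurable A ->
     P [set w | A (X ^~ w)] = P' [set w | A (Y ^~ w)].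
Proof.
move=> mX mY XY A mA.
have mX' := measurable_path mX; have mY' := measurable_path mY.
apply: (@finite_measure_eq_pi _ path_space R (law P mX') (law P' mY')
  (cylinder [set t : R | 0 <= t] coordinate)) => //.
- exact: cylinder_setI.
- exact: sub_sigma_algebra.
- by rewrite [ltLHS](probability_setT (law P mX')) ltry.
- exact: (etrans (probability_setT _) (esym (probability_setT _))).
Qed.

End path_space.

Arguments path_space : clear implicits.

(** * Independence of the past and the future Brownian increments *)

Section adapted.
Context {R : realType} {dsp} {T : measurableType dsp} (G : set (set T)).

Lemma sigma_vector_sub n (Y : T -> 'cV[R]_n) :
  @random_vector R _ (g_sigma_algebraType G) n Y ->
  sigma_vector Y `<=` <<s G >>.
Proof. by move=> mY _ [B mB <-]; rewrite -[_ @^-1` _]setTI; exact: mY. Qed.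

Lemma random_vector_sub n (Y : T -> 'cV[R]_n) :
  sigma_vector Y `<=` <<s G >> -> @random_vector R _ (g_sigma_algebraType G) n Y.
Proof. by move=> YG _ B mB; rewrite setTI; apply: YG; exists B. Qed.

Lemma sigma_process_sub n (I : set R) (Y : R -> T -> 'cV[R]_n) :
  (forall t, I t -> sigma_vector (Y t) `<=` <<s G >>) ->
  sigma_process I Y `<=` <<s G >>.
Proof.
move=> YG; apply: smallest_sub; first exact: smallest_sigma_algebra.
by move=> A [t It]; exact: YG.
Qed.

End adapted.

Definition future_increment {R : realType} {dsp} {T : measurableType dsp} {n}
  (W : R -> T -> 'cV[R]_n) (t u : R) (w : T) := W (t + u) w - W t w.

Definition past {R : realType} {dsp} {T : measurableType dsp} {n m}
    (X0 : T -> 'cV[R]_n) (W : R -> T -> 'cV[R]_m) (t : R) : set (set T) :=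
  [set X0 @^-1` B `&` E | B in (measurable : set (set (borel_cV R n)))
                        & E in sigma_process [set u | 0 <= u <= t] W].

Section brownian_independence.
Context {R : realType} {dsp} {T : measurableType dsp} (P : probability T R).
Context {m : nat} (W : R -> T -> 'cV[R]_m).
Hypothesis BW : standard_brownian_motion P W.

Let mW t : 0 <= t -> random_vector (W t).
Proof. by case: BW => h _ _ _ _; exact: h. Qed.

Lemma random_vector_future_increment t u : 0 <= t -> 0 <= u ->
  random_vector (future_increment W t u).
Proof.
by move=> t0 u0; apply: random_vectorB; apply: mW => //; exact: addr_ge0.
Qed.

Let Ft t := sigma_process [set u | 0 <= u <= t] W.
Let K t (l : seq R) := sigma_process [set` l] (future_increment W t).

Let Ft_measurable t : Ft t `<=` measurable.
Proof. by apply: sigma_process_measurable => u /andP[u0 _]; exact: mW. Qed.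

Let K_measurable t l : 0 <= t -> all (fun u => 0 <= u) l -> K t l `<=` measurable.
Proof.
move=> t0 /allP l0; apply: sigma_process_measurable => u /= ul.
by apply: random_vector_future_increment => //; exact: l0.
Qed.

Let K_Ft t l s : 0 <= t -> (forall u, u \in l -> 0 <= u <= s) ->
  K t l `<=` Ft (t + s).
Proof.
move=> t0 ls; apply: sigma_process_sub => u /= /ls /andP[u0 us].
apply: sigma_vector_sub; apply: random_vectorB; apply: random_vector_sub;
  apply: (@sigma_vector_process _ _ _ _ [set u | 0 <= u <= t + s] W) => /=.
- by rewrite addr_ge0//= lerD2l.
- by rewrite t0/= lerDl (le_trans u0).
Qed.

(** Induction on the increasing list of times: the increment up to the last time
    [v] is the one up to the time [s] before it, plus [W (t + v) - W (t + s)],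
    which is independent of everything up to [t + s]. *)
Let Ft_indep_K t l : 0 <= t -> path <=%R 0 l ->
  independent P (Ft t) (K t (0 :: l)).
Proof.
move=> t0; elim/last_ind: l => [_|l v IH].
  move=> E C /Ft_measurable mE; rewrite /K.
  suff : sigma_process [set` [:: 0 : R]] (future_increment W t) `<=`
      [set set0; setT].
    move=> /[apply] -[] ->; first by rewrite setI0 measure0 mule0.
    by rewrite setIT probability_setT mule1.
  have sa : sigma_algebra setT [set set0; [set: T]].
    split; first by left.
    - by move=> A [->|->]; rewrite setTD ?setC0 ?setCT; [right|left].
    - move=> A hA; have [[k Ak]|no] := pselect (exists k, A k = setT).
        by right; rewrite /= -subTset => x _; exists k => //; rewrite Ak.
      left; rewrite /= -subset0 => x [k _]; have [->//|Ak] := hA k.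
      by exfalso; apply: no; exists k.
  apply: smallest_sub => // _ [t' /= t'0 [B mB <-]].
  move: t'0; rewrite inE => /eqP ->.
  rewrite /future_increment addr0.
  have [B0|B0] := pselect (B 0); [right|left].
    by rewrite /= -subTset => x _ /=; rewrite subrr.
  by rewrite /= -subset0 => x /=; rewrite subrr.
rewrite rcons_path => /andP[pl sv]; have {}IH := IH pl.
set s := last 0 l in sv.
have sl : s \in 0 :: l by exact: mem_last.
have l0s u : u \in 0 :: l -> 0 <= u <= s.
  have le_last (a : R) p : path <=%R a p -> a <= last a p.
    move=> /(order_path_min le_trans)/allP ap.
    have := mem_last a p; rewrite inE => /orP[/eqP->//|/ap//].
  move=> ul; move: pl; rewrite /s; case/splitPl: ul => l1 l2 <-.
  by rewrite cat_path last_cat => /andP[/le_last -> /le_last ->].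
have s0 : 0 <= s by have /andP[] := l0s _ sl.
have [vs|vs] := eqVneq v s.
  move=> E C FE KC; apply: IH => //; move: KC; apply: sub_sigma_process.
  move=> u /=; rewrite inE mem_rcons inE vs => /or3P[/eqP->|/eqP->|ul] //.
  - by rewrite inE eqxx.
  - by rewrite inE ul orbT.
have {vs}{}sv : s < v by rewrite lt_neqAle eq_sym vs.
pose D w := W (t + v) w - W (t + s) w.
have mD : random_vector D.
  by apply: random_vectorB; apply: mW; rewrite addr_ge0// (le_trans s0)// ltW.
pose Pi := [set C `&` D @^-1` B | C in K t (0 :: l)
             & B in (measurable : set (set (borel_cV R m)))].
have l0 : all (fun u => 0 <= u) (0 :: l).
  by apply/allP => u /l0s /andP[].
have Pim : Pi `<=` measurable.
  move=> _ [C KC [B mB <-]]; apply: measurableI; first exact: (K_measurable t0 l0).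
  exact: (preimage_measurable mD).
have PiI : setI_closed Pi.
  move=> _ _ [C KC [B mB <-]] [C' KC' [B' mB' <-]]; exists (C `&` C').
    exact: setI_closed_sigma_process.
  by exists (B `&` B'); [exact: measurableI|rewrite preimage_setI setIACA].
have sub : K t (0 :: rcons l v) `<=` <<s Pi >>.
  have KPi C : K t (0 :: l) C -> <<s Pi >> C.
    move=> KC; apply: sub_sigma_algebra; exists C => //; exists setT => //.
    by rewrite preimage_setT setIT.
  have iPi u : u \in 0 :: l ->
      sigma_vector (future_increment W t u) `<=` <<s Pi >>.
    move=> ul A Au; apply: KPi; move: Au.
    exact: (@sigma_vector_process _ _ _ _ [set` 0 :: l]).
  apply: sigma_process_sub => u /=; rewrite inE mem_rcons inE => /or3P[u0|uv|ul].
  - by apply: iPi; rewrite inE u0.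
  - rewrite (eqP uv) (_ : future_increment W t v =
        fun w => future_increment W t s w + D w); last first.
      by apply/funext => w; rewrite /future_increment /D [RHS]addrC addrA subrK.
    apply: sigma_vector_sub; apply: random_vectorD; apply: random_vector_sub.
      exact: iPi.
    move=> _ [B mB <-]; apply: sub_sigma_algebra; exists setT; last first.
      by exists B => //; rewrite setTI.
    exact: (@measurableT _ (g_sigma_algebraType (\bigcup_(t' in [set` 0 :: l]) sigma_vector (future_increment W t t')))).
  - by apply: iPi; rewrite inE ul orbT.
have FPi : independent P (Ft t) Pi.
  move=> E _ FE [C KC [B mB <-]].
  have indD : independent P (Ft (t + s)) (sigma_vector D).
    apply: independentC; case: BW => _ _ _ _; apply; first exact: addr_ge0.
    by rewrite ltrD2l.
  have DB : sigma_vector D (D @^-1` B) by exists B.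
  have FC : Ft (t + s) C by apply: K_Ft KC.
  rewrite setIA indD//; last first.
    apply: setI_closed_sigma_process => //; move: FE; apply: sub_sigma_process.
    by move=> u /= /andP[-> ut]/=; rewrite (le_trans ut)// lerDl.
  by rewrite IH// [in RHS]indD// muleA.
move=> E C FE KC; apply: (independent_pi (@Ft_measurable t) Pim PiI FPi) => //.
exact: sub.
Qed.

(** An event of the future increments from a pi-system of generators involves
    finitely many times only, which can be sorted. *)
Lemma past_indep_future n (X0 : T -> 'cV[R]_n) t : 0 <= t ->
  random_vector X0 -> independent_of_process P X0 W ->
  independent P <<s past X0 W t >>
    (sigma_process [set u | 0 <= u] (future_increment W t)).
Proof.
move=> t0 mX0 X0W.
have mI u : 0 <= u -> random_vector (future_increment W t u).
  exact: random_vector_future_increment.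
have pastm : past X0 W t `<=` measurable.
  move=> _ [B mB [E FE <-]]; apply: measurableI; first exact: (preimage_measurable mX0).
  exact: Ft_measurable FE.
have pastI : setI_closed (past X0 W t).
  move=> _ _ [B mB [E FE <-]] [B' mB' [E' FE' <-]]; exists (B `&` B').
    exact: measurableI.
  exists (E `&` E'); first exact: setI_closed_sigma_process.
  by rewrite preimage_setI setIACA.
apply: independentC; apply: independent_pi => //.
  exact: (@sigma_process_measurable _ _ _ _ [set u | 0 <= u]).
apply: independentC; rewrite sigma_process_cylinder; apply: independent_pi => //.
- move=> C cC; apply: (@sigma_process_measurable _ _ _ _ [set u | 0 <= u] _ mI).
  by rewrite sigma_process_cylinder; exact: sub_sigma_algebra.
- exact: cylinder_setI.
move=> _ C [B mB [E FE <-]] cC.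
have [l [lC l0]] : exists l, K t l C /\ all (fun u => 0 <= u) l.
  elim: cC => [|u B' C' u0 mB' _ [l [lC l0]]].
    exists [::]; split => //.
    exact: (@measurableT _ (g_sigma_algebraType (\bigcup_(t' in [set` [::]]) sigma_vector (future_increment W t t')))).
  exists (u :: l); split; last by rewrite /= u0 l0.
  apply: setI_closed_sigma_process.
    apply: (@sigma_vector_process _ _ _ _ [set` u :: l]); first exact: mem_head.
    by exists B'.
  by move: lC; apply: sub_sigma_process => v /= vl; rewrite inE vl orbT.
have {}lC : K t (0 :: sort <=%R l) C.
  move: lC; apply: sub_sigma_process => v /= vl.
  by rewrite inE mem_sort vl orbT.
have FK : independent P (Ft t) (K t (0 :: sort <=%R l)).
  apply: Ft_indep_K => //; rewrite path_min_sorted ?sort_sorted//; first exact: le_total.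
  by rewrite all_sort.
have WFE : sigma_process [set t | 0 <= t] W E.
  by move: FE; apply: sub_sigma_process => u /andP[].
have WC : sigma_process [set t | 0 <= t] W C.
  have : all (fun u => 0 <= u) (0 :: sort <=%R l) by rewrite /= lexx all_sort.
  move=> /allP l0'; move: lC; apply: sigma_process_sub => u /= /l0' u0.
  apply: sigma_vector_sub; apply: random_vectorB; apply: random_vector_sub;
    by apply: (@sigma_vector_process _ _ _ _ [set u | 0 <= u] W) => //=; rewrite addr_ge0.
have X0B : sigma_vector X0 (X0 @^-1` B) by exists B.
rewrite -setIA X0W//; last exact: setI_closed_sigma_process.
by rewrite FK// X0W// muleA.
Qed.

End brownian_independence.

(** * Euler's scheme *)

Definition continuous_curve {R : realType} {n} (x : R -> 'cV[R]_n) : Prop :=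
  forall t e, 0 < e ->
  exists2 r, 0 < r & forall s, `|t - s| < r -> `|x t - x s| < e.

Section locally_lipschitz.
Context {R : realType} {d : nat} (F : 'cV[R]_d -> 'cV[R]_d).
Hypothesis lipF : locally_lipschitz F.

Lemma locally_lipschitz_ball x : exists e M : R, [/\ 0 < e, 0 <= M &
  forall y z, `|x - y| < e -> `|x - z| < e -> `|F y - F z| <= M * `|y - z|].
Proof.
have [U /nbhs_ballP[e /= e0 eU] lipU] := lipF x.
near (pinfty_nbhs R) => M.
have M0 : 0 <= M by near: M; exact: nbhs_pinfty_ge.
have lipM : forall p, (U `*` U) p -> `|self_sub F p| <= M * `|self_sub id p|.
  near: M.
  by move: lipU; rewrite /lipschitz_on /dominated_by.
exists e, M; split => // y z xy xz.
by apply: (lipM (y, z)); split; apply: eU; rewrite -ball_normE.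
Unshelve. all: by end_near. Qed.

Lemma locally_lipschitz_preimage_open U : open U -> open (F @^-1` U).
Proof.
rewrite !openE => oU x /oU /nbhs_ballP[eps /= eps0 epsU].
have [e [M [e0 M0 FM]]] := locally_lipschitz_ball x.
have M1 : 0 < M + 1 by rewrite ltr_wpDl.
apply/nbhs_ballP; exists (Num.min e (eps / (M + 1))) => /=.
  by rewrite lt_min e0 divr_gt0.
move=> y; rewrite -ball_normE/= lt_min => /andP[xy].
rewrite ltr_pdivlMr// mulrDr mulr1 mulrC => h.
apply: epsU; rewrite -ball_normE/=.
rewrite (le_lt_trans (FM _ _ _ xy)) ?subrr ?normr0//.
by apply: le_lt_trans h; rewrite lerDl.
Qed.

Variables (x : R -> 'cV[R]_d) (u : R).
Hypothesis cx : continuous_curve x.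

(** Along a compact piece of a continuous path, [F] is Lipschitz with one
    constant, as long as the second point stays close enough to the path. *)
Lemma lipschitz_near_path : exists rho L : R, [/\ 0 < rho, 0 <= L &
  forall t y, 0 <= t <= u -> `|x t - y| < rho ->
    `|F (x t) - F y| <= L * `|x t - y|].
Proof.
have /compact_near_coveringP : compact `[0, u]%classic by exact: segment_compact.
move=> /(_ nat \oo (fun n t => forall y, `|x t - y| < n.+1%:R^-1 ->
  `|F (x t) - F y| <= n%:R * `|x t - y|)) H.
have {H} [N _ /(_ N (leqnn N)) NP] : \forall n \near \oo,
    `[0, u]%classic `<=` [set t | forall y, `|x t - y| < n.+1%:R^-1 ->
      `|F (x t) - F y| <= n%:R * `|x t - y|].
  apply: H => t _; have [e [M [e0 M0 FM]]] := locally_lipschitz_ball (x t).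
  have e20 : 0 < e / 2 by rewrite divr_gt0.
  have [r r0 rP] := cx t e20.
  near=> s n => y xsy.
  have ts : `|x t - x s| < e / 2 by apply: rP; near: s; exact: cvgr_dist_lt.
  have ne : n.+1%:R^-1 < e / 2 by near: n; exact: (near_infty_natSinv_lt (PosNum e20)).
  have Mn : M <= n%:R by near: n; exact: nbhs_infty_ger.
  apply: (le_trans (FM _ _ _ _)).
  - by rewrite (lt_trans ts)// ltr_pdivrMr// ltr_pMr// ltr1n.
  - rewrite -(subrKA (x s)) (le_lt_trans (ler_normD _ _))//.
    by rewrite [ltRHS]splitr ltrD// (lt_trans xsy).
  - exact: ler_wpM2r.
exists N.+1%:R^-1, N%:R; split => // t y t0u; exact: NP.
Unshelve. all: by end_near. Qed.

End locally_lipschitz.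

Section uniform_continuity.
Context {R : realType} {d : nat} (x : R -> 'cV[R]_d) (u : R).
Hypothesis cx : continuous_curve x.

Lemma unif_continuous_path (e : R) : 0 < e -> exists2 eta, 0 < eta &
  forall s t, 0 <= s <= u -> 0 <= t <= u -> `|s - t| < eta ->
    `|x s - x t| < e.
Proof.
move=> e0.
have /compact_near_coveringP : compact `[0, u]%classic by exact: segment_compact.
move=> /(_ nat \oo (fun n t => forall s, `|s - t| < n.+1%:R^-1 ->
  `|x s - x t| < e)) H.
have {H} [N _ /(_ N (leqnn N)) NP] : \forall n \near \oo,
    `[0, u]%classic `<=` [set t | forall s, `|s - t| < n.+1%:R^-1 ->
      `|x s - x t| < e].
  apply: H => t _.
  have e20 : 0 < e / 2 by rewrite divr_gt0.
  have [r r0 rP] := cx t e20.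
  have r20 : 0 < r / 2 by rewrite divr_gt0.
  near=> t' n => s st'.
  have tt' : `|t - t'| < r / 2 by near: t'; exact: cvgr_dist_lt.
  have ne : n.+1%:R^-1 < r / 2 by near: n; exact: (near_infty_natSinv_lt (PosNum r20)).
  rewrite -(subrKA (x t)) (le_lt_trans (ler_normD _ _))// [ltRHS]splitr ltrD//.
    rewrite distrC; apply: rP; rewrite -(subrKA t') [ltRHS]splitr.
    by rewrite (le_lt_trans (ler_normD _ _))// ltrD// distrC (lt_trans st').
  by apply: rP; rewrite (lt_trans tt')// ltr_pdivrMr// ltr_pMr// ltr1n.
by exists N.+1%:R^-1 => // s t _ t0u; exact: NP.
Unshelve. all: by end_near. Qed.

End uniform_continuity.

Lemma max0_dist (R : realType) (t s : R) :
  `|Num.max 0 t - Num.max 0 s| <= `|t - s|.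
Proof.
have := ler_norm (t - s); have := ler_norm (s - t); rewrite (distrC s t).
rewrite ler_norml /Num.max; case: ifPn; case: ifPn; rewrite -?leNgt;
  by move=> *; apply/andP; split; lra.
Qed.

(** Continuity on [0, +oo), phrased for the path extended by its value at 0. *)
Definition half_line_continuous {R : realType} {n} (x : R -> 'cV[R]_n) : Prop :=
  continuous_curve (fun t => x (Num.max 0 t)).

Lemma continuous_path_max (R : realType) n (x : R -> 'cV[R]_n) :
  continuous_path x -> half_line_continuous x.
Proof.
move=> /subspace_continuousP cx t e e0.
have m0 : [set t : R | 0 <= t] (Num.max 0 t) by rewrite /= le_max lexx.
have := cx _ m0 (ball (x (Num.max 0 t)) e) (nbhsx_ballx (x (Num.max 0 t)) e e0).
rewrite /within/= => /nbhs_ballP[r /= r0 rP].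
exists r => // s ts.
suff : ball (x (Num.max 0 t)) e (x (Num.max 0 s)) by rewrite -ball_normE.
apply: rP; last by rewrite /= le_max lexx.
by rewrite -ball_normE/=; apply: le_lt_trans ts; exact: max0_dist.
Qed.

Section drift_integral.
Context {R : realType} {d : nat} (F : 'cV[R]_d -> 'cV[R]_d) (x : R -> 'cV[R]_d).
Hypotheses (lipF : locally_lipschitz F) (cx : continuous_curve x).

(** Half-open intervals make the drift additive over adjacent intervals. *)
Definition drift (a c : R) : 'cV[R]_d :=
  \col_j \int[lebesgue_measure]_(r in `]a, c]) (F (x r) j 0).

Lemma continuous_drift_coord j : continuous (fun r => F (x r) j 0 : R).
Proof.
move=> t; apply/cvgrPdist_lt => eps eps0.
have [e [M [e0 M0 FM]]] := locally_lipschitz_ball lipF (x t).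
have M1 : 0 < M + 1 by rewrite ltr_wpDl.
have m0 : 0 < Num.min e (eps / (M + 1)) by rewrite lt_min e0 divr_gt0.
have [r r0 rP] := cx t m0.
apply/nbhs_ballP; exists r => //= s /rP; rewrite lt_min => /andP[xs].
rewrite ltr_pdivlMr// mulrDr mulr1 mulrC => h.
have := cV_norm_coord (F (x t) - F (x s)) j; rewrite !mxE => /le_lt_trans; apply.
rewrite (le_lt_trans (FM _ _ _ xs)) ?subrr ?normr0//.
by apply: le_lt_trans h; rewrite lerDl.
Qed.

Lemma integrable_drift_coord a c j :
  lebesgue_measure.-integrable `[a, c] (EFin \o (fun r => F (x r) j 0)).
Proof.
apply: continuous_compact_integrable; first exact: segment_compact.
by apply: continuous_subspaceT; exact: continuous_drift_coord.
Qed.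

Lemma drift_itvB a c : 0 <= a -> a <= c ->
  (\col_j \int[lebesgue_measure]_(r in `[0, c]) (F (x r) j 0)) -
  (\col_j \int[lebesgue_measure]_(r in `[0, a]) (F (x r) j 0)) = drift a c.
Proof.
move=> a0 ac; apply/colP => j; rewrite !mxE.
by rewrite Rintegral_itvB//; exact: integrable_drift_coord.
Qed.

Lemma drift_coord_near a c j (v : R) K : a <= c ->
  (forall r, a <= r <= c -> `|F (x r) j 0 - v| <= K) ->
  `|drift a c j 0 - (c - a) * v| <= (c - a) * K.
Proof.
move=> ac FK.
have mui : lebesgue_measure `]a, c]%classic = (c - a)%:E.
  rewrite lebesgue_measure_itv/= lte_fin; case: ltP => // ca'.
  have -> : c = a by apply/le_anti/andP; split.
  by rewrite subrr.
have cst k : \int[lebesgue_measure]_(r in `]a, c]) k = k * (c - a) :> R.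
  by rewrite Rintegral_cst//; exact: (congr1 (fun z => k * fine z) mui).
have iF : lebesgue_measure.-integrable `]a, c] (EFin \o (fun r => F (x r) j 0)).
  by apply: integrableS (integrable_drift_coord a c j) => //; apply: subset_itvr; rewrite bnd_simp.
have ik k : lebesgue_measure.-integrable `]a, c] (EFin \o (fun _ => k : R)).
  suff : lebesgue_measure.-integrable `[a, c] (EFin \o (fun _ => k : R)).
    by apply: integrableS => //; apply: subset_itvr; rewrite bnd_simp.
  apply: continuous_compact_integrable; first exact: segment_compact.
  by apply: continuous_subspaceT => ?; exact: cst_continuous.
rewrite !mxE mulrC -cst -RintegralB//.
have iFv : lebesgue_measure.-integrable `]a, c]
    (EFin \o (fun r => F (x r) j 0 - v)).
  suff : lebesgue_measure.-integrable `]a, c] ((EFin \o (fun r => F (x r) j 0)%R)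
      \- (EFin \o (fun=> v)))%E by [].
  exact: integrableB.
rewrite (le_trans (le_normr_Rintegral _ _))//.
rewrite mulrC -cst; apply: le_Rintegral => //.
  exact: integrable_norm.
move=> r; rewrite /= in_itv/= => /andP[/ltW ar rc].
by apply: FK; rewrite ar.
Qed.

Lemma drift_near a c (v : 'cV[R]_d) K : a <= c -> 0 <= K ->
  (forall r, a <= r <= c -> `|F (x r) - v| <= K) ->
  `|drift a c - (c - a) *: v| <= (c - a) * K.
Proof.
move=> ac K0 FK; apply: cV_norm_le => [|j]; first by rewrite mulr_ge0// subr_ge0.
rewrite mxE [in X in _ + X]mxE [in X in _ + X]mxE.
apply: drift_coord_near => // r arc.
have := cV_norm_coord (F (x r) - v) j; rewrite !mxE => /le_trans; apply; exact: FK.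
Qed.

End drift_integral.

(** [xi] lists the noise increments: the scheme only uses finitely many values of
    the driving process. *)
Fixpoint euler {R : realType} {d} (F : 'cV[R]_d -> 'cV[R]_d) (eta : R)
    (xi : nat -> 'cV[R]_d) (y0 : 'cV[R]_d) (i : nat) : 'cV[R]_d :=
  if i is k.+1 then
    let y := euler F eta xi y0 k in y + eta *: F y + xi k
  else y0.

Section euler_convergence.
Context {R : realType} {d : nat} (F : 'cV[R]_d -> 'cV[R]_d) (x : R -> 'cV[R]_d).
Hypotheses (lipF : locally_lipschitz F) (cx : continuous_curve x).
Variables (s u : R).
Hypotheses (s0 : 0 <= s) (u0 : 0 <= u).

Let t (N i : nat) : R := s + i%:R * (u / N%:R).

Variable b : R -> 'cV[R]_d.
Hypothesis xE : forall N i, (i < N)%N ->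
  x (t N i.+1) - x (t N i) = drift F x (t N i) (t N i.+1)
                             + (b (t N i.+1) - b (t N i)).

(** The error [e_i] at step [i] satisfies
    [e_(i+1) <= (1 + L eta) e_i + eta omega], where [omega] is the modulus of
    continuity of [F] along the solution, as long as the scheme has not left the
    neighbourhood of the solution where [F] has Lipschitz constant [L]; by the
    discrete Gronwall inequality it never does when [omega] is small. *)
Lemma euler_cvg (e : R) : 0 < e -> \forall N \near \oo,
  `|x (s + u) - euler F (u / N%:R) (fun i => b (t N i.+1) - b (t N i)) (x s) N| < e.
Proof.
move=> e0.
have [rho [L [rho0 L0 FL]]] := lipschitz_near_path lipF (s + u) cx.
pose C := u * expR (L * u) + 1.
have C0 : 0 < C by rewrite ltr_wpDl// mulr_ge0// expR_ge0.
pose om := Num.min e rho / C.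
have om0 : 0 < om by rewrite divr_gt0// lt_min e0.
have L1 : 0 < L + 1 by rewrite ltr_wpDl.
have om1 : 0 < Num.min rho (om / (L + 1)) by rewrite lt_min rho0 divr_gt0.
have [eta eta0 xeta] := unif_continuous_path (s + u) cx om1.
have [n0 _ n0P] : \forall N \near \oo, u / eta < N%:R :> R.
  exact: nbhs_infty_gtr.
exists n0.+1 => // N /= n0N.
have N0 : (0 < N)%N by exact: leq_trans n0N.
have NR0 : 0 < N%:R :> R by rewrite ltr0n.
set h := u / N%:R.
have h0 : 0 <= h by rewrite divr_ge0.
have heta : h < eta.
  by rewrite /h ltr_pdivrMr// mulrC -ltr_pdivrMr//; apply: n0P; exact: ltnW.
have tN : t N N = s + u by rewrite /t mulrCA divff ?mulr1// gt_eqF.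
have tS i : t N i.+1 = t N i + h.
  by rewrite /t -natr1 mulrDl mul1r addrA.
have t_mono i j : (i <= j)%N -> t N i <= t N j.
  by move=> ij; rewrite lerD2l ler_wpM2r// ler_nat.
have t0 : t N 0 = s by rewrite /t mul0r addr0.
have ti i : (i <= N)%N -> 0 <= t N i <= s + u.
  by move=> iN; rewrite -tN t_mono// andbT (le_trans s0)// -t0 t_mono.
set y := euler _ _ _ _.
have q1 : 1 <= 1 + L * h by rewrite lerDl mulr_ge0.
have bnd i : (i <= N)%N -> i%:R * h * om * (1 + L * h) ^+ i < Num.min e rho.
  move=> iN; rewrite -[ltRHS](divfK (lt0r_neq0 C0)) -/om mulrC (mulrC om).
  rewrite mulrA ltr_pM2r// mulrC ltr_pwDr//.
  have ihu : i%:R * h <= u.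
    by rewrite /h mulrCA ler_piMr// ler_pdivrMr// mul1r ler_nat.
  apply: ler_pM => //; first exact: mulr_ge0.
    by rewrite exprn_ge0// (le_trans _ q1).
  apply: (@le_trans _ _ (expR (L * h) ^+ i)).
    by rewrite lerXn2r ?nnegrE ?expR_ge0// ?expR_ge1Dx// (le_trans _ q1).
  rewrite -expRM_natl ler_expR mulrCA.
  exact: ler_wpM2l.
have err i : (i <= N)%N -> `|x (t N i) - y i| <= i%:R * h * om * (1 + L * h) ^+ i.
  elim: i => [|i IH] iN; first by rewrite t0 /= subrr normr0 !mul0r.
  have {}IH := IH (ltnW iN).
  have [yrho ye] : `|x (t N i) - y i| < rho /\ `|x (t N i) - y i| < e.
    have := le_lt_trans IH (bnd _ (ltnW iN)); rewrite lt_min => /andP[]//.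
  set ei := `|x (t N i) - y i| in IH yrho ye.
  have K0 : 0 <= om + L * ei by apply: addr_ge0; [exact: ltW|rewrite mulr_ge0// /ei].
  have : `|drift F x (t N i) (t N i.+1) - (t N i.+1 - t N i) *: F (y i)|
      <= (t N i.+1 - t N i) * (om + L * ei).
    apply: drift_near => // [|r /andP[tr rt]]; first exact: t_mono.
    rewrite -(subrKA (F (x (t N i)))) (le_trans (ler_normD _ _))// lerD//; last first.
      by apply: FL => //; rewrite ti// ltnW.
    have /andP[ti0 _] := ti _ (ltnW iN); have /andP[_ tiu] := ti _ iN.
    have := xeta (t N i) r.
    rewrite ti ?(ltnW iN)//= (le_trans _ tr)//= (le_trans rt)//=.
    have -> : `|t N i - r| < eta.
      rewrite distrC ger0_norm ?subr_ge0// (le_lt_trans _ heta)//.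
      by rewrite lerBlDl -tS.
    move=> /(_ isT isT isT); rewrite lt_min => /andP[xr1 xr2].
    rewrite distrC (le_trans (FL _ _ _ xr1)) ?ti ?(ltnW iN)//.
    move: xr2; rewrite ltr_pdivlMr// mulrDr mulr1 mulrC => /ltW; apply: le_trans.
    by rewrite lerDl.
  have hE : t N i + h - t N i = h by rewrite addrC addKr.
  rewrite tS hE => dr.
  have -> : x (t N i + h) - y i.+1 =
      (x (t N i) - y i) + (drift F x (t N i) (t N i + h) - h *: F (y i)).
    have := xE iN; rewrite tS => /eqP; rewrite subr_eq => /eqP ->.
    rewrite /y/= -/y tS; move: (drift _ _ _ _) (b _) (x _) => D b1 xx.
    move: (h *: _) (b _) => hF b2.
    by apply/colP => j; rewrite !mxE; ring.
  rewrite (le_trans (ler_normD _ _))//.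
  apply: (le_trans (lerD (lexx _) dr)); rewrite -/ei.
  have -> : ei + h * (om + L * ei) = ei * (1 + L * h) + h * om by ring.
  apply: (@le_trans _ _ (i%:R * h * om * (1 + L * h) ^+ i * (1 + L * h) + h * om)).
    by rewrite lerD2r ler_wpM2r// (le_trans _ q1).
  rewrite -mulrA -exprSr -[i.+1%:R]natr1 !mulrDl !mul1r lerD2l.
  by apply: ler_peMr; [rewrite mulr_ge0// ltW|exact: exprn_ege1].
have := le_lt_trans (err N (leqnn _)) (bnd N (leqnn _)).
by rewrite tN lt_min => /andP[].
Qed.

End euler_convergence.

(** * The solution map and the Markov property *)

Section ae_equal_events.
Context {d} {T : measurableType d} {R : realType} (P : probability T R).

Lemma ae_prob_le (A B : set T) : measurable A -> measurable B ->
  {ae P, forall w, A w -> B w} -> (P A <= P B)%E.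
Proof.
move=> mA mB [N [mN PN NP]]; apply: (@le_trans _ _ (P (B `|` N))).
  apply: le_measure; rewrite ?inE//; first exact: measurableU.
  move=> w Aw; have [Bw|Bw] := pselect (B w); [by left|right].
  by apply: NP => /= h; apply: Bw; exact: h.
by apply: (le_trans (measureU2 P mB mN)); rewrite [X in (_ + X)%E]PN adde0.
Qed.

Lemma ae_eq_prob (A B : set T) : measurable A -> measurable B ->
  {ae P, forall w, A w <-> B w} -> P A = P B.
Proof.
move=> mA mB AB; apply/le_anti/andP; split; apply: ae_prob_le => //.
  by apply: filterS AB => w [].
by apply: filterS AB => w [].
Qed.

Lemma prob_diff_le (A B C : set T) : measurable A -> measurable B -> measurable C ->
  {ae P, forall w, ~ C w -> (A w <-> B w)} ->
  `|fine (P A) - fine (P B)| <= fine (P C).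
Proof.
move=> mA mB mC H.
have le A' B' : measurable A' -> measurable B' ->
    {ae P, forall w, ~ C w -> A' w -> B' w} -> fine (P A') - fine (P B') <= fine (P C).
  move=> mA' mB' H'; rewrite lerBlDl -lee_fin EFinD !fineK ?fin_num_measure//.
  apply: le_trans (measureU2 P mB' mC).
  apply: ae_prob_le => //; first exact: measurableU.
  apply: filterS H' => w h A'w; have [Cw|Cw] := pselect (C w); [by right|left].
  exact: h.
rewrite ler_norml lerNl opprB !le//.
  by apply: filterS H => w h Cw; have [] := h Cw.
by apply: filterS H => w h Cw; have [] := h Cw.
Qed.

(** Countable operations preserve almost sure equality, although the times are
    uncountably many: each event depends on countably many coordinates. *)
Lemma ae_eq_path_events n (I : set R) (X Y : R -> T -> 'cV[R]_n) :
  (forall t, I t -> {ae P, forall w, X t w = Y t w}) ->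
  forall A, <<s cylinder I (@coordinate R n) >> A ->
    {ae P, forall w, A (X ^~ w) <-> A (Y ^~ w)}.
Proof.
move=> XY; apply: smallest_sub.
  split.
  - by apply: aeW.
  - by move=> A hA; rewrite setTD; apply: filterS hA => w [h1 h2]; split=> ? ?; auto.
  - move=> A hA; have : {ae P, forall w, forall k, A k (X ^~ w) <-> A k (Y ^~ w)}.
      exact: ae_foralln.
    by apply: filterS => w h; split => -[k _ /h ?]; exists k.
move=> A; elim=> [|t B C It mB _ IH]; first by apply: aeW.
by apply: filterS2 (XY _ It) IH => w e [h1 h2]; rewrite /coordinate/=; split=> -[/=];
  rewrite /coordinate e; split => //; auto.
Qed.

End ae_equal_events.

Section solution_map.
Context {R : realType} {dsp} {T : measurableType dsp}.
Context {d m : nat} (F : 'cV[R]_d -> 'cV[R]_d) (A : 'M[R]_(d, m)).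
Variable W : R -> T -> 'cV[R]_m.

Definition euler_map (s u : R) (N : nat) (z : 'cV[R]_d * T) : 'cV[R]_d :=
  euler F (u / N%:R)
    (fun i => A *m (future_increment W s (i.+1%:R * (u / N%:R)) z.2
                    - future_increment W s (i%:R * (u / N%:R)) z.2)) z.1 N.

(** The limit of Euler's scheme started at time [s], coordinatewise; the upper
    limit makes it a total and measurable function of the starting point and of
    the driving increments. *)
Definition solution_map (s u : R) (z : 'cV[R]_d * T) : 'cV[R]_d :=
  \col_j fine (limn_esup (fun N => (euler_map s u N z j 0)%:E)).

Definition solution_path (s : R) (z : 'cV[R]_d * T) : R -> 'cV[R]_d :=
  fun u => solution_map s u z.

Hypothesis lipF : locally_lipschitz F.

Section measurability.
Context {d'} {S : measurableType d'} (f : S -> 'cV[R]_d) (g : S -> T).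
Variables (s u : R).
Hypothesis mf : random_vector f.
Hypothesis mg : forall v, 0 <= v <= u ->
  random_vector (fun z => future_increment W s v (g z)).

Lemma random_vector_solution_map : 0 <= u ->
  random_vector (fun z => solution_map s u (f z, g z)).
Proof.
move=> u0; have me N : random_vector (fun z => euler_map s u N (f z, g z)).
  rewrite /euler_map /=; set h := u / N%:R.
  have hu i : (i <= N)%N -> 0 <= i%:R * h <= u.
    have [->|N0] := eqVneq N 0%N.
      by rewrite leqn0 => /eqP ->; rewrite mul0r lexx.
    move=> iN; rewrite mulr_ge0 ?divr_ge0//= /h mulrCA ler_piMr//.
    by rewrite ler_pdivrMr ?ltr0n ?lt0n// mul1r ler_nat.
  suff H k : (k <= N)%N -> random_vector (fun z => euler F h
    (fun i => A *m (future_increment W s (i.+1%:R * h) (g z)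
                    - future_increment W s (i%:R * h) (g z))) (f z) k) by exact: H.
  elim: k => [//|k IH] kN /=; have {}IH := IH (ltnW kN).
  apply: random_vectorD; last first.
    by apply: random_vector_mulmx; apply: random_vectorB; apply: mg;
      apply: hu => //; exact: ltnW.
  apply: random_vectorD => //; apply: random_vectorZ.
  apply: random_vector_continuous => // U; exact: locally_lipschitz_preimage_open.
apply: random_vector_coord => j; under eq_fun do rewrite mxE.
have me' : measurable_fun [set: S]
    (fun z => limn_esup (fun N => (euler_map s u N (f z, g z) j 0)%:E)).
  apply: (@measurable_fun_limn_esup _ _ _ _
    (fun N z => (euler_map s u N (f z, g z) j 0)%:E)) => N.
  by apply/measurable_EFinP; exact: (measurable_coord_of j (me N)).
by apply: (measurableT_comp _ me').
Qed.

End measurability.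

Variables (P : probability T R) (X : R -> T -> 'cV[R]_d).
Hypothesis solX : sde_solution P F A W X.

Lemma solution_incrementE a c : 0 <= a -> a <= c -> {ae P, forall w,
  X c w - X a w = drift F (fun r => X (Num.max 0 r) w) a c + A *m (W c w - W a w)}.
Proof.
move=> a0 ac; have [_ cX eqX] := solX; have c0 := le_trans a0 ac.
apply: filterS2 (eqX _ a0) (eqX _ c0) => w Ea Ec.
have cx : continuous_curve (fun r => X (Num.max 0 r) w) := continuous_path_max (cX w).
rewrite Ea Ec -(drift_itvB lipF cx a0 ac).
have E k : \col_j (\int[lebesgue_measure]_(r in `[0, k]) (F (X r w) j 0)) =
    \col_j (\int[lebesgue_measure]_(r in `[0, k]) (F (X (Num.max 0 r) w) j 0)).
  apply/colP => j; rewrite !mxE; apply: eq_Rintegral => r.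
  by rewrite inE/= in_itv/= => /andP[r0 _]; rewrite max_r.
rewrite !E mulmxBr.
move: (\col_j _) (\col_j _) (X 0 w) (A *m _) (A *m _) => a1 a2 a3 a4 a5.
by apply/colP => j; rewrite !mxE; ring.
Qed.

(** Euler's scheme evaluates the equation at countably many grid times only, so
    that the equation, which holds almost surely at each time, determines the
    limit; this is uniqueness of solutions in a measurable form. *)
Lemma solution_mapE s u : 0 <= s -> 0 <= u ->
  {ae P, forall w, X (s + u) w = solution_map s u (X s w, w)}.
Proof.
move=> s0 u0; have [_ cX _] := solX.
pose t N i : R := s + i%:R * (u / N%:R).
have t0 N i : 0 <= t N i by rewrite addr_ge0// mulr_ge0// divr_ge0.
have tS N i : t N i <= t N i.+1 by rewrite lerD2l ler_wpM2r ?divr_ge0// ler_nat.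
have : {ae P, forall w, forall N i, X (t N i.+1) w - X (t N i) w =
    drift F (fun r => X (Num.max 0 r) w) (t N i) (t N i.+1) +
    A *m (W (t N i.+1) w - W (t N i) w)}.
  apply: ae_foralln => N; apply: ae_foralln => i.
  exact: solution_incrementE (t0 N i) (tS N i).
apply: filterS => w XE.
pose x r := X (Num.max 0 r) w.
have cx : continuous_curve x := continuous_path_max (cX w).
have xX r : 0 <= r -> x r = X r w by move=> r0; rewrite /x max_r.
pose b r := A *m W r w.
have xE N i : (i < N)%N -> x (t N i.+1) - x (t N i) =
    drift F x (t N i) (t N i.+1) + (b (t N i.+1) - b (t N i)).
  by move=> iN; rewrite !xX// XE /b -mulmxBr.
have cvg := euler_cvg lipF cx s0 u0 xE.
apply/colP => j; rewrite mxE.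
have cvgj : (euler_map s u N (X s w, w) j 0) @[N --> \oo] --> (X (s + u) w j 0 : R).
  apply/cvgrPdist_lt => e e0; apply: filterS (cvg e e0) => N; rewrite !xX//; last first.
    exact: addr_ge0.
  apply: le_lt_trans.
  have := cV_norm_coord (X (s + u) w - euler F (u / N%:R)
    (fun i => b (t N i.+1) - b (t N i)) (X s w) N) j.
  rewrite !mxE; congr (`| _ - _ | <= _); rewrite /euler_map; congr (euler _ _ _ _ _ _ _).
  apply/funext => i /=; rewrite /b -mulmxBr /future_increment -/(t N i) -/(t N i.+1).
  by rewrite opprB addrA subrK.
have /cvg_limn_einf_sup[_ ->] // : (euler_map s u N (X s w, w) j 0)%:E @[N --> \oo] -->
  (X (s + u) w j 0)%:E by apply: cvg_EFin; first exact: nearW.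
Qed.

End solution_map.

Section markov.
Context {R : realType} {dsp} {T : measurableType dsp} (P : probability T R).
Context {d m : nat} (F : 'cV[R]_d -> 'cV[R]_d) (A : 'M[R]_(d, m)).
Variable W : R -> T -> 'cV[R]_m.
Hypotheses (BW : standard_brownian_motion P W) (lipF : locally_lipschitz F).

Definition future_generators (s : R) : set (set T) :=
  \bigcup_(u in [set u : R | 0 <= u]) sigma_vector (future_increment W s u).

Definition past_generators (X : R -> T -> 'cV[R]_d) (s : R) : set (set T) :=
  \bigcup_(u in [set u : R | 0 <= u <= s]) sigma_vector (X u).

Lemma future_generators_measurable s : 0 <= s ->
  future_generators s `<=` measurable.
Proof.
move=> s0 _ [u u0 [B mB <-]].
exact: (preimage_measurable (random_vector_future_increment BW s0 u0)).
Qed.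

Lemma measurable_solution_path s : 0 <= s ->
  @measurable_fun _ _ (borel_cV R d * g_sigma_algebraType (future_generators s))%type
    (path_space R d) setT (solution_path F A W s).
Proof.
move=> s0; apply: (@measurable_path _ _ _ _
  (fun u (z : borel_cV R d * g_sigma_algebraType (future_generators s)) =>
     solution_map F A W s u z)) => u u0.
rewrite (_ : (fun z => _) = (fun z => solution_map F A W s u (z.1, z.2))); last first.
  by apply/funext => -[].
apply: random_vector_solution_map => //; first exact: measurable_fst.
move=> v /andP[v0 _].
have mv : @random_vector R _ (g_sigma_algebraType (future_generators s)) m
    (future_increment W s v).
  by apply: random_vector_sub => C Cv; apply: sub_sigma_algebra; exists v.
exact: (measurableT_comp mv measurable_snd).
Qed.

(** The transition kernel: the probability that the solution started from [x],
    and driven by the increments after time [s], lies in [B]. *)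
Definition path_kernel (s : R) (B : set (path_space R d)) (x : 'cV[R]_d) : \bar R :=
  (\int[P]_w (\1_B (solution_path F A W s (x, w)))%:E)%E.

Section kernel_measurable.
Variables (s : R) (B : set (path_space R d)).
Hypotheses (s0 : 0 <= s) (mB : measurable B).

Let phi_measurable : @measurable_fun _ _
    (borel_cV R d * g_sigma_algebraType (future_generators s))%type (\bar R) setT
    (fun z => (\1_B (solution_path F A W s z) : R)%:E).
Proof.
apply/measurable_EFinP.
by apply: (measurableT_comp _ (measurable_solution_path s0)).
Qed.

Lemma measurable_path_kernel :
  measurable_fun [set: borel_cV R d] (path_kernel s B).
Proof.
apply: (measurable_fun_pair_integral P (future_generators_measurable s0)
  phi_measurable) => z.
by rewrite lee_fin.
Qed.

Lemma path_kernel_ge0 x : (0 <= path_kernel s B x)%E.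
Proof. by apply: integral_ge0 => w _; rewrite lee_fin. Qed.

Lemma path_kernel_section x :
  measurable [set w | B (solution_path F A W s (x, w))] /\
  path_kernel s B x = P [set w | B (solution_path F A W s (x, w))].
Proof.
have mS : measurable [set w | B (solution_path F A W s (x, w))].
  apply: (sigma_sub_measurable (future_generators_measurable s0)).
  have := measurableT_comp (measurable_solution_path s0)
    (@pair1_measurable _ _ (borel_cV R d) (g_sigma_algebraType (future_generators s)) x).
  by move=> /(_ measurableT _ mB); rewrite setTI.
split => //; rewrite /path_kernel.
rewrite -[in RHS](setIT [set w | B (solution_path F A W s (x, w))]).
by rewrite -(integral_indic P measurableT mS).
Qed.

Lemma path_kernel_le1 x : (path_kernel s B x <= 1)%E.
Proof. by have [mS ->] := path_kernel_section x; exact: probability_le1. Qed.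

End kernel_measurable.

Section solution.
Variable X : R -> T -> 'cV[R]_d.
Hypotheses (solX : sde_solution P F A W X)
  (X0W : independent_of_process P (X 0) W).

Let mX t : 0 <= t -> random_vector (X t).
Proof. by case: solX => h _ _; exact: h. Qed.

(** Up to null sets, the past of the solution is a function of its start and of
    the past of the Brownian motion. *)
Lemma solution_past_indep_future s : 0 <= s ->
  independent P <<s past_generators X s >> <<s future_generators s >>.
Proof.
move=> s0; pose Y u w := solution_map F A W 0 u (X 0 w, w).
have XY u : [set u : R | 0 <= u <= s] u -> {ae P, forall w, X u w = Y u w}.
  move=> /andP[u0 _]; have := solution_mapE lipF solX (lexx 0) u0.
  by rewrite add0r.
pose G := past (X 0) W s.
have mY u : 0 <= u <= s -> @random_vector R _ (g_sigma_algebraType G) d (Y u).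
  move=> /andP[u0 us]; apply: (@random_vector_solution_map _ _ _ _ _ _ _ _ lipF
    _ (g_sigma_algebraType G)) => //.
  - apply: random_vector_sub => _ [B mB <-]; apply: sub_sigma_algebra.
    exists B => //; exists setT; last by rewrite setIT.
    exact: (@measurableT _ (g_sigma_algebraType (\bigcup_(v in [set v | 0 <= v <= s]) sigma_vector (W v)))).
  - move=> v /andP[v0 vu].
    have sub r : 0 <= r <= s -> @random_vector R _ (g_sigma_algebraType G) m (W r).
      move=> rs; apply: random_vector_sub => C Cr; apply: sub_sigma_algebra.
      exists setT => //; exists C; last by rewrite preimage_setT setTI.
      exact: (@sigma_vector_process _ _ _ _ [set v | 0 <= v <= s]) Cr.
    rewrite /future_increment; under eq_fun do rewrite add0r.
    by apply: random_vectorB; apply: sub; rewrite ?lexx// v0 (le_trans vu).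
have indG := past_indep_future BW s0 (mX (lexx 0)) X0W.
have pm : sigma_process [set u | 0 <= u <= s] X `<=` measurable.
  by apply: sigma_process_measurable => u /andP[u0 _]; exact: mX.
have Gm : <<s G >> `<=` measurable.
  apply: sigma_sub_measurable => _ [B mB [E FE <-]]; apply: measurableI.
    exact: (preimage_measurable (mX (lexx 0))).
  move: FE; apply: sigma_process_measurable => u /andP[u0 _].
  by case: BW => h _ _ _ _; exact: h.
suff: independent P <<s past_generators X s >> <<s future_generators s >> by [].
apply: independentC.
have -> : <<s past_generators X s >> = <<s cylinder [set u : R | 0 <= u <= s] X >>.
  exact: sigma_process_cylinder.
apply: independent_pi.
- exact: (sigma_sub_measurable (future_generators_measurable s0)).
- move=> C cC; apply: pm; rewrite sigma_process_cylinder; exact: sub_sigma_algebra.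
- exact: cylinder_setI.
move=> E C HE cC.
have mE : measurable E by exact: (sigma_sub_measurable (future_generators_measurable s0)).
have [D [sD aeD]] : exists D, <<s G >> D /\ {ae P, forall w, C w <-> D w}.
  elim: cC => [|u B C' us mB _ [D [sD aeD]]].
    exists setT; split; last by apply: aeW.
    exact: (@measurableT _ (g_sigma_algebraType G)).
  exists (Y u @^-1` B `&` D); split.
    apply: (@measurableI _ (g_sigma_algebraType G)) => //.
    exact: (preimage_measurable (mY u us)).
  by apply: filterS2 (XY _ us) aeD => w e [h1 h2]; rewrite /preimage/=; split=> -[/=];
    rewrite e; split => //; auto.
have mC : measurable C.
  by apply: pm; rewrite sigma_process_cylinder; exact: sub_sigma_algebra.
have mD := Gm _ sD.
rewrite (ae_eq_prob mC mD aeD) (ae_eq_prob (B := E `&` D)); last 3 first.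
- exact: measurableI.
- exact: measurableI.
- by apply: filterS aeD => w [h1 h2]; split=> -[? ?]; split; auto.
by rewrite setIC indG// muleC.
Qed.

Lemma path_event_ae s B : 0 <= s -> measurable (B : set (path_space R d)) ->
  {ae P, forall w, B (shift_path s (X ^~ w)) <-> B (solution_path F A W s (X s w, w))}.
Proof.
move=> s0 mB; apply: (@ae_eq_path_events _ _ _ _ _ [set u | 0 <= u]
  (fun u w => X (u + s) w) (fun u w => solution_map F A W s u (X s w, w)) _ B) => //.
move=> u u0; have := solution_mapE lipF solX s0 u0.
by rewrite addrC.
Qed.

(** The path after [s] is the solution map at [X s] and at the future
    increments, which are independent of the past, and may be integrated out. *)
Lemma markov_property s B (xi : T -> \bar R) : 0 <= s ->
  measurable (B : set (path_space R d)) ->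
  @measurable_fun _ _ (g_sigma_algebraType (past_generators X s)) _ setT xi ->
  (forall w, 0 <= xi w)%E ->
  (\int[P]_w (xi w * (\1_B (shift_path s (X ^~ w)))%:E) =
   \int[P]_w (xi w * path_kernel s B (X s w)))%E.
Proof.
move=> s0 mB mxi xi0.
have pm : past_generators X s `<=` measurable.
  by move=> _ [u /andP[u0 _] [C mC <-]]; exact: (preimage_measurable (mX u0)).
have mid : @measurable_fun _ _ T (g_sigma_algebraType (past_generators X s)) setT id.
  by move=> _ C mC; rewrite setTI; exact: (sigma_sub_measurable pm).
have mxiT : measurable_fun [set: T] xi by exact: (measurableT_comp mxi mid).
pose S := g_sigma_algebraType (past_generators X s).
pose TH := g_sigma_algebraType (future_generators s).
pose phi (z : S * TH) := (xi z.1 * (\1_B (solution_path F A W s (X s z.1, z.2)))%:E)%E.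
have mXs : @random_vector R _ S d (X s).
  by apply: random_vector_sub => C Cs; apply: sub_sigma_algebra; exists s => //=; rewrite s0/=.
have mphi : measurable_fun [set: S * TH] phi.
  apply: emeasurable_funM; first exact: (measurableT_comp mxi measurable_fst).
  apply/measurable_EFinP; apply: (measurableT_comp (measurable_indic mB)).
  apply: (measurableT_comp (measurable_solution_path s0)).
  apply: measurable_fun_pair; last exact: measurable_snd.
  exact: (measurableT_comp mXs measurable_fst).
have phi0 z : (0 <= phi z)%E by rewrite mule_ge0// lee_fin.
have ind : independent P [set id @^-1` C | C in (measurable : set (set S))]
    <<s future_generators s >>.
  have := solution_past_indep_future s0; apply: sub_independent => // _ [C mC <-].
  by rewrite preimage_id.
have := indep_pair_integral mid (future_generators_measurable s0) ind mphi phi0.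
rewrite /phi/= => J.
transitivity (\int[P]_w (xi w * (\1_B (solution_path F A W s (X s w, w)))%:E))%E.
  have mB1 : measurable_fun [set: T] (fun w => (\1_B (shift_path s (X ^~ w)))%:E : \bar R).
    apply/measurable_EFinP; apply: (measurableT_comp (measurable_indic mB)).
    apply: measurable_path => t t0; apply: mX; exact: addr_ge0.
  apply: ge0_ae_eq_integral => //.
  - exact: emeasurable_funM.
  - have mpair : measurable_fun [set: T] (fun w => (w, w) : S * TH).
      apply: measurable_fun_pair => // _ C mC; rewrite setTI.
      exact: (sigma_sub_measurable (future_generators_measurable s0)).
    exact: (measurableT_comp mphi mpair).
  - by move=> w _; rewrite mule_ge0// lee_fin.
  - by move=> w _; rewrite mule_ge0// lee_fin.
  apply: filterS (path_event_ae s0 mB) => w [h1 h2] _; congr (_ * _%:E)%E.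
  rewrite !indicE (_ : (shift_path s (X ^~ w) \in B) =
    (solution_path F A W s (X s w, w) \in B))//.
  by apply/idP/idP; rewrite !inE.
rewrite J; apply: eq_integral => w _.
rewrite ge0_integralZl//; apply/measurable_EFinP.
exact: (measurable_indic (path_kernel_section s0 mB (X s w)).1).
Qed.

Lemma measurable_path_event B : measurable (B : set (path_space R d)) ->
  measurable [set w | B (X ^~ w)].
Proof.
by move=> mB; have := measurable_path mX measurableT mB; rewrite setTI.
Qed.

(** Uniqueness in law for a deterministic start. *)
Lemma path_kernel_start B x : measurable (B : set (path_space R d)) ->
  {ae P, forall w, X 0 w = x} -> P [set w | B (X ^~ w)] = path_kernel 0 B x.
Proof.
move=> mB X0x; have [mS ->] := path_kernel_section (lexx 0) mB x.
apply: ae_eq_prob => //; first exact: measurable_path_event.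
apply: filterS2 X0x (path_event_ae (lexx 0) mB) => w <-.
by rewrite (_ : shift_path 0 (X ^~ w) = X ^~ w)//; apply/funext => t; rewrite /shift_path addr0.
Qed.

Lemma cylinder_tuple (A' : set (R -> 'cV[R]_d)) :
  cylinder [set t : R | 0 <= t] (@coordinate R d) A' ->
  exists k (t : 'I_k -> R) (B : 'I_k -> set (borel_cV R d)),
    [/\ forall i, 0 <= t i, forall i, measurable (B i) &
      A' = [set x | forall i, B i (x (t i))]].
Proof.
elim => [|t B C t0 mB _ [k [ts [Bs [ts0 mBs ->]]]]].
  exists 0%N, (fun=> 0), (fun=> setT); split => //.
  by apply/esym; rewrite -subTset => x _ [].
exists k.+1, (fun i => oapp ts t (unlift ord0 i)),
  (fun i => oapp Bs B (unlift ord0 i)); split.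
- by move=> i; case: unlift => //=.
- by move=> i; case: unlift => //=.
apply/seteqP; split => [x [Bx h] i|x h]; first by case: unlift => //=.
split; first by have := h ord0; rewrite unlift_none.
by move=> i; have := h (lift ord0 i); rewrite liftK.
Qed.

Hypothesis statX : stationary P X.

Lemma stationary_path h B : 0 <= h -> measurable (B : set (path_space R d)) ->
  P [set w | B (shift_path h (X ^~ w))] = P [set w | B (X ^~ w)].
Proof.
move=> h0 mB.
apply: (path_law_eq (P := P) (P' := P) (X := fun t w => X (t + h) w) (Y := X)) => //.
  by move=> t t0; apply: mX; exact: addr_ge0.
move=> C /cylinder_tuple[k [t [Bs [t0 mBs ->]]]].
have := statX h0 t0 (B := [set u : k.-tuple (borel_cV R d) | forall i, Bs i (tnth u i)]).
rewrite (_ : [set w | _ [tuple X (t i + h) w | i < k]] =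
  [set w | forall i, Bs i (X (t i + h) w)]); last first.
  by apply/seteqP; split => w /= H i; have := H i; rewrite tnth_mktuple.
rewrite (_ : [set w | _ [tuple X (t i) w | i < k]] =
  [set w | forall i, Bs i (X (t i) w)]); last first.
  by apply/seteqP; split => w /= H i; have := H i; rewrite tnth_mktuple.
apply; rewrite (_ : [set u | _] = \bigcap_(i in [set: 'I_k])
  ((fun u : k.-tuple (borel_cV R d) => tnth u i) @^-1` Bs i)); last first.
  by apply/seteqP; split => u H i; [move=> _; exact: H|exact: (H i I)].
apply: fin_bigcap_measurable => // i _.
exact: (preimage_measurable (measurable_tnth i)).
Qed.

Variable mu : probability (borel_cV R d) R.
Hypothesis lawX0 : has_law P (X 0) mu.

Lemma stationary_marginal t B : 0 <= t -> measurable (B : set (borel_cV R d)) ->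
  P (X t @^-1` B) = mu B.
Proof.
move=> t0 mB; rewrite -lawX0//.
have := @stationary_path t (coordinate 0 @^-1` B) t0.
rewrite /shift_path/coordinate/preimage/= add0r; apply.
exact: (preimage_measurable (measurable_coordinate (lexx 0))).
Qed.

Lemma integral_marginal t (D : set (borel_cV R d)) (g : borel_cV R d -> \bar R) :
  0 <= t -> measurable D ->
  measurable_fun [set: borel_cV R d] g -> (forall x, 0 <= g x)%E ->
  (\int[P]_(w in X t @^-1` D) g (X t w) = \int[mu]_(x in D) g x)%E.
Proof.
move=> t0 mD mg g0.
transitivity (\int[law P (mX t0)]_(x in D) g x)%E.
  by rewrite ge0_integral_pushforward//; exact: measurable_funTS.
apply: eq_measure_integral => C mC _.
exact: (stationary_marginal t0).
Qed.

(** Stationarity makes the kernel time-homogeneous: testing the Markov property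
    at time [s] against events of [X s] gives the same integrals for all [s]. *)
Lemma path_kernel_homogeneous s B : 0 <= s ->
  measurable (B : set (path_space R d)) ->
  ae_eq mu setT (path_kernel s B) (path_kernel 0 B).
Proof.
move=> s0 mB.
have k1 r : 0 <= r -> mu.-integrable setT (path_kernel r B).
  move=> r0; apply: (@le_integrable _ _ _ mu _ measurableT _ (cst 1%E)).
  - exact: measurable_path_kernel.
  - move=> x _; rewrite /= gee0_abs ?path_kernel_ge0//.
    rewrite normr1; exact: path_kernel_le1.
  - exact: finite_measure_integrable_cst.
apply: (integral_ae_eq measurableT (k1 s s0) (measurable_path_kernel (lexx 0) mB)).
move=> E _ mE.
have int r : 0 <= r -> (\int[mu]_(x in E) path_kernel r B x =
    P [set w | (coordinate 0 @^-1` E `&` B) (shift_path r (X ^~ w))])%E.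
  move=> r0; rewrite -(integral_marginal r0)//; last 2 first.
  - exact: measurable_path_kernel.
  - by move=> x; exact: path_kernel_ge0.
  have mXE : measurable (X r @^-1` E) by exact: (preimage_measurable (mX r0)).
  have mC : measurable [set w | (coordinate 0 @^-1` E `&` B) (shift_path r (X ^~ w))].
    have mp : @measurable_fun _ _ T (path_space R d) setT (fun w => shift_path r (X ^~ w)).
      by apply: measurable_path => t t0; apply: mX; exact: addr_ge0.
    apply: (preimage_measurable mp); apply: measurableI => //.
    exact: (preimage_measurable (measurable_coordinate (lexx 0))).
  rewrite integral_mkcond -[in RHS](setIT [set w | _ (shift_path r _)]).
  rewrite -(integral_indic P measurableT mC).
  transitivity (\int[P]_w ((\1_(X r @^-1` E) w)%:E * path_kernel r B (X r w)))%E.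
    apply: eq_integral => w _; rewrite patchE indicE.
    by case: ifP => _; rewrite ?mul1e ?mul0e.
  rewrite -markov_property//; last first.
    apply/measurable_EFinP; apply: measurable_indic.
    by apply: sub_sigma_algebra; exists r; [rewrite /= r0 lexx|exists E].
  apply: eq_integral => w _; rewrite -EFinM !indicE; congr EFin.
  rewrite -natrM mulnb; congr (nat_of_bool _)%:R.
  apply/andP/idP; rewrite !inE /shift_path/coordinate/preimage/= add0r => -[] //.
apply: etrans (int s s0) _; apply: etrans _ (esym (int 0 (lexx 0))).
have mC : measurable (coordinate 0 @^-1` E `&` B : set (path_space R d)).
  apply: measurableI => //.
  exact: (preimage_measurable (measurable_coordinate (lexx 0))).
exact: etrans (stationary_path s0 mC) (esym (stationary_path (lexx 0) mC)).
Qed.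

Lemma markov_stationary s B (xi : T -> \bar R) : 0 <= s ->
  measurable (B : set (path_space R d)) ->
  @measurable_fun _ _ (g_sigma_algebraType (past_generators X s)) _ setT xi ->
  (forall w, 0 <= xi w)%E ->
  (\int[P]_w (xi w * (\1_B (shift_path s (X ^~ w)))%:E) =
   \int[P]_w (xi w * path_kernel 0 B (X s w)))%E.
Proof.
move=> s0 mB mxi xi0; apply: etrans (markov_property s0 mB mxi xi0) _.
have pm : past_generators X s `<=` measurable.
  by move=> _ [u /andP[u0 _] [C mC <-]]; exact: (preimage_measurable (mX u0)).
have mid : @measurable_fun _ _ T (g_sigma_algebraType (past_generators X s)) setT id.
  by move=> _ C mC; rewrite setTI; exact: (sigma_sub_measurable pm).
have mxiT : measurable_fun [set: T] xi by exact: (measurableT_comp mxi mid).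
have mk r : 0 <= r -> measurable_fun [set: T] (fun w => xi w * path_kernel r B (X s w))%E.
  move=> r0; apply: emeasurable_funM => //.
  exact: (measurableT_comp (measurable_path_kernel r0 mB) (mX s0)).
apply: ge0_ae_eq_integral => //.
- exact: mk.
- exact: mk.
- by move=> w _; rewrite mule_ge0// path_kernel_ge0.
- by move=> w _; rewrite mule_ge0// path_kernel_ge0.
have [N [mN muN NP]] := path_kernel_homogeneous s0 mB.
exists (X s @^-1` N); split; first exact: (preimage_measurable (mX s0)).
  exact: etrans (stationary_marginal s0 mN) muN.
move=> w h; apply: (NP (X s w)) => h'; apply: h => _.
exact: (congr1 (fun z => (xi w * z)%E) (h' Logic.I)).
Qed.

(** The integral of the kernel over the start is the probability of the event. *)
Lemma path_event_null B : measurable (B : set (path_space R d)) ->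
  P [set w | B (X ^~ w)] = 0%E -> {ae mu, forall x, path_kernel 0 B x = 0%E}.
Proof.
move=> mB PB0.
have k0 : (\int[mu]_x path_kernel 0 B x = 0)%E.
  rewrite -(integral_marginal (lexx 0))//; last 2 first.
  - exact: measurable_path_kernel.
  - by move=> x; exact: path_kernel_ge0.
  rewrite preimage_setT -PB0.
  have := markov_stationary (lexx 0) mB (xi := cst 1%E).
  move=> /(_ (@measurable_cst _ _ _ _ _ _)) H.
  under eq_integral do rewrite -[path_kernel _ _ _]mul1e.
  rewrite -H// -[in RHS](setIT [set w | B _]).
  rewrite -(integral_indic P measurableT (measurable_path_event mB)).
  apply: eq_integral => w _; rewrite mul1e !indicE.
  by rewrite (_ : shift_path 0 _ = X ^~ w)//; apply/funext => t; rewrite /shift_path addr0.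
have /(ae_eq_integral_abs mu measurableT (measurable_path_kernel (lexx 0) mB)).1 :
    (\int[mu]_x `|path_kernel 0 B x| = 0)%E.
  rewrite -[RHS]k0; apply: eq_integral => x _.
  by rewrite gee0_abs// path_kernel_ge0.
by apply: filterS => x; apply.
Qed.

End solution.
End markov.

(** * A law of large numbers for path events *)

Lemma sum_near_end c M : (\sum_(n < M) (M < n + c)%N <= c)%N.
Proof.
rewrite (reindex_inj rev_ord_inj)/=.
apply: (@leq_trans (\sum_(n < M) (n < c)%N)).
  apply: leq_sum => n _; have := ltn_ord n.
  by case: (ltnP M _) => h1; case: (ltnP n c) => h2 // h3; lia.
suff -> : (\sum_(n < M) (n < c)%N = minn M c)%N by exact: geq_minr.
by elim: M => [|M IH]; rewrite ?big_ord0 ?min0n// big_ord_recr/= IH; lia.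
Qed.

Section bounded_expectation.
Context {d} {T : measurableType d} {R : realType} (P : probability T R).

Definition bounded_rv (f : T -> R) : Prop :=
  measurable_fun [set: T] f /\ exists M, forall w, `|f w| <= M.

Lemma bounded_rv_integrable f : bounded_rv f ->
  P.-integrable setT (EFin \o f).
Proof.
move=> [mf [M fM]]; apply: (@le_integrable _ _ _ P _ measurableT _ (cst M%:E)).
- exact/measurable_EFinP.
- by move=> w _; rewrite /= lee_fin (le_trans (fM w))// ler_norm.
- exact: finite_measure_integrable_cst.
Qed.

Lemma bounded_rvD f g : bounded_rv f -> bounded_rv g ->
  bounded_rv (fun w => f w + g w).
Proof.
move=> [mf [M fM]] [mg [N gN]]; split; first exact: measurable_funD.
by exists (M + N) => w; rewrite (le_trans (ler_normD _ _))// lerD.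
Qed.

Lemma bounded_rvB f g : bounded_rv f -> bounded_rv g ->
  bounded_rv (fun w => f w - g w).
Proof.
move=> [mf [M fM]] [mg [N gN]]; split; first exact: measurable_funB.
by exists (M + N) => w; rewrite (le_trans (ler_normB _ _))// lerD.
Qed.

Lemma bounded_rvM f g : bounded_rv f -> bounded_rv g ->
  bounded_rv (fun w => f w * g w).
Proof.
move=> [mf [M fM]] [mg [N gN]]; split; first exact: measurable_funM.
by exists (M * N) => w; rewrite normrM ler_pM.
Qed.

Lemma bounded_rv_sum n (f : nat -> T -> R) : (forall i, bounded_rv (f i)) ->
  bounded_rv (fun w => \sum_(i < n) f i w).
Proof.
move=> bf; elim: n => [|n IH].
  under eq_fun do rewrite big_ord0.
  by split; [exact: measurable_cst|exists 0 => w; rewrite normr0].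
by under eq_fun do rewrite big_ord_recr/=; exact: bounded_rvD.
Qed.

Lemma mean_sum_rv n (f : nat -> T -> R) : (forall i, bounded_rv (f i)) ->
  \int[P]_w (\sum_(i < n) f i w) = \sum_(i < n) \int[P]_w f i w.
Proof.
move=> bf; elim: n => [|n IH].
  rewrite big_ord0; under eq_Rintegral do rewrite big_ord0.
  by rewrite Rintegral_cst// mul0r.
under eq_Rintegral do rewrite big_ord_recr/=.
rewrite RintegralD//; last 2 first.
- exact/bounded_rv_integrable/bounded_rv_sum.
- exact/bounded_rv_integrable.
by rewrite IH big_ord_recr.
Qed.

Lemma expectation_le_bound f (M : R) : bounded_rv f -> (forall w, f w <= M) ->
  \int[P]_w f w <= M.
Proof.
move=> bf fM; have -> : M = \int[P]_w M.
  rewrite Rintegral_cst//; have /(congr1 fine)/= PT := probability_setT P.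
  by rewrite [fine _]PT mulr1.
apply: le_Rintegral => //; first exact: bounded_rv_integrable.
exact: finite_measure_integrable_cst.
Qed.

Lemma chebyshev_square f (a : R) : bounded_rv f -> 0 < a ->
  (P [set w | (a < f w)%R] <= ((\int[P]_w (f w * f w)) / (a * a))%:E)%E.
Proof.
move=> bf a0; have aa0 : 0 < a * a by rewrite mulr_gt0.
have mS : measurable [set w | a < f w] by exact: (measurable_gt_set bf.1).
have b1 : bounded_rv (\1_[set w | a < f w] : T -> R).
  split; first exact: measurable_indic.
  by exists 1 => w; rewrite indicE; case: (_ \in _); rewrite ?normr1 ?normr0.
have bff := bounded_rvM bf bf.
have baa : bounded_rv (fun w => a * a * \1_[set w | a < f w] w).
  apply: bounded_rvM => //; split; first exact: measurable_cst.
  by exists `|a * a|.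
rewrite -(fineK (fin_num_measure P _ mS)) lee_fin ler_pdivlMr//.
have -> : fine (P [set w | a < f w]) = \int[P]_w (\1_[set w | a < f w] w).
  by rewrite /Rintegral integral_indic// setIT.
rewrite mulrC -RintegralZl//; last exact: bounded_rv_integrable.
apply: le_Rintegral => //; try exact: bounded_rv_integrable.
move=> w _; rewrite indicE; case: (boolP (_ \in _)); rewrite ?mulr0 ?sqr_ge0//.
  rewrite inE/= mulr1 => aw; apply: ler_pM => //; exact: ltW.
Qed.

(** Orthogonality at distance at least [c] bounds the second moment of a sum of
    [M] terms by a multiple of [M]. *)
Lemma second_moment_sum (Z : nat -> T -> R) c M : (forall n, bounded_rv (Z n)) ->
  (forall n w, `|Z n w| <= 1) ->
  (forall k n, (k + c <= n)%N -> \int[P]_w (Z k w * Z n w) = 0) ->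
  \int[P]_w ((\sum_(n < M) Z n w) * (\sum_(n < M) Z n w)) <= (2 * c + 1)%:R * M%:R.
Proof.
move=> bZ Z1 orth; elim: M => [|M IH].
  by under eq_Rintegral do rewrite big_ord0 mul0r; rewrite Rintegral_cst// mul0r mulr0.
have bS := bounded_rv_sum M bZ.
have bSZ : bounded_rv (fun w => \sum_(n < M) Z n w * Z M w).
  by apply: (bounded_rv_sum M (f := fun n w => Z n w * Z M w)) => n; exact: bounded_rvM.
have -> : \int[P]_w ((\sum_(n < M.+1) Z n w) * (\sum_(n < M.+1) Z n w)) =
    \int[P]_w ((\sum_(n < M) Z n w) * (\sum_(n < M) Z n w)) +
    (\int[P]_w (\sum_(n < M) Z n w * Z M w) + \int[P]_w (\sum_(n < M) Z n w * Z M w) +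
    \int[P]_w (Z M w * Z M w)).
  rewrite -!RintegralD//; try (apply: bounded_rv_integrable;
    do ?[exact: bSZ | exact: bounded_rvM | apply: bounded_rvD]).
  apply: eq_Rintegral => w _; rewrite big_ord_recr/= -mulr_suml; ring.
rewrite -natr1 mulrDr mulr1 lerD//.
have ZZ : \int[P]_w (Z M w * Z M w) <= 1.
  apply: expectation_le_bound; first exact: bounded_rvM.
  by move=> w; rewrite (le_trans (ler_norm _))// normrM mulr_ile1.
have SZ : \int[P]_w (\sum_(n < M) Z n w * Z M w) <= c%:R.
  rewrite (mean_sum_rv M (f := fun n w => Z n w * Z M w)); last first.
    by move=> n; exact: bounded_rvM.
  apply: (@le_trans _ _ (\sum_(n < M) (M < n + c)%N%:R)).
    apply: ler_sum => n _; case: ltnP => [h|/orth ->//].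
    apply: expectation_le_bound; first exact: bounded_rvM.
    by move=> w; rewrite (le_trans (ler_norm _))// normrM mulr_ile1.
  rewrite -natr_sum ler_nat; exact: sum_near_end.
rewrite natrD natrM; lra.
Qed.

End bounded_expectation.

(** A layer-cake approximation: a function with values in [0, K] is, up to one,
    the number of its integer levels, which reduces averages of the function to
    frequencies of its level sets. *)
Section level_counts.
Context {R : realType}.

Lemma level_count_le (y : R) K : 0 <= y ->
  \sum_(i < K) (i.+1%:R <= y)%R%:R <= y.
Proof.
move=> y0; elim: K => [|K IH]; first by rewrite big_ord0.
rewrite big_ord_recr/=; case: (leP K.+1%:R y) => h; last by rewrite addr0.
apply: le_trans h; rewrite -natr1 lerD2r.
apply: (@le_trans _ _ (\sum_(i < K) 1)); last by rewrite sumr_const card_ord.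
by apply: ler_sum => i _; rewrite lern1 leq_b1.
Qed.

Lemma level_count_ge (y : R) K : y <= K%:R ->
  y - 1 <= \sum_(i < K) (i.+1%:R <= y)%R%:R.
Proof.
elim: K => [|K IH] yK.
  by rewrite big_ord0 subr_le0 (le_trans yK)// ler01.
rewrite big_ord_recr/=; have [/IH h|yK'] := leP y K%:R.
  by rewrite (le_trans h)// lerDl ler0n.
apply: (@le_trans _ _ (\sum_(i < K) 1)).
  by rewrite sumr_const card_ord lerBlDr natr1.
rewrite -[leLHS]addr0 lerD//.
apply: ler_sum => i _; suff -> : i.+1%:R <= y by [].
by rewrite (ltW (le_lt_trans _ yK'))// ler_nat.
Qed.

End level_counts.

Section law_of_large_numbers.
Context {R : realType} {dsp} {T : measurableType dsp} (P : probability T R).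
Context {d m : nat} (F : 'cV[R]_d -> 'cV[R]_d) (A : 'M[R]_(d, m)).
Variable W : R -> T -> 'cV[R]_m.
Hypotheses (BW : standard_brownian_motion P W) (lipF : locally_lipschitz F).
Variable X : R -> T -> 'cV[R]_d.
Hypotheses (solX : sde_solution P F A W X)
  (X0W : independent_of_process P (X 0) W) (statX : stationary P X).
Variable mu : probability (borel_cV R d) R.
Hypotheses (lawX0 : has_law P (X 0) mu) (ergX : ergodicity_condition P mu X).

Let mX t : 0 <= t -> random_vector (X t).
Proof. by case: solX => h _ _; exact: h. Qed.

Variables (delta c : R) (B : set (path_space R d)).
Hypotheses (delta0 : 0 < delta) (cB : path_until c B).

Let mB : measurable B.
Proof. exact: path_until_sub cB. Qed.

Let t (n : nat) : R := n%:R * delta.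
Let t0 n : 0 <= t n. Proof. by rewrite mulr_ge0// ltW. Qed.

(* The kernel started at the time 0 may be used at all times: by stationarity
   the difference is a null set. *)
Let I n w : R := \1_B (shift_path (t n) (X ^~ w)).
Let g (x : 'cV[R]_d) : R := fine (path_kernel P F A W 0 B x).
Let G n w : R := g (X (t n) w).

Let g01 x : 0 <= g x <= 1.
Proof.
have k0 := path_kernel_ge0 P F A W 0 B x.
have k1 := path_kernel_le1 A BW lipF (lexx 0) mB x.
rewrite fine_ge0//= -lee_fin fineK// ge0_fin_numE//.
by rewrite (le_lt_trans k1)// ltry.
Qed.

Let gE x : (g x)%:E = path_kernel P F A W 0 B x.
Proof.
have k0 := path_kernel_ge0 P F A W 0 B x.
have k1 := path_kernel_le1 A BW lipF (lexx 0) mB x.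
by rewrite fineK// ge0_fin_numE// (le_lt_trans k1)// ltry.
Qed.

Let mg : measurable_fun [set: borel_cV R d] g.
Proof.
apply: measurableT_comp => //.
exact: measurable_path_kernel.
Qed.

Let I01 n w : 0 <= I n w <= 1.
Proof. by rewrite /I indicE; case: (_ \in _); rewrite ?lexx ?ler01. Qed.

Let adapted_I n s : t n + c <= s ->
  @measurable_fun _ _ (g_sigma_algebraType (past_generators X s)) R setT (I n).
Proof.
move=> ns.
have mp : @measurable_fun _ _ (g_sigma_algebraType (past_generators X s))
    (g_sigma_algebraType (cylinder [set t : R | 0 <= t <= c] (@coordinate R d)))
    setT (fun w => shift_path (t n) (X ^~ w)).
  apply: (@measurability _ _ (g_sigma_algebraType (past_generators X s))
    (g_sigma_algebraType (cylinder [set t : R | 0 <= t <= c] (@coordinate R d)))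
    setT _ (cylinder [set t : R | 0 <= t <= c] (@coordinate R d))) => //.
  move=> _ [C cC <-]; rewrite setTI.
  elim: cC => [|r D C' /andP[r0 rc] mD _ mC']; first by rewrite preimage_setT.
  rewrite preimage_setI; apply: measurableI => //.
  apply: sub_sigma_algebra; exists (r + t n); last by exists D.
  by rewrite /= addr_ge0//= (le_trans _ ns)// addrC lerD2l.
have mB' : measurable (B : set (g_sigma_algebraType (cylinder [set t : R | 0 <= t <= c] (@coordinate R d)))).
  exact: cB.
exact: (measurableT_comp (measurable_indic mB') mp).
Qed.

Let adapted_G n s : t n <= s ->
  @measurable_fun _ _ (g_sigma_algebraType (past_generators X s)) R setT (G n).
Proof.
move=> ns; apply: (measurableT_comp mg).
apply: random_vector_sub => C Cs; apply: sub_sigma_algebra.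
by exists (t n) => //=; rewrite t0 ns.
Qed.

Let past_to_T s (f : T -> R) :
  @measurable_fun _ _ (g_sigma_algebraType (past_generators X s)) R setT f ->
  measurable_fun [set: T] f.
Proof.
move=> mf _ C mC; have := mf measurableT C mC; rewrite !setTI.
apply: sigma_sub_measurable => _ [u /andP[u0 _] [D mD <-]].
exact: (preimage_measurable (mX u0)).
Qed.

Let bI n : bounded_rv (I n).
Proof.
split; first by apply: past_to_T; exact: adapted_I (lexx _).
by exists 1 => w; have /andP[? ?] := I01 n w; rewrite ger0_norm.
Qed.

Let bG n : bounded_rv (G n).
Proof.
split; first by apply: past_to_T; exact: adapted_G (lexx _).
by exists 1 => w; have /andP[? ?] := g01 (X (t n) w); rewrite ger0_norm.
Qed.

Let markovR n (xi : T -> R) : bounded_rv xi -> (forall w, 0 <= xi w) ->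
  @measurable_fun _ _ (g_sigma_algebraType (past_generators X (t n))) R setT xi ->
  \int[P]_w (xi w * I n w) = \int[P]_w (xi w * G n w).
Proof.
move=> bxi xi0 axi; rewrite /Rintegral; congr fine.
have := @markov_stationary _ _ _ P _ _ F A W BW lipF X solX X0W statX mu lawX0
  (t n) B (EFin \o xi) (t0 n) mB.
move=> /(_ ((measurable_EFinP _ _).2 axi)) /(_ (fun w => xi0 w)) H.
apply: etrans (etrans H _); first by apply: eq_integral => w _.
by apply: eq_integral => w _; rewrite /= -gE -EFinM.
Qed.

Let orth c' k n : c <= c'%:R * delta -> (k + c' <= n)%N ->
  \int[P]_w ((I k w - G k w) * (I n w - G n w)) = 0.
Proof.
move=> cc kn.
have kn1 : t k + c <= t n.
  apply: (@le_trans _ _ (t k + c'%:R * delta)); first by rewrite lerD2l.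
  by rewrite -mulrDl -natrD ler_wpM2r ?ler_nat// ltW.
have kn2 : t k <= t n.
  by rewrite ler_wpM2r ?ler_nat ?(ltW delta0)// (leq_trans (leq_addr c' k)).
have E1 := markovR (bI k) (fun w => (andP (I01 k w)).1) (adapted_I kn1).
have E2 := markovR (bG k) (fun w => (andP (g01 _)).1) (adapted_G kn2).
have -> : \int[P]_w ((I k w - G k w) * (I n w - G n w)) =
    (\int[P]_w (I k w * I n w) - \int[P]_w (I k w * G n w)) -
    (\int[P]_w (G k w * I n w) - \int[P]_w (G k w * G n w)).
  rewrite -!RintegralB//; try (apply: bounded_rv_integrable;
    do ?[exact: bI | exact: bG | apply: bounded_rvM | apply: bounded_rvB]).
  by apply: eq_Rintegral => w _; rewrite mulrBl !mulrBr.
by rewrite E1 E2 !subrr.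
Qed.

Let p : R := fine (P [set w | B (X ^~ w)]).

Let int_g : \int[mu]_x g x = p.
Proof.
rewrite /Rintegral /p; congr fine.
have H := @markov_stationary _ _ _ P _ _ F A W BW lipF X solX X0W statX mu lawX0
  0 B (cst 1%E) (lexx 0) mB (@measurable_cst _ _ _ _ _ _) (fun=> lee01).
rewrite -(integral_marginal solX statX lawX0 (lexx 0) measurableT (g := EFin \o g)); last 2 first.
- exact/measurable_EFinP.
- by move=> x; rewrite lee_fin; case/andP: (g01 x).
have mE := measurable_path_event solX mB.
rewrite preimage_setT -[in RHS](setIT [set w | B _]) -(integral_indic P measurableT mE).
transitivity (\int[P]_w (cst 1 w * path_kernel P F A W 0 B (X 0 w)))%E.
  by apply: eq_integral => w _; rewrite /= gE mul1e.
rewrite -H; apply: eq_integral => w _; rewrite /= mul1e.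
by rewrite (_ : shift_path 0 _ = X ^~ w)//; apply/funext => r; rewrite /shift_path addr0.
Qed.

Let level (K i : nat) : set (borel_cV R d) := [set x | i.+1%:R <= g x * K%:R].

Let mlevel K i : measurable (level K i).
Proof.
have mgK : measurable_fun [set: borel_cV R d] (fun x => g x * K%:R).
  by apply: measurable_funM => //; exact: measurable_cst.
exact: (measurable_ge_set mgK).
Qed.

Let I_prob_measurable M (a : R) : measurable [set w | a < \sum_(n < M) I n w].
Proof.
have [mS _] := bounded_rv_sum M bI.
exact: (measurable_gt_set mS).
Qed.

Let G_upper K M (eps : R) w : (0 < K)%N ->
  (forall i, (i < K)%N ->
    M%:R^-1 * (\sum_(0 <= n < M) \1_(level K i) (X (t n) w)) <= fine (mu (level K i)) + eps) ->
  (0 < M)%N ->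
  \sum_(n < M) G n w <= (p + eps + K%:R^-1) * M%:R.
Proof.
move=> K0 h M0.
have KR0 : 0 < K%:R :> R by rewrite ltr0n.
have MR0 : 0 < M%:R :> R by rewrite ltr0n.
have levelE i x : \1_(level K i) x = (i.+1%:R <= g x * K%:R)%R%:R :> R.
  by rewrite indicE; congr ((nat_of_bool _)%:R); apply/idP/idP; rewrite inE.
have gK x : g x * K%:R <= K%:R by rewrite ler_piMl//; case/andP: (g01 x).
have up n : G n w * K%:R <= 1 + \sum_(i < K) \1_(level K i) (X (t n) w).
  rewrite -lerBlDl; apply: le_trans (level_count_ge (gK _)) _.
  by apply: ler_sum => i _; rewrite levelE.
have low : \sum_(i < K) fine (mu (level K i)) <= p * K%:R.
  have mui i : fine (mu (level K i)) = \int[mu]_x (\1_(level K i) x).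
    by rewrite /Rintegral integral_indic// setIT.
  under eq_bigr do rewrite mui.
  have b1 i : bounded_rv (\1_(level K i) : borel_cV R d -> R).
    split; first exact: measurable_indic.
    by exists 1 => x; rewrite levelE ger0_norm ?ler0n// lern1 leq_b1.
  rewrite -(mean_sum_rv mu K b1) -int_g mulrC -RintegralZl//; last first.
    apply: bounded_rv_integrable; split => //.
    by exists 1 => x; have /andP[? ?] := g01 x; rewrite ger0_norm.
  apply: le_Rintegral => //.
  - by apply: bounded_rv_integrable; exact: (bounded_rv_sum K b1).
  - apply: bounded_rv_integrable; apply: bounded_rvM.
      by split; [exact: measurable_cst|exists `|K%:R|].
    by split => //; exists 1 => x; have /andP[? ?] := g01 x; rewrite ger0_norm.
  - move=> x _; rewrite mulrC; under eq_bigr do rewrite levelE.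
    by apply: level_count_le; rewrite mulr_ge0//; case/andP: (g01 x).
have sumlev : \sum_(n < M) \sum_(i < K) \1_(level K i) (X (t n) w) <=
    M%:R * (p * K%:R + eps * K%:R).
  rewrite exchange_big/=.
  apply: (@le_trans _ _ (\sum_(i < K) (M%:R * (fine (mu (level K i)) + eps)))).
    apply: ler_sum => i _; rewrite -ler_pdivrMl//.
    by have := h i (ltn_ord i); rewrite big_mkord.
  rewrite -mulr_sumr ler_pM2l// big_split/= lerD//.
  by rewrite sumr_const card_ord mulr_natr.
rewrite -(ler_pM2r KR0) mulr_suml.
apply: (@le_trans _ _ (\sum_(n < M) (1 + \sum_(i < K) \1_(level K i) (X (t n) w)))).
  by apply: ler_sum => n _; exact: up.
rewrite big_split/= sumr_const card_ord -mulr_natr mul1r.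
apply: (le_trans (lerD (lexx _) sumlev)).
have -> : (p + eps + K%:R^-1) * M%:R * K%:R =
   M%:R * (p * K%:R + eps * K%:R) + M%:R * (K%:R^-1 * K%:R) by ring.
by rewrite mulVf ?gt_eqF// mulr1 addrC.
Qed.

(** The indicators [I n] are compared with their conditional expectations [G n].
    The differences are orthogonal as soon as the window of length [c] of one
    event ends before the next one starts, and Chebyshev's inequality applies;
    the average of the [G n] is that of a function of the state, for which the
    ergodicity condition holds level by level. *)
Lemma law_of_large_numbers (eps eta : R) : 0 < eps -> 0 < eta ->
  exists2 M, (0 < M)%N &
  (P [set w | (p + eps) * M%:R < \sum_(n < M) I n w]%R <= eta%:E)%E.
Proof.
move=> eps0 eta0.
have e40 : 0 < eps / 4 by rewrite divr_gt0.
have [k _ /(_ k (leqnn k))/= kP] := near_infty_natSinv_lt (PosNum e40).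
pose K := k.+1.
have eK : 0 < eta / 2 / K%:R by rewrite !divr_gt0 ?ltr0n.
have [c' cc'] : exists c' : nat, c <= c'%:R * delta.
  exists (Num.truncn (`|c| / delta)).+1; rewrite -ler_pdivrMr//.
  apply: (le_trans _ (ltW (truncnS_gt _))).
  by rewrite ler_pM2r ?invr_gt0// ler_norm.
have [c'' c''P] : exists N : nat, forall M, (N <= M)%N ->
    forall i, (i < K)%N ->
    (P [set w | eps / 4 < `|M%:R^-1 * (\sum_(0 <= n < M) \1_(level K i) (X (t n) w))
         - fine (mu (level K i))|]%R <= (eta / 2 / K%:R)%:E)%E.
  have H i : exists N : nat, forall M, (N <= M)%N ->
    (P [set w | eps / 4 < `|M%:R^-1 * (\sum_(0 <= n < M) \1_(level K i) (X (t n) w))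
         - fine (mu (level K i))|]%R <= (eta / 2 / K%:R)%:E)%E.
    have := ergX (mlevel K i) delta0 e40.
    move=> /fine_cvgP[finM]/cvgrPdist_lt/(_ _ eK) H1.
    have [N _ NP] : \forall M \near \oo,
       (P [set w | eps / 4 < `|M%:R^-1 * (\sum_(0 <= n < M) \1_(level K i) (X (t n) w))
         - fine (mu (level K i))|]%R <= (eta / 2 / K%:R)%:E)%E.
      apply: filterS2 finM H1 => M fM; rewrite /= sub0r normrN => h.
      rewrite -(fineK fM) lee_fin; apply: (le_trans (ler_norm _)); exact: ltW.
    by exists N.
  have /choice[f fP] := H; exists (\max_(i < K) f i) => M fM i iK.
  apply: fP; apply: leq_trans fM; exact: (leq_bigmax (Ordinal iK)).
pose C : R := (2 * c' + 1)%:R / (eps / 2 * (eps / 2)).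
have ee0 : 0 < eps / 2 * (eps / 2) by rewrite mulr_gt0// divr_gt0.
have C0 : 0 <= C by rewrite divr_ge0// ltW.
pose M := maxn c'' (Num.truncn (C / (eta / 2))).+1.
have M0 : (0 < M)%N by rewrite /M leq_max orbT.
have MR0 : 0 < M%:R :> R by rewrite ltr0n.
have CM : C / M%:R <= eta / 2.
  rewrite ler_pdivrMr// mulrC -ler_pdivrMr ?divr_gt0//.
  apply: (le_trans (ltW (truncnS_gt _))); rewrite ler_nat leq_maxr//.
exists M => //.
pose E1 := [set w | eps / 2 * M%:R < \sum_(n < M) (I n w - G n w)].
pose E2 i := [set w | eps / 4 < `|M%:R^-1 * (\sum_(0 <= n < M) \1_(level K i) (X (t n) w))
         - fine (mu (level K i))|].
have bZ n : bounded_rv (fun w => I n w - G n w) by exact: bounded_rvB.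
have bS := bounded_rv_sum M bZ.
have mE1 : measurable E1 by exact: (measurable_gt_set bS.1).
have mE2 i : measurable (E2 i).
  have mf : measurable_fun [set: T] (fun w => `|M%:R^-1 * (\sum_(0 <= n < M)
      \1_(level K i) (X (t n) w)) - fine (mu (level K i))|).
    apply: measurableT_comp => //; apply: measurable_funB; last exact: measurable_cst.
    apply: measurable_funM; first exact: measurable_cst.
    under eq_fun do rewrite big_mkord.
    apply: measurable_sum => n.
    exact: (measurableT_comp (measurable_indic (mlevel K i)) (mX (t0 n))).
  exact: (measurable_gt_set mf).
have PE1 : (P E1 <= (eta / 2)%:E)%E.
  apply: (le_trans (chebyshev_square P bS _)); first by rewrite mulr_gt0// divr_gt0.
  rewrite lee_fin (le_trans _ CM)// /C.
  have := second_moment_sum (c := c') (Z := fun n w => I n w - G n w) M bZ.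
  have Z1 n w : `|I n w - G n w| <= 1.
    have /andP[? ?] := I01 n w; have /andP[? ?] := g01 (X (t n) w).
    by rewrite /G ler_norml; apply/andP; split; lra.
  move=> /(_ P Z1 (fun k n => @orth c' k n cc')) h.
  rewrite ler_pdivrMr ?mulr_gt0 ?divr_gt0//.
  apply: (le_trans h); rewrite le_eqVlt; apply/orP; left; apply/eqP.
  by field; rewrite ?gt_eqF.
have PE2 : (P (\big[setU/set0]_(i < K) E2 i) <= (eta / 2)%:E)%E.
  apply: (le_trans (Boole_inequality P (fun i _ => mE2 i))).
  apply: (@le_trans _ _ (\sum_(i < K) (eta / 2 / K%:R)%:E)%E).
    by apply: lee_sum => i _; apply: c''P => //; rewrite leq_maxl.
  by rewrite sumEFin sumr_const card_ord lee_fin -[X in X <= _]mulr_natr divfK// gt_eqF.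
apply: (@le_trans _ _ (P (E1 `|` \big[setU/set0]_(i < K) E2 i))).
  apply: le_measure; rewrite ?inE.
  - exact: I_prob_measurable.
  - by apply: measurableU => //; exact: bigsetU_measurable.
  move=> w /= pw; have [E1w|E1w] := pselect (E1 w); [by left|right].
  apply: contrapT => E2w.
  have : \sum_(n < M) G n w <= (p + eps / 4 + K%:R^-1) * M%:R.
    apply: G_upper => // i iK; rewrite addrC -lerBlDr leNgt; apply/negP => h.
    apply: E2w; rewrite -bigcup_mkord; exists i => //=.
    by apply: lt_le_trans h (ler_norm _).
  move: E1w => /negP; rewrite /E1/= -leNgt sumrB lerBlDr => E1w G1.
  have : (K%:R^-1 : R) < eps / 4 by [].
  have {}pw : (p + eps) * M%:R < \sum_(n < M) I n w by [].
  move: (\sum_(n < M) I n w) (\sum_(n < M) G n w) (K%:R^-1 : R) E1w G1 pw => a b u h1 h2 h3 h4.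
  have : u * M%:R < eps / 4 * M%:R by rewrite ltr_pM2r.
  nra.
apply: (le_trans (measureU2 _ _ _)) => //; first exact: bigsetU_measurable.
by rewrite [eta]splitr EFinD leeD.
Qed.

End law_of_large_numbers.

(** * Pointwise upper bounds for frequencies *)

Section counting.
Context {R : realType}.

(** Average over [m < M] of the sums shifted by [m], each of which differs from
    the sum by at most [m]. *)
Lemma block_average (a b : nat -> R) (c : R) M N : (0 < M)%N ->
  (forall n, 0 <= a n <= 1) ->
  (forall n, \sum_(m < M) a (n + m)%N <= c * M%:R + M%:R * b n) ->
  \sum_(n < N) a n <= c * N%:R + \sum_(n < N) b n + M%:R.
Proof.
move=> M0 a01 h; have MR0 : 0 < M%:R :> R by rewrite ltr0n.
have shiftm m : \sum_(n < N) a n <= \sum_(n < N) a (n + m)%N + m%:R.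
  elim: m => [|m IH]; first by under [in leRHS]eq_bigr do rewrite addn0; rewrite addr0.
  apply: (le_trans IH); rewrite -natr1 addrA (addrC _ 1) addrA lerD2r.
  have tele : a m + \sum_(n < N) a (n + m.+1)%N = \sum_(n < N) a (n + m)%N + a (N + m)%N.
    transitivity (\sum_(n < N.+1) a (n + m)%N); last by rewrite big_ord_recr.
    rewrite big_ord_recl/= add0n; congr (_ + _).
    by apply: eq_bigr => n _; rewrite /bump/= add1n addSnnS.
  have /andP[am _] := a01 (N + m)%N; have /andP[_ am1] := a01 m.
  by rewrite -(lerD2r (a (N + m)%N)) -tele; lra.
rewrite -(ler_pM2l MR0).
have -> : M%:R * \sum_(n < N) a n = \sum_(m < M) \sum_(n < N) a n.
  by rewrite sumr_const card_ord mulr_natl.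
apply: (@le_trans _ _ (\sum_(m < M) (\sum_(n < N) a (n + m)%N + M%:R))).
  apply: ler_sum => m _; apply: (le_trans (shiftm m)); rewrite lerD2l ler_nat.
  exact: ltnW.
have E : \sum_(m < M) M%:R = M%:R * M%:R :> R by rewrite sumr_const card_ord mulr_natl.
rewrite big_split/= E exchange_big/= [leRHS]mulrDr lerD2r.
apply: (@le_trans _ _ (\sum_(n < N) (c * M%:R + M%:R * b n))).
  by apply: ler_sum => n _; exact: h.
by rewrite big_split/= sumr_const card_ord -[X in X + _]mulr_natr -mulr_sumr; lra.
Qed.

(** A greedy covering: reading from left to right, a block of high frequency is
    skipped as a whole as soon as it starts. *)
Lemma greedy_count (b : nat -> R) (lam : R) K : 0 < lam -> (forall n, 0 <= b n) ->
  forall N s, lam * \sum_(i < N)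
     `[< exists2 j, (0 < j <= K)%N & lam * j%:R < \sum_(l < j) b (s + i + l)%N >]%:R
   <= \sum_(i < N + K) b (s + i)%N.
Proof.
move=> lam0 b0; elim/ltn_ind => N IH s.
have tail m n' : (m <= n')%N -> \sum_(i < m) b (s + i)%N <= \sum_(i < n') b (s + i)%N.
  move=> /subnKC <-; rewrite big_split_ord/= lerDl; exact: sumr_ge0.
case: N => [|N] in IH *; first by rewrite big_ord0 mulr0 sumr_ge0.
have [[j /andP[j0 jK] hj]|no] := pselect (exists2 j, (0 < j <= K)%N &
   lam * j%:R < \sum_(l < j) b (s + l)%N).
  have cnt n s' : lam * \sum_(i < n) `[< exists2 j, (0 < j <= K)%N &
      lam * j%:R < \sum_(l < j) b (s' + i + l)%N >]%:R <= lam * n%:R.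
    rewrite ler_pM2l//; apply: (@le_trans _ _ (\sum_(i < n) 1)).
      by apply: ler_sum => i _; rewrite lern1 leq_b1.
    by rewrite sumr_const card_ord.
  have [Nj|jN] := leqP N.+1 j.
    apply: (le_trans (cnt _ _)); apply: (@le_trans _ _ (lam * j%:R)).
      by rewrite ler_pM2l// ler_nat.
    apply: (le_trans (ltW hj)); apply: tail.
    by rewrite (leq_trans jK)// leq_addl.
  rewrite -[in leLHS](subnKC (ltnW jN)) big_split_ord/= mulrDr.
  apply: (@le_trans _ _ (lam * j%:R + \sum_(i < N.+1 - j + K) b (s + j + i)%N)).
    rewrite lerD ?cnt//; under [X in lam * X]eq_bigr do rewrite addnA.
    by apply: IH; lia.
  apply: (@le_trans _ _ (\sum_(i < j) b (s + i)%N +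
      \sum_(i < N.+1 - j + K) b (s + j + i)%N)); first by rewrite lerD2r ltW.
  have -> : (N.+1 + K = j + (N.+1 - j + K))%N by lia.
  rewrite [leRHS]big_split_ord/= lerD2l; apply: ler_sum => i _.
  by rewrite addnA.
rewrite big_ord_recl/= addn0 asboolF//= add0r.
under [X in lam * X]eq_bigr do rewrite /bump/= add1n addnS -addSn.
apply: (le_trans (IH N _ s.+1)); first exact: ltnSn.
rewrite addSn big_ord_recl/= -[leLHS]add0r lerD//.
by under [in leRHS]eq_bigr do rewrite /bump/= add1n addnS -addSn.
Qed.

End counting.

Section path_counts.
Context {R : realType} {d : nat}.

Definition path_upto (c : R) :=
  g_sigma_algebraType (cylinder [set t : R | 0 <= t <= c] (@coordinate R d)).

Lemma shift_path_until s c c' : 0 <= s -> s + c <= c' ->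
  @measurable_fun _ _ (path_upto c') (path_upto c) setT (shift_path s).
Proof.
move=> s0 sc; apply: (@measurability _ _ (path_upto c') (path_upto c) setT _
  (cylinder [set t : R | 0 <= t <= c] (@coordinate R d))) => //.
move=> _ [A cA <-]; rewrite setTI; elim: cA => [|t B C /andP[t0 tc] mB _ IH].
  by rewrite preimage_setT.
rewrite preimage_setI; apply: measurableI => //.
rewrite -[X in measurable X]setIT; apply: sub_sigma_algebra.
have -> : shift_path s @^-1` (coordinate t @^-1` B) = coordinate (t + s) @^-1` B by [].
apply: cylinderI => //; last exact: cylinderT.
by rewrite /= addr_ge0//= (le_trans _ sc)// addrC lerD2l.
Qed.

Definition visits (Q : set (R -> 'cV[R]_d)) (h : R) (M : nat) (x : R -> 'cV[R]_d) : R :=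
  \sum_(k < M) \1_Q (shift_path (k%:R * h) x).

Lemma visits_until Q c h M (a : R) : 0 <= h -> path_until c Q ->
  path_until (M%:R * h + c) [set x | a < visits Q h M x].
Proof.
move=> h0 cQ.
have mv : @measurable_fun _ _ (path_upto (M%:R * h + c)) R setT (visits Q h M).
  apply: measurable_sum => k.
  apply: (@measurableT_comp _ _ _ _ (path_upto c)).
    by apply: measurable_indic; exact: cQ.
  apply: shift_path_until; first by rewrite mulr_ge0.
  by rewrite lerD2r ler_wpM2r// ler_nat ltnW.
have := mv measurableT `]a, +oo[%classic (measurable_itv _).
rewrite setTI; congr (path_until _ _).
by apply/seteqP; split => x /=; rewrite in_itv/= andbT.
Qed.

Lemma visits_le Q h M x : visits Q h M x <= M%:R.
Proof.
apply: (@le_trans _ _ (\sum_(i < M) 1)); last by rewrite sumr_const card_ord.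
by apply: ler_sum => i _; rewrite indicE lern1 leq_b1.
Qed.

End path_counts.

Section pointwise_ergodic.
Context {R : realType} {dsp} {T : measurableType dsp} (P : probability T R).
Context {d m : nat} (F : 'cV[R]_d -> 'cV[R]_d) (A : 'M[R]_(d, m)).
Variable W : R -> T -> 'cV[R]_m.
Hypotheses (BW : standard_brownian_motion P W) (lipF : locally_lipschitz F).
Variable X : R -> T -> 'cV[R]_d.
Hypotheses (solX : sde_solution P F A W X)
  (X0W : independent_of_process P (X 0) W) (statX : stationary P X).
Variable mu : probability (borel_cV R d) R.
Hypotheses (lawX0 : has_law P (X 0) mu) (ergX : ergodicity_condition P mu X).

Definition path_prob (Q : set (R -> 'cV[R]_d)) : R := fine (P [set w | Q (X ^~ w)]).

Let mX t : 0 <= t -> random_vector (X t).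
Proof. by case: solX => h _ _; exact: h. Qed.

Let mpath (Q : set (path_space R d)) s : 0 <= s -> measurable Q ->
  measurable [set w | Q (shift_path s (X ^~ w))].
Proof.
move=> s0 mQ; have mp : @measurable_fun _ _ T (path_space R d) setT
    (fun w => shift_path s (X ^~ w)).
  by apply: measurable_path => t t0; apply: mX; exact: addr_ge0.
exact: (preimage_measurable mp).
Qed.

Let bounded_indic (Q : set (path_space R d)) s : 0 <= s -> measurable Q ->
  bounded_rv (fun w => \1_Q (shift_path s (X ^~ w)) : R).
Proof.
move=> s0 mQ; split; first exact: (measurable_indic (mpath s0 mQ)).
by exists 1 => w; rewrite indicE; case: (_ \in _); rewrite ?normr1 ?normr0.
Qed.

Let expectation_indic (Q : set (path_space R d)) s : 0 <= s -> measurable Q ->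
  \int[P]_w (\1_Q (shift_path s (X ^~ w))) = path_prob Q.
Proof.
move=> s0 mQ; rewrite /path_prob -(stationary_path solX statX s0 mQ).
rewrite /Rintegral; congr fine; rewrite -[in RHS](setIT [set w | _ (shift_path s _)]).
by rewrite -(integral_indic P measurableT (mpath s0 mQ)).
Qed.

Lemma shift_pathD s t (x : R -> 'cV[R]_d) :
  shift_path s (shift_path t x) = shift_path (t + s) x.
Proof. by apply/funext => r; rewrite /shift_path -addrA (addrC s). Qed.

(** The maximal ergodic inequality: the greedy bound is integrated, divided by
    [N], and [N] tends to infinity, then [K]. *)
Lemma maximal_inequality (Q : set (path_space R d)) h (lam : R) :
  0 <= h -> 0 < lam -> measurable Q ->
  (forall j a, measurable ([set x | a < visits Q h j x]%R : set (path_space R d))) ->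
  (P [set w | exists2 j, (0 < j)%N & (lam * j%:R < visits Q h j (X ^~ w))%R]
    <= (path_prob Q / lam)%:E)%E.
Proof.
move=> h0 lam0 mQ mv.
pose E K : set (path_space R d) :=
  [set x | exists2 j, (0 < j <= K)%N & lam * j%:R < visits Q h j x].
have mE K : measurable (E K).
  rewrite (_ : E K = \bigcup_(j in [set j | (0 < j <= K)%N]) [set x | lam * j%:R < visits Q h j x]).
    by apply: bigcup_measurable => j _; exact: mv.
  by apply/seteqP; split => x [j ? ?]; exists j.
have vE j i w : visits Q h j (shift_path (i%:R * h) (X ^~ w)) =
    \sum_(l < j) \1_Q (shift_path ((0 + i + l)%N%:R * h) (X ^~ w)).
  by apply: eq_bigr => l _; rewrite shift_pathD add0n natrD mulrDl.
have pE K : path_prob (E K) <= path_prob Q / lam.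
  rewrite ler_pdivlMr// mulrC leNgt; apply/negP => lt.
  pose N := (Num.truncn (K%:R * path_prob Q / (lam * path_prob (E K) - path_prob Q))).+1.
  have Nlt : K%:R * path_prob Q < N%:R * (lam * path_prob (E K) - path_prob Q).
    by rewrite -ltr_pdivrMr ?subr_gt0//; exact: truncnS_gt.
  have : lam * (N%:R * path_prob (E K)) <= (N + K)%:R * path_prob Q.
    have bE i : bounded_rv (fun w => \1_(E K) (shift_path (i%:R * h) (X ^~ w)) : R).
      by apply: bounded_indic => //; rewrite mulr_ge0.
    have bQ i : bounded_rv (fun w => \1_Q (shift_path (i%:R * h) (X ^~ w)) : R).
      by apply: bounded_indic => //; rewrite mulr_ge0.
    have -> : N%:R * path_prob (E K) =
        \int[P]_w (\sum_(i < N) \1_(E K) (shift_path (i%:R * h) (X ^~ w))).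
      rewrite (mean_sum_rv P N bE) (eq_bigr (fun=> path_prob (E K))).
        by rewrite sumr_const card_ord mulr_natl.
      by move=> i _; apply: expectation_indic => //; rewrite mulr_ge0.
    have -> : (N + K)%:R * path_prob Q =
        \int[P]_w (\sum_(i < N + K) \1_Q (shift_path (i%:R * h) (X ^~ w))).
      rewrite (mean_sum_rv P (N + K)%N bQ) (eq_bigr (fun=> path_prob Q)).
        by rewrite sumr_const card_ord mulr_natl.
      by move=> i _; apply: expectation_indic => //; rewrite mulr_ge0.
    rewrite -RintegralZl//; last exact/bounded_rv_integrable/(bounded_rv_sum N bE).
    apply: le_Rintegral => //.
    - apply: bounded_rv_integrable; apply: bounded_rvM.
        by split; [exact: measurable_cst|exists `|lam|].
      exact: (bounded_rv_sum N bE).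
    - exact/bounded_rv_integrable/(bounded_rv_sum (N + K)%N bQ).
    move=> w _; have b0 n : 0 <= \1_Q (shift_path (n%:R * h) (X ^~ w)) :> R.
      by rewrite indicE ler0n.
    have := greedy_count K lam0 b0 N 0; apply: le_trans.
    rewrite ler_pM2l//; apply: ler_sum => i _; rewrite indicE ler_nat.
    case: (boolP (_ \in _)) => //; rewrite inE => -[j jK].
    rewrite vE => hj; rewrite asboolT//; by exists j.
  rewrite natrD; nra.
have mEX K : measurable [set w | E K (X ^~ w)].
  by have := mpath (lexx 0) (mE K); rewrite (_ : shift_path 0 = id)//;
    apply/funext => x; apply/funext => r; rewrite /shift_path addr0.
have -> : [set w | exists2 j, (0 < j)%N & lam * j%:R < visits Q h j (X ^~ w)] =
    \bigcup_K [set w | E K (X ^~ w)].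
  apply/seteqP; split => [w [j j0 hj]|w [K _ [j /andP[j0 jK] hj]]]; last by exists j.
  by exists j => //; exists j => //; rewrite j0 leqnn.
have nd : nondecreasing_seq (fun K => [set w | E K (X ^~ w)]).
  move=> K L KL; apply/subsetPset => w [j /andP[j0 jK] hj]; exists j => //.
  by rewrite j0 (leq_trans jK).
have cv := nondecreasing_cvg_mu (mu := P) mEX (bigcupT_measurable _ mEX) nd.
rewrite -(cvg_lim _ cv)//; apply: lime_le; first by apply/cvg_ex; eexists; exact: cv.
apply: nearW => K /=.
by rewrite -(fineK (fin_num_measure P _ (mEX K))) lee_fin; exact: pE.
Qed.

(** Almost surely, the frequency of visits along the lattice [h Z] is
    asymptotically at most the probability: the weak law of large numbers makes
    block averages exceed the probability only on a rare event, and by the maximal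
    inequality the visits to a rare event are uniformly rare. *)
Lemma visits_upper (Q : set (R -> 'cV[R]_d)) c h (eps : R) :
  path_until c Q -> 0 < h -> 0 < eps ->
  exists N : set (path_space R d), [/\ measurable N,
    P [set w | N (X ^~ w)] = 0%E &
    forall x, ~ N x -> exists K0, forall K, (K0 <= K)%N ->
      visits Q h K x <= (path_prob Q + eps) * K%:R].
Proof.
move=> cQ h0 eps0; have mQ := path_until_sub cQ.
have mv j (a : R) : measurable ([set x | a < visits Q h j x] : set (path_space R d)).
  exact: (path_until_sub (visits_until a (ltW h0) cQ)).
pose Nl : set (path_space R d) := [set x | forall K0, exists2 K, (K0 <= K)%N &
   (path_prob Q + eps) * K%:R < visits Q h K x].
have mN : measurable Nl.
  have -> : Nl = \bigcap_K0 \bigcup_(K in [set K | (K0 <= K)%N])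
      [set x | (path_prob Q + eps) * K%:R < visits Q h K x].
    apply/seteqP; split => [x H K0 _|x H K0].
      by have [K ? ?] := H K0; exists K.
    by have [K ? ?] := H K0 Logic.I; exists K.
  apply: bigcapT_measurable => K0; apply: bigcup_measurable => K _; exact: mv.
exists Nl; split => //; last first.
  move=> x Nx; apply: contrapT => H; apply: Nx => K0; apply: contrapT => H2.
  apply: H; exists K0 => K K0K; rewrite leNgt; apply/negP => lt; apply: H2.
  by exists K.
have e40 : 0 < eps / 4 by rewrite divr_gt0.
have mNX : measurable [set w | Nl (X ^~ w)] by exact: (measurable_path_event solX).
apply/eqP; rewrite eq_le measure_ge0 andbT; apply/lee_addgt0Pr => eta eta0.
rewrite add0e.
have [M M0 PM] := law_of_large_numbers BW lipF solX X0W statX lawX0 ergX h0 cQ e40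
  (mulr_gt0 eta0 e40).
pose Q' : set (R -> 'cV[R]_d) := [set x | (path_prob Q + eps / 4) * M%:R < visits Q h M x].
have cQ' : path_until (M%:R * h + c) Q' by exact: (visits_until _ (ltW h0) cQ).
have mv' j (a : R) : measurable ([set x | a < visits Q' h j x] : set (path_space R d)).
  exact: (path_until_sub (visits_until a (ltW h0) cQ')).
have mQ' := path_until_sub cQ'.
have pQ' : path_prob Q' <= eta * (eps / 4).
  rewrite -lee_fin; apply: le_trans PM; rewrite le_eqVlt; apply/orP; left.
  by apply/eqP/fineK/fin_num_measure; exact: (measurable_path_event solX).
have := maximal_inequality (ltW h0) e40 mQ' mv'.
move=> /le_trans; have -> : eta = eta * (eps / 4) / (eps / 4) by rewrite mulfK// gt_eqF.
move=> /(_ (eta * (eps / 4) / (eps / 4))%:E) H.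
apply: (le_trans _ (H _)); last by rewrite lee_fin ler_pM2r ?invr_gt0.
apply: le_measure; rewrite ?inE//.
  rewrite (_ : [set w | _] = \bigcup_(j in [set j | (0 < j)%N])
      [set w | [set x | eps / 4 * j%:R < visits Q' h j x] (X ^~ w)]).
    by apply: bigcup_measurable => j _; exact: (measurable_path_event solX (mv' j _)).
  by apply/seteqP; split => w [j ? ?]; exists j.
move=> w; apply: contrapT => /not_implyP[Nw no].
pose K0 := (Num.truncn (M%:R / (eps / 2))).+1.
have [K K0K] := Nw K0; apply/negP; rewrite -leNgt.
have KM : M%:R <= eps / 2 * K%:R.
  rewrite mulrC -ler_pdivrMr ?divr_gt0//; apply: (le_trans (ltW (truncnS_gt _))).
  by rewrite ler_nat.
have K00 : (0 < K)%N by exact: leq_trans K0K.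
have block : visits Q h K (X ^~ w) <= (path_prob Q + eps / 4) * K%:R +
    visits Q' h K (X ^~ w) + M%:R.
  apply: (@block_average _ (fun n => \1_Q (shift_path (n%:R * h) (X ^~ w)))
    (fun n => \1_Q' (shift_path (n%:R * h) (X ^~ w))) _ M) => // n.
    by rewrite indicE ler0n lern1 leq_b1.
  have -> : \sum_(m0 < M) \1_Q (shift_path ((n + m0)%N%:R * h) (X ^~ w)) =
      visits Q h M (shift_path (n%:R * h) (X ^~ w)).
    by apply: eq_bigr => l _; rewrite shift_pathD natrD mulrDl.
  rewrite indicE; case: (boolP (_ \in _)).
    move=> _; rewrite mulr1; apply: (@le_trans _ _ M%:R).
      exact: visits_le.
    rewrite lerDr; apply: mulr_ge0 => //; apply: addr_ge0; last exact: ltW.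
    by rewrite /path_prob; exact: fine_ge0.
  by move=> /negP; rewrite inE /Q'/= mulr0 addr0 => /negP; rewrite -leNgt.
have : visits Q' h K (X ^~ w) <= eps / 4 * K%:R.
  by rewrite leNgt; apply/negP => lt; apply: no; exists K.
move: block; set v1 := visits _ _ _ _; set v2 := visits _ _ _ _; nra.
Qed.

End pointwise_ergodic.

(** * Frequencies of sign changes for all step sizes at once *)

Section turns.
Context {R : realType} {d : nat} (j0 : 'I_d) (sg : R).

(** The increments change sign when the turn for [sg = 1] is negative; the turns
    for [sg = -1] allow to bound their frequency from below by upper bounds. *)
Definition turn (delta u : R) (x : R -> 'cV[R]_d) : R :=
  sg * ((x (u + delta) j0 0 - x u j0 0) *
        (x (u + delta + delta) j0 0 - x (u + delta) j0 0)).

Lemma turn_shift delta u s x : turn delta u (shift_path s x) = turn delta (u + s) x.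
Proof.
by rewrite /turn /shift_path; do 2 rewrite (addrAC _ delta s); rewrite (addrAC u delta s).
Qed.

Lemma half_line_continuous_coord (x : R -> 'cV[R]_d) : half_line_continuous x ->
  continuous (fun t : R => x (Num.max 0 t) j0 0 : R).
Proof.
move=> cx t; apply/cvgrPdist_lt => e e0.
have [r r0 rP] := cx t e e0.
apply/nbhs_ballP; exists r => //= s /rP; apply: le_lt_trans.
by have := cV_norm_coord (x (Num.max 0 t) - x (Num.max 0 s)) j0; rewrite !mxE.
Qed.

Lemma turn_cvg (x : R -> 'cV[R]_d) (u_ dl_ : nat -> R) (u dl : R) : half_line_continuous x ->
  0 <= u -> 0 <= dl -> (forall k, 0 <= u_ k) -> (forall k, 0 <= dl_ k) ->
  u_ @ \oo --> u -> dl_ @ \oo --> dl ->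
  turn (dl_ k) (u_ k) x @[k --> \oo] --> turn dl u x.
Proof.
move=> /half_line_continuous_coord cx u0 dl0 u_0 dl_0 cu cdl.
pose y t : R := x (Num.max 0 t) j0 0.
have yE t : 0 <= t -> x t j0 0 = y t by move=> t0; rewrite /y max_r.
have cy (v_ : nat -> R) v : v_ @ \oo --> v -> y (v_ k) @[k --> \oo] --> y v.
  by move=> cv; apply: continuous_cvg => //; exact: cx.
have c1 : u_ k + dl_ k @[k --> \oo] --> u + dl by apply: cvgD.
have c2 : u_ k + dl_ k + dl_ k @[k --> \oo] --> u + dl + dl by apply: cvgD.
rewrite /turn !yE ?addr_ge0//.
under eq_cvg do rewrite !yE ?addr_ge0//.
apply: cvgM; first exact: cvg_cst.
by apply: cvgM; apply: cvgB; exact: cy.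
Qed.

(** Rational parameters suffice by continuity, which makes this a measurable
    event; it does not depend on the step that is close to [delta0]. *)
Definition near_turn (delta0 : R) (n : nat) : set (R -> 'cV[R]_d) :=
  [set x | exists a b : rat, [/\ 0 < (ratr a : R) < n.+1%:R^-1,
     `|ratr b - delta0| < n.+1%:R^-1, 0 <= ratr b :> R &
     turn (ratr b) (ratr a) x < n.+1%:R^-1]].

(** The last time that the event looks at is [u + 2 delta], where [u <= 1] and
    [delta <= delta0 + 1]. *)
Lemma near_turn_until delta0 n :
  path_until (1 + (delta0 + 1) + (delta0 + 1)) (near_turn delta0 n).
Proof.
pose c : R := 1 + (delta0 + 1) + (delta0 + 1).
pose E (p : rat * rat) : set (@path_upto R d c) := [set x |
  [/\ 0 < (ratr p.1 : R) < n.+1%:R^-1,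
     `|ratr p.2 - delta0| < n.+1%:R^-1, 0 <= ratr p.2 :> R &
     turn (ratr p.2) (ratr p.1) x < n.+1%:R^-1]].
have -> : near_turn delta0 n = \bigcup_p E p.
  apply/seteqP; split => [x [a [b h]]|x [[a b] _ h]]; first by exists (a, b).
  by exists a, b.
apply: (@countable_bigcupT_measurable _ (@path_upto R d c)) => // -[a b].
have n1 : n.+1%:R^-1 <= 1 :> R by rewrite invf_le1// ler1n.
have [/= h|h] := pselect [/\ 0 < (ratr a : R) < n.+1%:R^-1,
     `|ratr b - delta0| < n.+1%:R^-1 & 0 <= ratr b :> R]; last first.
  rewrite (_ : E _ = set0); first exact: measurable0.
  by rewrite -subset0 => x -[/= h1 h2 h3 _]; exact: h.
have [/andP[a0 an] bd b0] := h.
have bd' : ratr b < delta0 + 1.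
  by move: bd; rewrite ltr_norml => /andP[_]; rewrite ltrBlDl => /lt_le_trans; apply; rewrite lerD2l.
have mc r : 0 <= r <= c -> measurable_fun [set: @path_upto R d c] (fun x => x r j0 0 : R).
  move=> rc; apply: (@measurable_coord_of _ _ (@path_upto R d c) d (coordinate r)) => _ C mC.
  by rewrite setTI -[X in measurable X]setIT; apply: sub_sigma_algebra;
    apply: cylinderI => //; exact: cylinderT.
have mt : measurable_fun [set: @path_upto R d c] (turn (ratr b) (ratr a)).
  apply: measurable_funM; first exact: measurable_cst.
  have {}an := lt_le_trans an n1; move: (ratr a : R) (ratr b : R) a0 an b0 bd'.
  move=> u v u0 u1 v0 v1.
  by apply: measurable_funM; apply: measurable_funB; apply: mc; rewrite /c;
    apply/andP; split; lra.
have := mt measurableT `]-oo, n.+1%:R^-1[%classic (measurable_itv _).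
rewrite setTI; congr (measurable _).
apply/seteqP; split => x /=; rewrite in_itv/= => //; last by case.
by move=> ?; split => //; apply/andP.
Qed.

Lemma near_turn_limit (delta0 : R) (x : R -> 'cV[R]_d) : 0 < delta0 -> half_line_continuous x ->
  (forall n, near_turn delta0 n x) -> turn delta0 0 x <= 0.
Proof.
move=> d0 cx h.
have /choice[ab abP] : forall n, exists p : rat * rat,
    [/\ 0 < (ratr p.1 : R) < n.+1%:R^-1,
     `|ratr p.2 - delta0| < n.+1%:R^-1, 0 <= ratr p.2 :> R &
     turn (ratr p.2) (ratr p.1) x < n.+1%:R^-1].
  by move=> n; have [a [b ?]] := h n; exists (a, b).
have inv0 : n.+1%:R^-1 @[n --> \oo] --> (0 : R) by exact: cvg_harmonic.
have ca : ratr (ab n).1 @[n --> \oo] --> (0 : R).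
  apply: (squeeze_cvgr _ (cvg_cst 0) inv0); apply: nearW => n.
  by have [/andP[? ?] _ _ _] := abP n; rewrite !ltW.
have cb : ratr (ab n).2 @[n --> \oo] --> delta0.
  apply/cvgrPdist_lt => e e0.
  have := near_infty_natSinv_lt (PosNum e0); apply: filterS => n /= ne.
  by have [_ h2 _ _] := abP n; rewrite distrC (lt_trans h2).
have ct := turn_cvg cx (lexx 0) (ltW d0)
  (fun n => let: And4 h1 _ _ _ := abP n in ltW (andP h1).1)
  (fun n => let: And4 _ _ h3 _ := abP n in h3) ca cb.
apply: (ler_cvg_to ct inv0); apply: nearW => n.
by have [_ _ _ /ltW] := abP n.
Qed.

Lemma near_turnP (delta0 : R) n (x : R -> 'cV[R]_d) (v delta : R) : half_line_continuous x ->
  0 < v < n.+1%:R^-1 -> `|delta - delta0| < n.+1%:R^-1 -> 0 < delta ->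
  turn delta v x <= 0 -> near_turn delta0 n x.
Proof.
move=> cx /andP[v0 vn] dn dl0 t0.
have rat_seq (r : R) : 0 < r -> exists2 q : nat -> rat,
    ratr (q k) @[k --> \oo] --> r & forall k, 0 < ratr (q k) :> R.
  move=> r0; have /choice[q qP] : forall k : nat, exists q : rat,
      r < (ratr q : R) < r + k.+1%:R^-1.
    move=> k; have : r < r + k.+1%:R^-1 by rewrite ltrDl invr_gt0.
    by move=> /rat_in_itvoo[q]; rewrite in_itv/=; exists q.
  exists q => [|k]; last by have /andP[+ _] := qP k; apply: lt_trans.
  apply/cvgrPdist_lt => e e0.
  have := near_infty_natSinv_lt (PosNum e0); apply: filterS => k /= ke.
  have /andP[q1 q2] := qP k.
  by rewrite distrC ger0_norm ?subr_ge0 ?ltW// ltrBlDl (lt_trans q2)// ltrD2l.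
have [a ca a0] := rat_seq _ v0; have [b cb b0] := rat_seq _ dl0.
have ct := turn_cvg cx (ltW v0) (ltW dl0) (fun k => ltW (a0 k)) (fun k => ltW (b0 k)) ca cb.
have n0 : 0 < n.+1%:R^-1 :> R by rewrite invr_gt0.
have h1 : \forall k \near \oo, ratr (a k) < n.+1%:R^-1 :> R.
  exact: (cvgr_lt _ ca).
have h2 : \forall k \near \oo, `|ratr (b k) - delta0| < n.+1%:R^-1.
  have : `|ratr (b k) - delta0| @[k --> \oo] --> `|delta - delta0|.
    by apply: cvg_norm; apply: cvgB => //; exact: cvg_cst.
  by move/cvgr_lt; apply.
have h3 : \forall k \near \oo, turn (ratr (b k)) (ratr (a k)) x < n.+1%:R^-1.
  by apply: (cvgr_lt _ ct); exact: le_lt_trans n0.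
have [k _ kP] := filterI h1 (filterI h2 h3).
have [? [? ?]] := kP k (leqnn k).
by exists (a k), (b k); split => //; [rewrite a0|exact: ltW].
Qed.

End turns.

Section turn_frequencies.
Context {R : realType} {d : nat} (j0 : 'I_d).

(** Nonpositive instead of negative: a closed condition is stable under limits of
    the parameters. *)
Definition turn_event (sg delta : R) : set (R -> 'cV[R]_d) :=
  [set x | turn j0 sg delta 0 x <= 0].

(** The time 0 is left out, since a finer lattice has to have points before each
    of the times. *)
Definition turn_count (sg delta : R) (N : nat) (x : R -> 'cV[R]_d) : R :=
  \sum_(n < N) (turn j0 sg delta (n.+1%:R * delta) x <= 0)%R%:R.

Lemma sum_increasing (b : nat -> R) (k : nat -> nat) N :
  (forall n, 0 <= b n) -> (forall n, (k n < k n.+1)%N) ->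
  \sum_(n < N) b (k n) <= \sum_(i < k N) b i.
Proof.
move=> b0 kinc; elim: N => [|N IH]; first by rewrite big_ord0 sumr_ge0.
rewrite big_ord_recr/=.
apply: (@le_trans _ _ (\sum_(i < (k N).+1) b i)); first by rewrite big_ord_recr/= lerD2r.
by rewrite -(subnKC (kinc N)) big_split_ord/= lerDl sumr_ge0.
Qed.

Lemma half_line_continuous_shift s (x : R -> 'cV[R]_d) : 0 <= s ->
  half_line_continuous x -> half_line_continuous (shift_path s x).
Proof.
move=> s0 cx t e e0; have [r r0 rP] := cx (Num.max 0 t + s) e e0.
exists r => // t' tt'; have := rP (Num.max 0 t' + s).
have m0 (u : R) : 0 <= Num.max 0 u by rewrite le_max lexx.
rewrite /shift_path !(max_r (addr_ge0 (m0 _) s0)); apply.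
by rewrite opprD addrACA subrr addr0; apply: le_lt_trans tt'; exact: max0_dist.
Qed.

(** Comparison of the lattice [delta Z] with the fixed lattices [h Z] and
    [delta0 Z]: a time [(n + m) delta] lies less than [3 h] after
    [k h + m delta0], where [k h] is the lattice point [h] to [2 h] before
    [n delta]. *)
Lemma turn_count_visits sg delta0 delta h n M K0 (c c' : R)
    (x : R -> 'cV[R]_d) :
  let G := near_turn j0 sg delta0 n in
  let Q := [set x | c * M%:R < visits G delta0 M x] in
  half_line_continuous x -> 0 < h -> 3 * h <= n.+1%:R^-1 -> h <= delta ->
  (0 < M)%N -> 0 <= c -> 0 <= c' -> 0 <= delta0 ->
  `|delta - delta0| < n.+1%:R^-1 -> `|delta - delta0| * M%:R < h ->
  (forall K, (K0 <= K)%N -> visits Q h K x <= c' * K%:R) ->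
  forall N, (K0 <= N)%N ->
  turn_count sg delta N x <= c * N%:R + c' * ((N.+1)%:R * delta / h) + M%:R.
Proof.
move=> G Q cx h0 hn hd M0 c0 c'0 d00 dn dM vK N K0N.
have dl0 : 0 < delta by exact: lt_le_trans hd.
have MR1 : 1 <= M%:R :> R by rewrite ler1n.
(* The lattice point [k n' * h] lies between [h] and [2 h] before [n'.+1 * delta]. *)
pose k n' := (Num.truncn (n'.+1%:R * delta / h)).-1.
have hdn n' : 1 <= n'.+1%:R * delta / h.
  rewrite ler_pdivlMr// mul1r (le_trans hd)// ler_peMl ?(ltW dl0)// ler1n//.
have tn n' : (0 < Num.truncn (n'.+1%:R * delta / h))%N by rewrite truncn_gt0.
have kitv n' : (k n').+1%:R <= n'.+1%:R * delta / h < (k n').+2%:R.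
  by rewrite /k prednK//; apply: truncn_itv; exact: le_trans ler01 (hdn n').
have kinc n' : (k n' < k n'.+1)%N.
  rewrite -ltnS /k !prednK// truncn_gt_nat// -natr1.
  have /andP[h1 _] := kitv n'; rewrite /k prednK// in h1.
  rewrite -[X in _ <= X * _ / _]natr1 2!mulrDl lerD// mul1r ler_pdivlMr// mul1r//.
apply: (@le_trans _ _ (c * N%:R + \sum_(n' < N) \1_Q (shift_path ((k n')%:R * h) x) + M%:R)); last first.
  rewrite lerD2r lerD2l.
  apply: (@le_trans _ _ (visits Q h (k N) x)).
    by apply: (sum_increasing (b := fun i => \1_Q (shift_path (i%:R * h) x))) => // i;
      rewrite indicE ler0n.
  have kN : (N <= k N)%N by elim: N {K0N} => // N IH; exact: leq_ltn_trans IH (kinc N).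
  apply: (le_trans (vK _ (leq_trans K0N kN))).
  rewrite ler_wpM2l//; have /andP[+ _] := kitv N; apply: le_trans.
  by rewrite ler_nat.
apply: (@block_average _ (fun n' => (turn j0 sg delta (n'.+1%:R * delta) x <= 0)%R%:R)
  (fun n' => \1_Q (shift_path ((k n')%:R * h) x)) c M N M0) => n'.
  by rewrite ler0n lern1 leq_b1.
apply: (@le_trans _ _ (visits G delta0 M (shift_path ((k n')%:R * h) x))); last first.
  rewrite indicE; case: (boolP (_ \in _)).
    move=> _; rewrite mulr1 (le_trans (visits_le _ _ _ _))// lerDr mulr_ge0//.
  by move=> /negP; rewrite inE /Q/= mulr0 addr0 => /negP; rewrite -leNgt.
apply: ler_sum => m _; rewrite indicE ler_nat.
case: (leP (turn _ _ _ _ _) 0) => // tm; rewrite lt0b; apply/mem_set.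
pose v : R := n'.+1%:R * delta - (k n')%:R * h + m%:R * (delta - delta0).
have vE : (n' + m).+1%:R * delta = v + ((k n')%:R * h + m%:R * delta0).
  by rewrite /v -addSn natrD; ring.
have mM : `|m%:R * (delta - delta0)| < h.
  rewrite normrM ger0_norm// mulrC; apply: le_lt_trans dM.
  by rewrite ler_wpM2l// ler_nat ltnW.
have v0 : 0 < v < n.+1%:R^-1.
  have := kitv n'; rewrite ler_pdivlMr// ltr_pdivrMr//.
  rewrite -[(k n').+2%:R]natr1 -natr1 => /andP[k1 k2].
  move: mM; rewrite ltr_norml => /andP[m1 m2].
  have v3 : 0 < v < 3 * h by apply/andP; split; rewrite /v; lra.
  by have /andP[-> v4] := v3; rewrite (lt_le_trans v4).
apply: (near_turnP _ v0 dn dl0).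
  rewrite shift_pathD; apply: half_line_continuous_shift => //.
  by rewrite addr_ge0 ?mulr_ge0// ltW.
by rewrite shift_pathD turn_shift -vE.
Qed.

End turn_frequencies.

Section simultaneous_frequencies.
Context {R : realType} {dsp} {T : measurableType dsp} (P : probability T R).
Context {d m : nat} (F : 'cV[R]_d -> 'cV[R]_d) (A : 'M[R]_(d, m)).
Variable W : R -> T -> 'cV[R]_m.
Hypotheses (BW : standard_brownian_motion P W) (lipF : locally_lipschitz F).
Variable X : R -> T -> 'cV[R]_d.
Hypotheses (solX : sde_solution P F A W X)
  (X0W : independent_of_process P (X 0) W) (statX : stationary P X).
Variable mu : probability (borel_cV R d) R.
Hypotheses (lawX0 : has_law P (X 0) mu) (ergX : ergodicity_condition P mu X).
Variable j0 : 'I_d.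

Let mX t : 0 <= t -> random_vector (X t).
Proof. by case: solX => h _ _; exact: h. Qed.

Lemma turn_event_measurable sg delta : 0 <= delta ->
  measurable (turn_event j0 sg delta : set (path_space R d)).
Proof.
move=> d0.
have mc r : 0 <= r -> measurable_fun [set: path_space R d] (fun x => x r j0 0 : R).
  move=> r0; apply: (@measurable_coord_of _ _ (path_space R d) d (coordinate r)).
  exact: measurable_coordinate.
have mt : measurable_fun [set: path_space R d] (turn j0 sg delta 0).
  apply: measurable_funM; first exact: measurable_cst.
  by apply: measurable_funM; apply: measurable_funB; apply: mc; rewrite ?addr_ge0.
exact: (measurable_le_set mt).
Qed.

(** Continuity from above along the decreasing events [near_turn]. *)
Lemma near_turn_prob sg delta0 (eps : R) : 0 < delta0 -> 0 < eps ->
  exists n, path_prob P X (near_turn j0 sg delta0 n) <=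
            path_prob P X (turn_event j0 sg delta0) + eps.
Proof.
move=> d0 eps0.
pose E n := [set w | near_turn j0 sg delta0 n (X ^~ w)].
have mE n : measurable (E n).
  exact: (measurable_path_event solX (path_until_sub (near_turn_until j0 sg n))).
have niE : nonincreasing_seq E.
  move=> n n' nn'; apply/subsetPset => w [a [b [/andP[h1 h2] h3 h4 h5]]].
  have le : n'.+1%:R^-1 <= n.+1%:R^-1 :> R by rewrite lef_pV2 ?posrE// ler_nat.
  by exists a, b; split; rewrite ?h1 ?(lt_le_trans _ le).
have cv : P (E n) @[n --> \oo] --> P (\bigcap_n E n).
  apply: nonincreasing_cvg_mu => //.
  - by rewrite -ge0_fin_numE// fin_num_measure.
  - exact: bigcapT_measurable.
have mTE : measurable [set w | turn_event j0 sg delta0 (X ^~ w)].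
  exact: (measurable_path_event solX (turn_event_measurable sg (ltW d0))).
have le : (P (\bigcap_n E n) <= P [set w | turn_event j0 sg delta0 (X ^~ w)])%E.
  apply: le_measure; rewrite ?inE//; first exact: bigcapT_measurable.
  move=> w h; apply: (near_turn_limit d0); last by move=> n; exact: h.
  by apply: continuous_path_max; case: solX => _ cX _; exact: cX.
have /fine_cvgP[_ /cvgrPdist_lt/(_ _ eps0)[n _ nP]] :
    P (E n) @[n --> \oo] --> (fine (P (\bigcap_n E n)))%:E.
  by rewrite fineK// fin_num_measure//; exact: bigcapT_measurable.
exists n; have := nP n (leqnn n); rewrite /= ltr_norml => /andP[h1 _].
have : fine (P (\bigcap_n E n)) <= path_prob P X (turn_event j0 sg delta0).
  by apply: fine_le => //; apply: fin_num_measure => //; exact: bigcapT_measurable.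
by rewrite /path_prob -/(E n); lra.
Qed.

(** For all [delta] in a neighbourhood of [delta0] at once, outside one
    null set. *)
Lemma turn_frequency_upper sg (delta0 eps : R) : 0 < delta0 -> 0 < eps ->
  exists (N : set (path_space R d)) (r : R), [/\ measurable N,
    P [set w | N (X ^~ w)] = 0%E, 0 < r, r <= delta0 / 2 &
    forall x, half_line_continuous x -> ~ N x ->
      forall delta, `|delta - delta0| < r -> exists N0, forall n, (N0 <= n)%N ->
        turn_count j0 sg delta n x <=
        (path_prob P X (turn_event j0 sg delta0) + eps) * n%:R].
Proof.
move=> d00 eps0; have e40 : 0 < eps / 4 by rewrite divr_gt0.
have [n nP] := near_turn_prob sg d00 e40.
set q := path_prob P X (turn_event _ _ _) in nP *.
set G := near_turn _ _ _ _ in nP.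
set pG := path_prob P X G in nP.
have n0 : 0 < n.+1%:R^-1 :> R by rewrite invr_gt0.
(* [M] makes the average over a block of [M] steps exceed the probability only
   with probability [lam], so small that it may be multiplied by the number
   [delta / h] of points of the fine lattice per step; [r] keeps [M] steps of
   length [delta] within [h] of those of length [delta0]. *)
pose h := Num.min (delta0 / 2) (n.+1%:R^-1 / 3).
have h0 : 0 < h by rewrite lt_min !divr_gt0.
have hd0 : h <= delta0 / 2 by rewrite ge_min lexx.
have hn : 3 * h <= n.+1%:R^-1.
  by rewrite mulrC -ler_pdivlMr// ge_min lexx orbT.
pose lam := eps / 8 * (h / (2 * delta0)).
have lam0 : 0 < lam by rewrite mulr_gt0 ?divr_gt0// mulr_gt0.
have cG := @near_turn_until R d j0 sg delta0 n; rewrite -/G in cG.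
have [M M0 PM] := law_of_large_numbers BW lipF solX X0W statX lawX0 ergX d00 cG e40 lam0.
pose c := pG + eps / 4.
pose Q : set (R -> 'cV[R]_d) := [set x | c * M%:R < visits G delta0 M x].
have cQ := visits_until (c * M%:R) (M := M) (ltW d00) cG.
have pQ : path_prob P X Q <= lam.
  rewrite -lee_fin; apply: le_trans PM; rewrite le_eqVlt; apply/orP; left.
  apply/eqP/fineK/fin_num_measure.
  exact: (measurable_path_event solX (path_until_sub cQ)).
have [Nl [mN PN NP]] := visits_upper BW lipF solX X0W statX lawX0 ergX cQ h0 lam0.
have MR0 : 0 < M%:R :> R by rewrite ltr0n.
pose r := Num.min (Num.min (delta0 / 2) n.+1%:R^-1) (h / M%:R).
exists Nl, r; split => //.
- by rewrite !lt_min !divr_gt0//= n0.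
- by rewrite !ge_min lexx.
move=> x cx Nx delta; rewrite !lt_min => /andP[/andP[dd dn] dM].
have [K0 KP] := NP x Nx.
have dM' : `|delta - delta0| * M%:R < h by rewrite -ltr_pdivlMr.
have hd : h <= delta.
  by apply: (le_trans hd0); move: dd; rewrite ltr_norml => /andP[? _]; lra.
have d2 : delta <= 2 * delta0.
  by move: dd; rewrite ltr_norml => /andP[_ ?]; lra.
have p0 Q' : 0 <= path_prob P X Q' by rewrite /path_prob; exact: fine_ge0.
have c0 : 0 <= c by apply: addr_ge0; [exact: p0|exact: ltW].
have c'0 : 0 <= path_prob P X Q + lam by apply: addr_ge0; [exact: p0|exact: ltW].
have bound := turn_count_visits cx h0 hn hd M0 c0 c'0 (ltW d00) dn dM' KP.
exists (maxn K0 (Num.truncn ((eps / 4 + M%:R) / (eps / 4))).+1) => N.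
rewrite geq_max => /andP[K0N Nbig].
apply: (le_trans (bound N K0N)).
have NR : eps / 4 + M%:R <= eps / 4 * N%:R.
  rewrite [leRHS]mulrC -ler_pdivrMr//; apply: (le_trans (ltW (truncnS_gt _))).
  by rewrite ler_nat.
have step : (path_prob P X Q + lam) * (N.+1%:R * delta / h) <= eps / 4 * N.+1%:R.
  apply: (@le_trans _ _ (2 * lam * (N.+1%:R * (2 * delta0) / h))).
    apply: ler_pM => //.
    - by rewrite divr_ge0 ?(ltW h0)// mulr_ge0// (le_trans (ltW h0)).
    - by move: pQ; lra.
    - by rewrite ler_pM2r ?invr_gt0// ler_pM2l.
  rewrite le_eqVlt; apply/orP; left; apply/eqP; rewrite /lam.
  by field; rewrite !gt_eqF.
move: step; rewrite -natr1 mulrDr mulr1 => step.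
have : c * N%:R <= (q + eps / 2) * N%:R.
  by rewrite ler_wpM2r// /c; lra.
move: step; set s := _ * _; move: NR; set N' : R := N%:R.
by move=> NR step cN; rewrite mulrDl; move: cN; rewrite mulrDl; lra.
Qed.

(** The open intervals with rational end points on which one null set serves
    are countably many and cover the half line. *)
Lemma all_turn_frequencies : exists N : set (path_space R d),
  [/\ measurable N, P [set w | N (X ^~ w)] = 0%E &
    forall x, half_line_continuous x -> ~ N x ->
    forall delta eps : R, 0 < delta -> 0 < eps ->
    exists2 delta0, 0 < delta0 < 2 * delta &
      forall sg, sg = 1 \/ sg = -1 -> exists N0, forall n, (N0 <= n)%N ->
        turn_count j0 sg delta n x <=
        (path_prob P X (turn_event j0 sg delta0) + eps) * n%:R].
Proof.
pose good (p : nat * (rat * rat)) (N : set (path_space R d)) :=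
  [/\ measurable N, P [set w | N (X ^~ w)] = 0%E & exists2 delta0, 0 < delta0 &
   forall x, half_line_continuous x -> ~ N x ->
   forall delta, ratr p.2.1 < delta < ratr p.2.2 -> delta0 < 2 * delta /\
      forall sg, sg = 1 \/ sg = -1 -> exists N0, forall n, (N0 <= n)%N ->
        turn_count j0 sg delta n x <=
        (path_prob P X (turn_event j0 sg delta0) + p.1.+1%:R^-1) * n%:R].
have /choice[f fP] : forall p, exists N : set (path_space R d),
    [/\ measurable N, P [set w | N (X ^~ w)] = 0%E & (exists N', good p N') -> good p N].
  move=> p; have [[N' gN']|no] := pselect (exists N', good p N').
    by exists N'; have [? ? _] := gN'.
  by exists set0; split => //; rewrite [X in P X](_ : _ = set0) ?measure0.
pose idx k : nat * (rat * rat) := odflt (0%N, (0, 0)) (unpickle k).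
have mf k : measurable (f (idx k)) by have [] := fP (idx k).
have mfX k : measurable [set w | f (idx k) (X ^~ w)].
  exact: (measurable_path_event solX).
exists (\bigcup_k f (idx k)); split.
- exact: bigcupT_measurable.
- have -> : [set w | (\bigcup_k f (idx k)) (X ^~ w)] =
    \bigcup_k [set w | f (idx k) (X ^~ w)] by [].
  apply: measure_negligible; first exact: bigcupT_measurable.
  apply: negligible_bigcup => k; exists [set w | f (idx k) (X ^~ w)]; split => //.
  by have [_ + _] := fP (idx k).
move=> x cx Nx delta eps dl0 eps0.
have [e _ /(_ e (leqnn e))/= eP] := near_infty_natSinv_lt (PosNum eps0).
have ie0 : 0 < e.+1%:R^-1 :> R by rewrite invr_gt0.
have [N1 [r1 [mN1 PN1 r10 r1d H1]]] := turn_frequency_upper 1 dl0 ie0.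
have [N2 [r2 [mN2 PN2 r20 r2d H2]]] := turn_frequency_upper (-1) dl0 ie0.
pose r := Num.min r1 r2; have r0 : 0 < r by rewrite lt_min r10.
have /rat_in_itvoo[a] : delta - r < delta by rewrite ltrBlDr ltrDl.
have /rat_in_itvoo[b] : delta < delta + r by rewrite ltrDl.
rewrite !in_itv/= => /andP[b1 b2] /andP[a1 a2].
have [_ _ /(_ _)] := fP (e, (a, b)).
have : exists N', good (e, (a, b)) N'.
  exists (N1 `|` N2); split; first exact: measurableU.
    have -> : [set w | (N1 `|` N2) (X ^~ w)] =
      [set w | N1 (X ^~ w)] `|` [set w | N2 (X ^~ w)] by [].
    by apply/eqP; rewrite -measure_le0 (le_trans (measureU2 _ _ _))//;
      [exact: (measurable_path_event solX)|exact: (measurable_path_event solX)|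
       rewrite /= PN1 PN2 adde0].
  exists delta => // y cy /not_orP[n1 n2] dl /= /andP[adl dlb].
  have rr : `|dl - delta| < r by rewrite ltr_norml; apply/andP; split; lra.
  move: rr; rewrite lt_min => /andP[rr1 rr2].
  split; first by move: rr1; rewrite ltr_norml => /andP[]; lra.
  by move=> sg [->|->]; [exact: H1|exact: H2].
move=> /[swap] /[apply] -[_ _ [dl' dl'0 H]].
have Nf : ~ f (e, (a, b)) x.
  move=> fx; apply: Nx; exists (pickle (e, (a, b))) => //.
  by rewrite /idx pickleK.
have [|dd H'] := H x cx Nf delta; first by rewrite /= a2 b1.
exists dl'; first by rewrite dl'0.
move=> sg sgP; have [N0 N0P] := H' sg sgP; exists N0 => n nN; apply: (le_trans (N0P n nN)).
by rewrite ler_wpM2r// lerD2l ltW.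
Qed.

End simultaneous_frequencies.

(** * Small balls and symmetry of Gaussian increments *)

Section normal.
Context {R : realType}.
Local Notation lm := (@lebesgue_measure R).

Lemma lebesgue_measure_opp (B : set R) : measurable B ->
  lm (-%R @^-1` B) = lm B.
Proof.
move=> mB; have mN : @measurable_fun _ _ (measurableTypeR R) (measurableTypeR R) setT -%R by exact: oppr_measurable.
pose M' : {measure set (measurableTypeR R) -> \bar R} := pushforward lm (mfun_of mN).
pose M := M' mN.
suff H : forall X, ocitv X -> lm X = M X by rewrite (lebesgue_measure_unique H mB).
move=> _ [[a b] _ <-]; rewrite /M /M'/= /pushforward.
have -> : (mfun_of mN) @^-1` `]a, b] = `[- b, - a[%classic.
  by apply/seteqP; split => x /=; rewrite !in_itv/= => /andP[? ?]; apply/andP; split; lra.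
by rewrite !lebesgue_measure_itv/= !lte_fin ltrN2 -!EFinB opprK addrC.
Qed.

Lemma normal_prob_opp (s : R) (B : set R) : s != 0 -> measurable B ->
  normal_prob 0 s (-%R @^-1` B) = normal_prob 0 s B.
Proof.
move=> s0 mB; have mN : @measurable_fun _ _ (measurableTypeR R) (measurableTypeR R) setT -%R by exact: oppr_measurable.
rewrite /normal_prob.
transitivity (\int[pushforward lm (mfun_of mN)]_(x in B) (normal_pdf 0 s x)%:E)%E.
  rewrite ge0_integral_pushforward; last 3 first.
  - exact: mB.
  - apply/measurable_EFinP; apply: measurable_funTS; exact: measurable_normal_pdf.
  - by move=> x _; rewrite lee_fin normal_pdf_ge0.
  apply: eq_integral => x _; congr EFin.
  by rewrite /= !normal_pdfE//= /normal_fun !subr0 sqrrN.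
  exact: mN.
apply: eq_measure_integral => C mC _; exact: lebesgue_measure_opp.
Qed.

Lemma normal_prob_itv_le (s a b : R) : 0 < s -> a <= b ->
  (normal_prob 0 s `[a, b] <= ((b - a) * normal_peak s)%:E)%E.
Proof.
move=> s0 ab; rewrite /normal_prob.
apply: (@le_trans _ _ (\int[lm]_(x in `[a, b]) (normal_peak s)%:E)%E).
  apply: ge0_le_integral => //.
  - by move=> x _; rewrite lee_fin normal_pdf_ge0.
  - apply/measurable_EFinP; apply: measurable_funTS; exact: measurable_normal_pdf.
  - by move=> x _; rewrite lee_fin normal_pdf_ub// gt_eqF.
have lab : lm `[a, b]%classic = (b - a)%:E.
  rewrite lebesgue_measure_itv/= lte_fin; case: ltP => // ba.
  have -> : b = a by apply/le_anti/andP; split.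
  by rewrite subrr.
by rewrite mulrC EFinM -lab integral_cst.
Qed.

(** A Gaussian variable of variance [t] has a density of order
    [1 / Num.sqrt t]. *)
Lemma normal_peak_sqrt_le (t : R) : 0 < t -> t * normal_peak (Num.sqrt t) <= Num.sqrt t.
Proof.
move=> t0; rewrite /normal_peak sqr_sqrtr ?(ltW t0)//.
have s0 : 0 < Num.sqrt t by rewrite sqrtr_gt0.
have tp : t <= t * pi *+ 2.
  rewrite -mulrnAr ler_peMr ?(ltW t0)// mulr2n.
  by have := pi_ge2 R; lra.
have tp0 : 0 < Num.sqrt (t * pi *+ 2) by rewrite sqrtr_gt0 (lt_le_trans t0).
rewrite ler_pdivrMr// -{1}(sqr_sqrtr (ltW t0)) expr2 ler_pM2l//.
by rewrite ler_sqrt// (le_trans (ltW t0)).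
Qed.

End normal.

Section gaussian_vector.
Context {R : realType} {dsp} {T : measurableType dsp} (P : probability T R).
Context {m : nat} (V : T -> 'cV[R]_m) (s : R).
Hypotheses (s0 : 0 < s) (mV : random_vector V).
Hypothesis lawV : forall B : 'I_m -> set R, (forall i, measurable (B i)) ->
  P [set w | forall i, B i (V w i 0)] = (\prod_(i < m) normal_prob 0 s (B i))%E.
Variable a : 'I_m -> R.

Definition lin_comb (w : T) : R := \sum_(j < m) a j * V w j 0.

Lemma measurable_lin_comb : measurable_fun [set: T] lin_comb.
Proof.
apply: measurable_sum => j; apply: measurable_funM; first exact: measurable_cst.
exact: measurable_coord_of.
Qed.

(** Products of Borel sets, which generate the Borel sets and are the events
    whose probabilities [lawV] prescribes. *)
Inductive box : set (set 'cV[R]_m) :=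
  Box (B : 'I_m -> set R) : (forall i, measurable (B i)) ->
    box [set x | forall i, B i (x i 0)].

Lemma box_measurable : box `<=` (measurable : set (set (borel_cV R m))).
Proof.
move=> _ [B mB].
have : measurable (\bigcap_(i in [set: 'I_m]) ((fun x : borel_cV R m => x i 0) @^-1` B i)).
  apply: fin_bigcap_measurable => // i _.
  exact: (preimage_measurable (measurable_coord i)).
congr (measurable _).
by apply/seteqP; split => x h i; [exact: (h i Logic.I)|move=> _; exact: h].
Qed.

Lemma borel_box : (measurable : set (set (borel_cV R m))) `<=` <<s box >>.
Proof.
move=> C mC.
have : @random_vector R _ (g_sigma_algebraType box) m id.
  apply: random_vector_coord => i _ B mB; rewrite setTI; apply: sub_sigma_algebra.
  have -> : (fun x : g_sigma_algebraType box => x i 0) @^-1` B =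
      [set x : 'cV[R]_m | forall k, (if k == i then B else setT) (x k 0)].
    apply/seteqP; split => x /=; first by move=> Bx k; case: eqP => // ->.
    by move=> /(_ i); rewrite eqxx.
  by apply: (Box (B := fun k => if k == i then B else setT)) => k; case: ifP.
by move=> /(_ measurableT _ mC); rewrite setTI.
Qed.

(** [V] and [- V] have the same law, since they give the same probability to
    boxes. *)
Lemma lin_comb_opp : P [set w | lin_comb w < 0] = P [set w | 0 < lin_comb w].
Proof.
have mNV : random_vector (fun w => - V w).
  apply: random_vector_coord => i; under eq_fun do rewrite mxE.
  by apply: measurable_funN; exact: measurable_coord_of.
have boxI : setI_closed box.
  move=> _ _ [B mB] [B' mB'].
  rewrite (_ : _ `&` _ = [set x : 'cV[R]_m | forall i, (B i `&` B' i) (x i 0)]).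
    by apply: (Box (B := fun i => B i `&` B' i)) => i; exact: measurableI.
  by apply/seteqP; split => [x [h1 h2] i|x h]; split => // i; have [] := h i.
have eqlaw (C : set (borel_cV R m)) : measurable C -> law P mV C = law P mNV C.
  move=> /borel_box.
  apply: (@finite_measure_eq_pi _ (borel_cV R m) R (law P mV) (law P mNV) box);
    [exact: boxI|exact: box_measurable|..].
  - exact: (le_lt_trans (probability_le1 (law P mV) measurableT) (ltry 1)).
  - exact: etrans (probability_setT (law P mV)) (esym (probability_setT (law P mNV))).
  move=> _ [B mB].
  transitivity (P [set w | forall i, B i (V w i 0)]); first by [].
  transitivity (P [set w | forall i, (-%R @^-1` B i) (V w i 0)]); last first.
    by congr (P _); apply/seteqP; split => w h i; have := h i; rewrite mxE.
  have mB' i : measurable (-%R @^-1` B i).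
    by rewrite -[X in measurable X]setTI; exact: oppr_measurable.
  apply: etrans (lawV mB) _; apply: etrans _ (esym (lawV mB')).
  by apply: eq_bigr => i _; rewrite normal_prob_opp// gt_eqF.
pose C : set (borel_cV R m) := [set x | \sum_(j < m) a j * x j 0 < 0].
have mC : measurable C.
  have mf : measurable_fun [set: borel_cV R m] (fun x => \sum_(j < m) a j * x j 0).
    apply: measurable_sum => j; apply: measurable_funM; first exact: measurable_cst.
    exact: measurable_coord.
  exact: (measurable_lt_set mf).
transitivity (law P mV C); first by [].
apply: etrans (eqlaw C mC) _; transitivity (P [set w | \sum_(j < m) a j * (- V w) j 0 < 0]); first by [].
congr (P _); apply/seteqP; split => w /=;
  by under eq_bigr do rewrite mxE mulrN; rewrite sumrN oppr_lt0.
Qed.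

(** Conditionally on everything but one coordinate with a nonzero coefficient, the
    sum is Gaussian and its density is bounded. *)
Lemma small_ball (C : T -> R) j (rho : R) : measurable_fun [set: T] C ->
  independent P [set C @^-1` B | B in measurable] (sigma_vector V) ->
  a j != 0 -> 0 <= rho ->
  (P [set w | `|C w + lin_comb w| <= rho]%R <=
     ((rho + rho) / `|a j| * normal_peak s)%:E)%E.
Proof.
move=> mC indC aj0 rho0.
pose Vj w := V w j 0.
have mVi i : measurable_fun [set: T] (fun w => V w i 0) by exact: measurable_coord_of.
pose Pi : set (set T) := [set E | exists (D : set R) (B : 'I_m -> set R),
  [/\ measurable D, forall i, measurable (B i), B j = setT &
     E = C @^-1` D `&` [set w | forall i, B i (V w i 0)]]].
pose H : set (set T) := [set Vj @^-1` B | B in measurable].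
have mbox (B : 'I_m -> set R) : (forall i, measurable (B i)) ->
    measurable [set w | forall i, B i (V w i 0)].
  by move=> mB; exact: (preimage_measurable mV (box_measurable (Box mB))).
have Pim : Pi `<=` measurable.
  move=> _ [D [B [mD mB _ ->]]]; apply: measurableI; last exact: mbox.
  exact: (preimage_measurable mC).
have PiI : setI_closed Pi.
  move=> _ _ [D [B [mD mB Bj ->]]] [D' [B' [mD' mB' B'j ->]]].
  exists (D `&` D'), (fun i => B i `&` B' i); split.
  - exact: measurableI.
  - by move=> i; exact: measurableI.
  - by rewrite Bj B'j setIT.
  apply/seteqP; split => [w [[? h1] [? h2]]|w [[? ?] h]]; first by split => // i; split.
  by split; split => // i; have [] := h i.
have Hm : H `<=` measurable by move=> _ [B mB <-]; exact: (preimage_measurable (mVi j)).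
have HI : setI_closed H.
  by move=> _ _ [B mB <-] [B' mB' <-]; exists (B `&` B') => //; exact: measurableI.
have NT : normal_prob 0 s [set: R] = 1%E by exact: integral_normal_pdf.
have PV (B : set R) : measurable B -> P (Vj @^-1` B) = normal_prob 0 s B.
  move=> mB; pose B' i := if i == j then B else setT.
  have -> : Vj @^-1` B = [set w | forall i, B' i (V w i 0)].
    apply/seteqP; split => w /=; first by move=> Bw i; rewrite /B'; case: eqP => // ->.
    by move=> /(_ j); rewrite /B' eqxx.
  rewrite lawV; last by move=> i; rewrite /B'; case: ifP.
  rewrite (bigD1 j)//= big1 ?mule1 /B' ?eqxx// => i ij.
  by rewrite (negbTE ij).
have indPiH : independent P Pi H.
  move=> _ _ [D [B [mD mB Bj ->]]] [B0 mB0 <-].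
  pose B' i := if i == j then B0 else B i.
  have mB' i : measurable (B' i) by rewrite /B'; case: ifP.
  have sv (E : 'I_m -> set R) : (forall i, measurable (E i)) ->
      sigma_vector V [set w | forall i, E i (V w i 0)].
    move=> mE; exists [set x : 'cV[R]_m | forall i, E i (x i 0)] => //.
    by apply: box_measurable; exact: Box.
  have -> : C @^-1` D `&` [set w | forall i, B i (V w i 0)] `&` Vj @^-1` B0 =
      C @^-1` D `&` [set w | forall i, B' i (V w i 0)].
    apply/seteqP; split => [w [[? h] h0]|w [? h]].
      by split => // i; rewrite /B'; case: eqP => [->|].
    split; last by have := h j; rewrite /B' eqxx.
    split => // i; have := h i; rewrite /B'; case: eqP => // -> _.
    by rewrite Bj.
  have CD : [set C @^-1` B1 | B1 in measurable] (C @^-1` D) by exists D.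
  rewrite indC//; last exact: sv.
  rewrite [in RHS]indC//; last exact: sv.
  rewrite PV// !lawV// -muleA; congr (_ * _)%E.
  rewrite (bigD1 j)//= [in RHS](bigD1 j)//= Bj NT mul1e /B' eqxx muleC.
  by congr (_ * _)%E; apply: eq_bigr => i /negbTE ->.
pose Y w := C w + \sum_(i < m | i != j) a i * V w i 0.
have mYPi : @measurable_fun _ _ (g_sigma_algebraType Pi) R setT Y.
  apply: measurable_funD.
    move=> _ D mD; rewrite setTI; apply: sub_sigma_algebra; exists D, (fun=> setT).
    by split => //; apply/seteqP; split => w //= -[].
  rewrite /=; under eq_fun do rewrite big_mkcond/=.
  apply: measurable_sum => i; case: eqP => ij; first exact: measurable_cst.
  apply: measurable_funM; first exact: measurable_cst.
  move=> _ D mD; rewrite setTI; apply: sub_sigma_algebra.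
  exists setT, (fun k => if k == i then D else setT); split => //.
  - by move=> k; case: ifP.
  - by case: eqP => // ji; case: ij.
  apply/seteqP; split => w /=.
    by move=> Dw; split => // k; case: eqP => // ->.
  by move=> [_ /(_ i)]; rewrite eqxx.
have mY : measurable_fun [set: T] Y.
  move=> _ D mD; have := mYPi measurableT D mD; rewrite !setTI.
  exact: sigma_sub_measurable.
have indYH : independent P [set Y @^-1` B | B in measurable] <<s H >>.
  apply: independent_pi => //.
  - by move=> _ [B mB <-]; exact: (preimage_measurable mY).
  move=> E G [B mB <-] HG.
  apply: (independentC (independent_pi Hm Pim PiI (independentC indPiH))) => //.
  by have := mYPi measurableT B mB; rewrite setTI.
pose phi (z : R * g_sigma_algebraType H) : \bar R :=
  (\1_[set z : R * g_sigma_algebraType H | `|z.1 + a j * Vj z.2| <= rho]%R z)%:E.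
have mS : measurable [set z : R * g_sigma_algebraType H | `|z.1 + a j * Vj z.2| <= rho].
  have mVjH : @measurable_fun _ _ (g_sigma_algebraType H) R setT Vj.
    by move=> _ B mB; rewrite setTI; apply: sub_sigma_algebra; exists B.
  apply: measurable_norm_le_set; apply: measurable_funD; first exact: measurable_fst.
  apply: measurable_funM; first exact: measurable_cst.
  exact: (measurableT_comp mVjH measurable_snd).
have mphi : measurable_fun [set: R * g_sigma_algebraType H] phi.
  by apply/measurable_EFinP; exact: measurable_indic.
have phi0 z : (0 <= phi z)%E by rewrite lee_fin.
have J := indep_pair_integral mY Hm indYH mphi phi0.
have lcE w : C w + lin_comb w = Y w + a j * Vj w.
  by rewrite /Y /lin_comb (bigD1 j)//= addrA addrAC.
have mE : measurable [set w | `|C w + lin_comb w| <= rho].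
  apply: measurable_norm_le_set; apply: measurable_funD => //.
  exact: measurable_lin_comb.
have PJ : P [set w | `|C w + lin_comb w| <= rho] = (\int[P]_w phi (Y w, w))%E.
  rewrite -[in LHS](setIT [set w | `|C w + lin_comb w| <= rho]).
  rewrite -(integral_indic P measurableT mE).
  apply: eq_integral => w _; rewrite /phi !indicE; congr ((nat_of_bool _)%:R%:E).
  by apply/idP/idP; rewrite !inE/= lcE.
rewrite PJ J.
have naj : 0 < `|a j| by rewrite normr_gt0.
have bound y : (\int[P]_w phi (y, w) <= ((rho + rho) / `|a j| * normal_peak s)%:E)%E.
  pose I := `[- y / a j - rho / `|a j|, - y / a j + rho / `|a j|]%classic.
  have IE w : (`|y + a j * Vj w| <= rho) = (Vj w \in I).
    have -> : y + a j * Vj w = a j * (Vj w + y / a j) by field.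
    rewrite normrM mulrC -ler_pdivlMr// ler_norml /I mulNr.
    set u := rho / _; set v := y / _.
    apply/idP/idP; rewrite inE/= in_itv/= => /andP[? ?]; apply/andP; split; lra.
  have mI : measurable (Vj @^-1` I) by exact: (preimage_measurable (mVi j) (measurable_itv _)).
  have -> : (\int[P]_w phi (y, w))%E = P (Vj @^-1` I).
    rewrite -[in RHS](setIT (Vj @^-1` I)) -(integral_indic P measurableT mI).
    apply: eq_integral => w _; rewrite /phi !indicE; congr ((nat_of_bool _)%:R%:E).
    by apply/idP/idP; rewrite !inE/= IE inE.
  rewrite (PV I (measurable_itv _)); apply: (le_trans (normal_prob_itv_le s0 _)).
    by rewrite lerD2l ge0_cp// divr_ge0.
  rewrite lee_fin le_eqVlt; apply/orP; left; apply/eqP.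
  by rewrite opprD opprK addrACA subrr add0r -mulrDl.
apply: (@le_trans _ _ (\int[P]_w ((rho + rho) / `|a j| * normal_peak s)%:E)%E).
  apply: ge0_le_integral => //.
  - by move=> w _; exact: integral_ge0.
  - exact: (measurableT_comp (measurable_fun_pair_integral P Hm mphi phi0) mY).
by rewrite integral_cst//= [X in (_ * X)%E](probability_setT P) mule1.
Qed.

End gaussian_vector.

Section increments.
Context {R : realType} {dsp} {T : measurableType dsp} (P : probability T R).
Context {d m : nat} (F : 'cV[R]_d -> 'cV[R]_d) (A : 'M[R]_(d, m)).
Variable W : R -> T -> 'cV[R]_m.
Hypotheses (BW : standard_brownian_motion P W) (lipF : locally_lipschitz F).
Variable X : R -> T -> 'cV[R]_d.
Hypotheses (solX : sde_solution P F A W X)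
  (X0W : independent_of_process P (X 0) W) (statX : stationary P X).
Variables (j0 : 'I_d) (j1 : 'I_m).
Hypothesis A0 : A j0 j1 != 0.

Let mX t : 0 <= t -> random_vector (X t).
Proof. by case: solX => h _ _; exact: h. Qed.

Let mW t : 0 <= t -> random_vector (W t).
Proof. by case: BW => h _ _ _ _; exact: h. Qed.

(** What the coordinate [j0] of the solution gains from the Brownian motion. *)
Definition noise (s t : R) (w : T) : R :=
  lin_comb (fun w => W t w - W s w) (A j0) w.

Lemma noiseE s t w : noise s t w = (A *m (W t w - W s w)) j0 0.
Proof. by rewrite mxE. Qed.

Let mWW s t : 0 <= s -> s < t -> random_vector (fun w => W t w - W s w).
Proof. by move=> s0 st; apply: random_vectorB; apply: mW => //; rewrite (le_trans s0)// ltW. Qed.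

Lemma measurable_noise s t : 0 <= s -> s < t -> measurable_fun [set: T] (noise s t).
Proof. by move=> s0 st; apply: measurable_lin_comb; exact: mWW. Qed.

Let c0 : R := 2 / `|A j0 j1|.

(** The radius is linear in the length of the time interval, as the contribution
    of a bounded drift is; the probability is then of order [Num.sqrt (t - s)]. *)
Lemma noise_small_ball s t (C : T -> R) K : 0 <= s -> s < t -> 0 <= K ->
  measurable_fun [set: T] C ->
  independent P [set C @^-1` B | B in measurable] (sigma_vector (fun w => W t w - W s w)) ->
  (P [set w | `|C w + noise s t w| <= K * (t - s)]%R <=
     (c0 * K * Num.sqrt (t - s))%:E)%E.
Proof.
move=> s0 st K0 mC indC; have ts0 : 0 < t - s by rewrite subr_gt0.
have sq0 : 0 < Num.sqrt (t - s) by rewrite sqrtr_gt0.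
have lawV : forall B : 'I_m -> set R, (forall i, measurable (B i)) ->
   P [set w | forall i, B i ((W t w - W s w) i 0)] =
   (\prod_(i < m) normal_prob 0 (Num.sqrt (t - s)) (B i))%E.
  by case: BW => _ _ _ h _ B mB; exact: h.
have K0' : 0 <= K * (t - s) by rewrite mulr_ge0// ltW.
apply: (le_trans (small_ball sq0 (mWW s0 st) lawV mC indC A0 K0')).
rewrite lee_fin.
have -> : (K * (t - s) + K * (t - s)) / `|A j0 j1| * normal_peak (Num.sqrt (t - s)) =
   c0 * K * ((t - s) * normal_peak (Num.sqrt (t - s))) by rewrite /c0; ring.
rewrite ler_wpM2l ?normal_peak_sqrt_le// mulr_ge0// divr_ge0//.
Qed.

Lemma noise_small s t K : 0 <= s -> s < t -> 0 <= K ->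
  (P [set w | `|noise s t w| <= K * (t - s)]%R <= (c0 * K * Num.sqrt (t - s))%:E)%E.
Proof.
move=> s0 st K0.
have ind : independent P [set (fun=> 0 : R) @^-1` B | B in measurable]
    (sigma_vector (fun w => W t w - W s w)).
  move=> _ E [B mB <-] _; have [B0|B0] := pselect (B 0).
    rewrite (_ : _ @^-1` B = setT); last by apply/seteqP; split.
    by rewrite setTI [X in (X * _)%E](probability_setT P) mul1e.
  rewrite (_ : _ @^-1` B = set0); last by apply/seteqP; split.
  by rewrite set0I measure0 mul0e.
have mc : measurable_fun [set: T] (fun=> 0 : R) by exact: measurable_cst.
have := noise_small_ball s0 st K0 mc ind.
congr (P _ <= _)%E; apply/seteqP; split => w /=; by rewrite add0r.
Qed.

(** By symmetry, as the value 0 has probability 0. *)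
Lemma noise_sign s t : 0 <= s -> s < t ->
  P [set w | noise s t w < 0] = (2^-1)%:E /\ P [set w | 0 < noise s t w] = (2^-1)%:E.
Proof.
move=> s0 st; have ts0 : 0 < t - s by rewrite subr_gt0.
have sq0 : 0 < Num.sqrt (t - s) by rewrite sqrtr_gt0.
have lawV : forall B : 'I_m -> set R, (forall i, measurable (B i)) ->
   P [set w | forall i, B i ((W t w - W s w) i 0)] =
   (\prod_(i < m) normal_prob 0 (Num.sqrt (t - s)) (B i))%E.
  by case: BW => _ _ _ h _ B mB; exact: h.
have eqs : P [set w | noise s t w < 0] = P [set w | 0 < noise s t w].
  exact: (lin_comb_opp sq0 (mWW s0 st) lawV).
have mn := measurable_noise s0 st.
have mneg : measurable [set w | noise s t w < 0] by exact: measurable_lt_set.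
have mpos : measurable [set w | 0 < noise s t w] by exact: measurable_gt_set.
have mz : measurable [set w | `|noise s t w| <= 0 * (t - s)].
  exact: measurable_norm_le_set.
have z : P [set w | `|noise s t w| <= 0 * (t - s)] = 0%E.
  apply/eqP; rewrite eq_le measure_ge0 andbT.
  by apply: (le_trans (noise_small s0 st (lexx 0))); rewrite mulr0 mul0r.
have un : [set: T] = [set w | noise s t w < 0] `|` [set w | 0 < noise s t w] `|`
    [set w | `|noise s t w| <= 0 * (t - s)].
  apply/esym; rewrite -subTset => w _; rewrite /setU/= mul0r normr_le0.
  by have [?|?|?] := ltgtP (noise s t w) 0; [left; left|left; right|right].
have T1 : (P [set w | noise s t w < 0]%R + P [set w | 0 < noise s t w]%R = 1)%E.
  have d1 : [set w | noise s t w < 0] `&` [set w | 0 < noise s t w] = set0.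
    by rewrite -subset0 => w /= [h1 h2]; move: (lt_trans h1 h2); rewrite ltxx.
  have d2 : ([set w | noise s t w < 0] `|` [set w | 0 < noise s t w]) `&`
      [set w | `|noise s t w| <= 0 * (t - s)] = set0.
    rewrite -subset0 => w /= [[|] h]; rewrite mul0r normr_le0 => /eqP e;
      by move: h; rewrite e ltxx.
  apply: etrans _ (probability_setT P); rewrite un; apply: esym.
  apply: etrans (measureU P (measurableU _ _ mneg mpos) mz d2) _.
  rewrite [X in (P (_ `|` _) + X)%E]z adde0; exact: measureU.
have f1 : P [set w | noise s t w < 0] \is a fin_num by exact: fin_num_measure.
have : fine (P [set w | noise s t w < 0]) = 2^-1.
  move: T1; rewrite -eqs -(fineK f1) -EFinD => -[]; lra.
by move=> h; rewrite -eqs -(fineK f1) h.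
Qed.

Let f r w : R := F (X r w) j0 0.

Let mf r : 0 <= r -> measurable_fun [set: T] (f r).
Proof.
move=> r0; apply: measurable_coord_of; apply: random_vector_continuous; last exact: mX.
by move=> U; exact: locally_lipschitz_preimage_open.
Qed.

Let cf w : continuous (fun r : R => f (Num.max 0 r) w : R).
Proof.
have [_ cX _] := solX.
have cx : continuous_curve (fun r => X (Num.max 0 r) w) := continuous_path_max (cX w).
exact: (continuous_drift_coord lipF cx).
Qed.

(** With probability close to one the drift is bounded up to time [L] by a
    constant, so that increments differ from the noise by a linear term. *)
Lemma increments_near_noise (L eta : R) : 0 < L -> 0 < eta ->
  exists K (S : set T), [/\ 0 <= K, measurable S, (P (~` S) <= eta%:E)%E &
    forall s t, 0 <= s -> s <= t -> t <= L ->
      {ae P, forall w, S w -> `|X t w j0 0 - X s w j0 0 - noise s t w| <= K * (t - s)}].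
Proof.
move=> L0 eta0.
(* Rational times make this a measurable event. *)
pose S (K : nat) : set T := [set w | forall q : rat, (0 : R) <= ratr q <= L ->
  `|f (ratr q) w| <= K%:R].
have mS K : measurable (S K).
  rewrite -[S K]setCK; apply: measurableC.
  have -> : ~` S K = \bigcup_(q : rat) (if (0 : R) <= ratr q <= L then
      [set w | K%:R < `|f (ratr q) w|] else set0).
    apply/seteqP; split => [w|w [q _]].
      move=> /existsNP[q /not_implyP[qL /negP]]; rewrite -ltNge => h.
      by exists q => //; rewrite qL.
    by case: ifPn => // qL /= h /(_ q qL); rewrite leNgt h.
  apply: bigcupT_measurable_rat => q; case: ifPn => // /andP[q0 _].
  have mfq : measurable_fun [set: T] (fun w => `|f (ratr q) w|).
    by apply: measurableT_comp => //; exact: mf.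
  exact: (measurable_gt_set mfq).
have ndS : nondecreasing_seq S.
  move=> K K' KK'; apply/subsetPset => w h q /h /le_trans; apply.
  by rewrite ler_nat.
have US : \bigcup_K S K = setT.
  rewrite -subTset => w _.
  have cn : {within `[0, L], continuous (fun r => `|f (Num.max 0 r) w|)}.
    apply: continuous_subspaceT => r; apply: cvg_norm; exact: cf.
  have [c _ cP] := EVT_max (ltW L0) cn.
  exists (Num.truncn `|f (Num.max 0 c) w|).+1 => // q qL.
  rewrite (le_trans _ (ltW (truncnS_gt _)))//.
  have := cP (ratr q); rewrite in_itv/= => /(_ qL).
  by rewrite max_r//; case/andP: qL.
have P1 : P (\bigcup_K S K) = 1%E by rewrite US; exact: probability_setT.
have cv : P (S K) @[K --> \oo] --> 1%E.
  rewrite -P1; apply: nondecreasing_cvg_mu => //; exact: bigcupT_measurable.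
have /fine_cvgP[finS /cvgrPdist_lt/(_ _ eta0) H] := cv.
have [K _ /(_ K (leqnn K))[fK hK]] := filterI finS H.
exists K%:R, (S K); split => //.
  rewrite probability_setC// -(fineK fK) -EFinB lee_fin.
  by move: hK => /=; rewrite ltr_norml => /andP[_ /ltW].
move=> s t s0 st tL; have t0 := le_trans s0 st.
apply: filterS (solution_incrementE lipF solX s0 st) => w E Sw.
have [_ cX _] := solX.
have cx : continuous_curve (fun r => X (Num.max 0 r) w) := continuous_path_max (cX w).
have -> : X t w j0 0 - X s w j0 0 - noise s t w =
    drift F (fun r => X (Num.max 0 r) w) s t j0 0 - (t - s) * 0.
  rewrite mulr0 subr0 noiseE.
  have := congr1 (fun M : 'cV[R]_d => M j0 0) E; rewrite !mxE => ->.
  by rewrite addrK.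
rewrite [leRHS]mulrC; apply: (drift_coord_near lipF cx) => // r /andP[sr rt].
have r0 := le_trans s0 sr.
rewrite subr0 leNgt; apply/negP => Kr.
have [e /= e0 eP] : exists2 e, 0 < e & forall r', `|r - r'| < e ->
    K%:R < `|f (Num.max 0 r') w|.
  have /cvgr_gt/(_ _ Kr)/nbhs_ballP[e /= e0 eP] :
     `|f (Num.max 0 r') w| @[r' --> r] --> `|f (Num.max 0 r) w|.
    by apply: cvg_norm; exact: cf.
  by exists e.
have [q q0 q1] : exists2 q : rat, (0 : R) <= ratr q <= L & `|r - ratr q| < e.
  have [r0'|r0'] := ltP 0 r.
    have : Num.max 0 (r - e) < r by rewrite gt_max r0' ltrBlDr ltrDl.
    move=> /rat_in_itvoo[q]; rewrite in_itv/= gt_max => /andP[/andP[q1 q2] q3].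
    exists q; first by rewrite ltW//= (le_trans (ltW q3))// (le_trans rt).
    by rewrite ger0_norm ?subr_ge0 ?ltW// ltrBlDr addrC -ltrBlDr.
  have re : r = 0 by apply/le_anti/andP; split.
  have : 0 < Num.min L e by rewrite lt_min L0.
  move=> /rat_in_itvoo[q]; rewrite in_itv/= lt_min => /andP[q1 /andP[q2 q3]].
  exists q; first by rewrite !ltW.
  by rewrite re sub0r normrN ger0_norm// ltW.
have := eP _ q1; rewrite max_r; last by case/andP: q0.
by rewrite ltNge Sw.
Qed.

End increments.

(** * The probability of a sign change *)

Lemma product_sign_near (R : realDomainType) (k u1 u2 v1 v2 : R) :
  `|v1 - u1| <= k -> `|v2 - u2| <= k -> k < `|u1| -> k < `|u2| ->
  v1 * v2 <= 0 <-> u1 * u2 < 0.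
Proof.
have same (u v : R) : `|v - u| <= k -> k < `|u| -> 0 < u /\ 0 < v \/ u < 0 /\ v < 0.
  move=> /ler_normlP[h1 h2]; rewrite ltr_normr => /orP h.
  by case: h => h; [left|right]; split; lra.
move=> /same s1 /same s2 /s1[] [u1s v1s] /s2[] [u2s v2s];
  [rewrite pmulr_rle0// pmulr_rlt0//|rewrite pmulr_rle0// pmulr_rlt0//
  |rewrite nmulr_rle0// nmulr_rlt0//|rewrite nmulr_rle0// nmulr_rlt0//];
  by split => ?; lra.
Qed.

Section turn_probability.
Context {R : realType} {dsp} {T : measurableType dsp} (P : probability T R).
Context {d m : nat} (F : 'cV[R]_d -> 'cV[R]_d) (A : 'M[R]_(d, m)).
Variable W : R -> T -> 'cV[R]_m.
Hypotheses (BW : standard_brownian_motion P W) (lipF : locally_lipschitz F).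
Variable X : R -> T -> 'cV[R]_d.
Hypotheses (solX : sde_solution P F A W X)
  (X0W : independent_of_process P (X 0) W) (statX : stationary P X).
Variables (j0 : 'I_d) (j1 : 'I_m).
Hypothesis A0 : A j0 j1 != 0.

Let mX t : 0 <= t -> random_vector (X t).
Proof. by case: solX => h _ _; exact: h. Qed.

Let mcoord (t : R) : 0 <= t -> measurable_fun [set: T] (fun w => X t w j0 0 : R).
Proof. by move=> t0; apply: measurable_coord_of; exact: mX. Qed.

Let c0 : R := 2 / `|A j0 j1|.

Let c00 : 0 <= c0. Proof. by rewrite divr_ge0. Qed.

(** Small time steps beat the linear error term, since the noise over a time
    [e] is of order [Num.sqrt e]. *)
Lemma small_step (K eta : R) : 0 <= K -> 0 < eta ->
  exists2 e0, 0 < e0 & forall e, 0 < e <= e0 -> c0 * K * Num.sqrt e <= eta.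
Proof.
move=> K0 eta0; have c1 : 0 < c0 * K + 1 by rewrite ltr_wpDl// mulr_ge0.
have y0 : 0 < eta / (c0 * K + 1) by rewrite divr_gt0.
exists ((eta / (c0 * K + 1)) ^+ 2); first by rewrite exprn_gt0.
move=> e /andP[e0 ee]; apply: (@le_trans _ _ (c0 * K * (eta / (c0 * K + 1)))).
  rewrite ler_wpM2l ?mulr_ge0// -[leRHS]gtr0_norm// -sqrtr_sqr ler_sqrt//.
  by rewrite exprn_ge0// ltW.
by rewrite mulrCA ler_piMr ?(ltW eta0)// ler_pdivrMr// mul1r lerDl.
Qed.

(** Conditionally on the past up to a time [s] just before [delta], the
    increment is Gaussian at the scale [Num.sqrt (delta - s)], up to an error of
    order [delta - s]. *)
Lemma increment_neq0 delta : 0 < delta ->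
  P [set w | X delta w j0 0 = X 0 w j0 0] = 0%E.
Proof.
move=> dl0; have d0 := ltW dl0.
have mE : measurable [set w | X delta w j0 0 = X 0 w j0 0].
  by apply: measurable_eq_set; exact: mcoord.
apply/eqP; rewrite eq_le measure_ge0 andbT; apply/lee_addgt0Pr => eta eta0.
rewrite add0e; have eta20 : 0 < eta / 2 by rewrite divr_gt0.
have [K [S [K0 mS PS SP]]] := increments_near_noise lipF solX j0 dl0 eta20.
have [e0 e00 e0P] := small_step K0 eta20.
pose e := Num.min delta e0; pose s := delta - e.
have e_gt0 : 0 < e by rewrite lt_min dl0.
have s0 : 0 <= s by rewrite subr_ge0 ge_min lexx.
have sd : s < delta by rewrite ltrBlDr ltrDl.
have es : delta - s = e by rewrite /s opprB addrC subrK.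
pose C w := X s w j0 0 - X 0 w j0 0.
have mXG u : 0 <= u <= s -> @measurable_fun _ _ (g_sigma_algebraType (past_generators X s)) R setT
    (fun w => X u w j0 0).
  move=> us; apply: (@measurable_coord_of _ _ (g_sigma_algebraType (past_generators X s)) d (X u)).
  move=> _ B mB; rewrite setTI; apply: sub_sigma_algebra; exists u => //.
  by exists B.
have mC : @measurable_fun _ _ (g_sigma_algebraType (past_generators X s)) R setT C.
  by apply: measurable_funB; apply: mXG; rewrite ?lexx ?s0.
have ind : independent P [set C @^-1` B | B in measurable]
    (sigma_vector (fun w => W delta w - W s w)).
  apply: (sub_independent _ _ (solution_past_indep_future BW lipF solX X0W s0)).
    by move=> _ [B mB <-]; have := mC measurableT B mB; rewrite setTI.
  move=> E SE; apply: sub_sigma_algebra; exists (delta - s); first by rewrite /= subr_ge0 ltW.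
  by rewrite /future_increment addrC subrK.
have mCT : measurable_fun [set: T] C.
  by apply: measurable_funB; exact: mcoord.
have ball := noise_small_ball BW A0 s0 sd K0 mCT ind.
pose D := [set w | `|C w + noise A W j0 s delta w| <= K * (delta - s)]%R.
have mD : measurable D.
  apply: measurable_norm_le_set; apply: measurable_funD => //.
  exact: (measurable_noise A BW j0 s0 sd).
apply: (@le_trans _ _ (P (~` S `|` D))).
  apply: ae_prob_le => //; first by apply: measurableU => //; exact: measurableC.
  apply: filterS (SP s delta s0 (ltW sd) (lexx _)) => w Sw E.
  have [/Sw|] := pselect (S w); last by left.
  move=> h; right; rewrite /D/=; move: h; rewrite /= in E; rewrite E.
  by rewrite -normrN !opprD !opprK [- X 0 w _ _ + _]addrC.
apply: (le_trans (measureU2 P (measurableC mS) mD)).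
rewrite (splitr eta) EFinD; apply: leeD => //.
apply: (le_trans ball); rewrite lee_fin es; apply: e0P.
by rewrite e_gt0/= ge_min lexx orbT.
Qed.

Lemma increment_neq0_shift s delta : 0 <= s -> 0 < delta ->
  P [set w | X (s + delta) w j0 0 = X s w j0 0] = 0%E.
Proof.
move=> s0 dl0; rewrite -[RHS](increment_neq0 dl0).
pose B : set (path_space R d) := [set x | x delta j0 0 = x 0 j0 0].
have mB : measurable B.
  have mc r : 0 <= r -> measurable_fun [set: path_space R d] (fun x => x r j0 0 : R).
    move=> r0; apply: (@measurable_coord_of _ _ (path_space R d) d (coordinate r)).
    exact: measurable_coordinate.
  by apply: measurable_eq_set; apply: mc => //; exact: ltW.
apply: etrans _ (stationary_path solX statX s0 mB).
by rewrite /B /shift_path/= add0r addrC.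
Qed.

Let D delta (w : T) : R := turn j0 1 delta 0 (X ^~ w).

Let mD delta : 0 <= delta -> measurable_fun [set: T] (D delta).
Proof.
move=> d0; rewrite /D /turn; apply: measurable_funM; first exact: measurable_cst.
by apply: measurable_funM; apply: measurable_funB; apply: mcoord; rewrite ?addr_ge0.
Qed.

Let mDlt delta : 0 <= delta -> measurable [set w | D delta w <= 0].
Proof.
by move=> d0; exact: (measurable_le_set (mD d0)).
Qed.

(** A turn that is neither positive nor negative has a flat increment. *)
Lemma turn_probD delta : 0 < delta ->
  path_prob P X (turn_event j0 1 delta) + path_prob P X (turn_event j0 (-1) delta) = 1.
Proof.
move=> dl0; have d0 := ltW dl0.
have mge : measurable [set w | 0 <= D delta w] by exact: (measurable_ge_set (mD d0)).
have D0 : P ([set w | D delta w <= 0] `&` [set w | 0 <= D delta w]) = 0%E.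
  have mX0 s : 0 <= s -> measurable [set w | X (s + delta) w j0 0 = X s w j0 0].
    by move=> s0; apply: measurable_eq_set; apply: mcoord; rewrite ?addr_ge0.
  have m1 := mX0 _ (lexx 0); have m2 := mX0 _ (addr_ge0 (lexx 0) d0).
  apply/eqP; rewrite eq_le measure_ge0 andbT.
  apply: (@le_trans _ _ (P ([set w | X (0 + delta) w j0 0 = X 0 w j0 0] `|`
     [set w | X (0 + delta + delta) w j0 0 = X (0 + delta) w j0 0]))).
    apply: le_measure; rewrite ?inE; [exact: measurableI (mDlt d0) mge|exact: measurableU|].
    move=> w [/= h1 h2]; have /eqP : D delta w = 0 by apply/le_anti/andP.
    rewrite /D /turn mul1r mulf_eq0 !subr_eq0 => /orP[] /eqP ?; by [left|right].
  apply: (le_trans (measureU2 P m1 m2)).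
  rewrite [X in (X + _)%E](increment_neq0_shift (lexx 0) dl0) add0e.
  by rewrite [leLHS](increment_neq0_shift (addr_ge0 (lexx 0) d0) dl0).
have DU : [set w | D delta w <= 0] `|` [set w | 0 <= D delta w] = setT.
  by rewrite -subTset => w _; have /orP[|] := le_total (D delta w) 0; [left|right].
have E1 : path_prob P X (turn_event j0 1 delta) = fine (P [set w | D delta w <= 0]) by [].
have E2 : path_prob P X (turn_event j0 (-1) delta) = fine (P [set w | 0 <= D delta w]).
  congr (fine (P _)); apply/seteqP; split => w /=; rewrite /turn_event /D /turn/=;
  by rewrite mulN1r oppr_le0 mul1r.
rewrite E1 E2; apply: EFin_inj; rewrite EFinD !fineK ?fin_num_measure//.
  apply: etrans _ (probability_setT P); rewrite -DU; apply: esym.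
  have fin : (P [set w | D delta w <= 0]%R < +oo)%E.
    by rewrite -ge0_fin_numE// fin_num_measure//; exact: mDlt.
  by apply: etrans (measureUfinl (mDlt d0) mge fin) _; rewrite [X in (_ - X)%E]D0 sube0.
exact: mDlt.
Qed.

(** Independence and symmetry: each of the two ways to have opposite signs has
    probability [1 / 4]. *)
Lemma noise_product_sign delta : 0 < delta ->
  let N := [set w | noise A W j0 0 delta w * noise A W j0 delta (delta + delta) w < 0] in
  measurable N /\ fine (P N) = 2^-1.
Proof.
move=> dl0 N; have d0 := ltW dl0; have dd : delta < delta + delta by rewrite ltrDl.
pose G := sigma_process [set u | 0 <= u <= delta] W.
pose U1 w := noise A W j0 0 delta w; pose U2 w := noise A W j0 delta (delta + delta) w.
have mG : @measurable_fun _ _ (g_sigma_algebraType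
    (\bigcup_(t in [set u | 0 <= u <= delta]) sigma_vector (W t))) R setT U1.
  apply: (@measurable_lin_comb _ _ (g_sigma_algebraType
    (\bigcup_(t in [set u | 0 <= u <= delta]) sigma_vector (W t))) m
    (fun w => W delta w - W 0 w)).
  have mW0 t : 0 <= t <= delta -> @random_vector _ _ (g_sigma_algebraType
    (\bigcup_(t in [set u | 0 <= u <= delta]) sigma_vector (W t))) m (W t).
    move=> td _ B mB; rewrite setTI; apply: sub_sigma_algebra; exists t => //.
    by exists B.
  by apply: random_vectorB; apply: mW0; rewrite ?lexx d0.
have mL : @measurable_fun _ _ (borel_cV R m) R setT (fun x => \sum_(j < m) A j0 j * x j 0).
  apply: measurable_sum => j; apply: measurable_funM; first exact: measurable_cst.
  exact: measurable_coord.
have [n1 p1] := noise_sign BW A0 (lexx 0) dl0.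
have [n2 p2] := noise_sign BW A0 d0 dd.
have mG1 (I : interval R) : sigma_process [set u | 0 <= u <= delta] W (U1 @^-1` [set` I]).
  by have := mG measurableT _ (measurable_itv I); rewrite setTI.
have mH2 (I : interval R) : sigma_vector (fun w => W (delta + delta) w - W delta w)
    (U2 @^-1` [set` I]).
  exists ((fun x : 'cV[R]_m => \sum_(j < m) A j0 j * x j 0) @^-1` [set` I]) => //.
  by have := mL measurableT _ (measurable_itv I); rewrite setTI.
have ind (I J : interval R) :
    P (U1 @^-1` [set` I] `&` U2 @^-1` [set` J]) = (P (U1 @^-1` [set` I]) * P (U2 @^-1` [set` J]))%E.
  rewrite setIC muleC; case: BW => _ _ _ _ h.
  exact: (h _ _ d0 dd _ _ (mH2 J) (mG1 I)).
have mU1 (I : interval R) : measurable (U1 @^-1` [set` I]).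
  exact: (preimage_measurable (measurable_noise A BW j0 (lexx 0) dl0) (measurable_itv I)).
have mU2 (I : interval R) : measurable (U2 @^-1` [set` I]).
  exact: (preimage_measurable (measurable_noise A BW j0 d0 dd) (measurable_itv I)).
have neg (U : T -> R) : U @^-1` `]-oo, 0[%classic = [set w | U w < 0] by [].
have pos (U : T -> R) : U @^-1` `]0, +oo[%classic = [set w | 0 < U w].
  by apply/seteqP; split => w /=; rewrite in_itv/= andbT.
pose E1 := U1 @^-1` `]-oo, 0[%classic `&` U2 @^-1` `]0, +oo[%classic.
pose E2 := U1 @^-1` `]0, +oo[%classic `&` U2 @^-1` `]-oo, 0[%classic.
have NE : N = E1 `|` E2.
  rewrite /E1 /E2 !neg !pos; apply/seteqP; split => w; rewrite /N/= -/(U1 w) -/(U2 w).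
    have [h|h|->] := ltgtP (U1 w) 0; last by rewrite mul0r ltxx.
      by rewrite nmulr_rlt0//; left.
    by rewrite pmulr_rlt0//; right.
  by move=> [[/= h1 h2]|[/= h1 h2]]; [rewrite nmulr_rlt0|rewrite pmulr_rlt0].
have mE1 : measurable E1 by exact: measurableI.
have mE2 : measurable E2 by exact: measurableI.
have E12 : E1 `&` E2 = set0.
  by rewrite /E1 /E2 !neg !pos -subset0 => w [[/= h1 _] [/= h2 _]]; move: (lt_trans h1 h2); rewrite ltxx.
have quarter : P N = (2^-1)%:E.
  rewrite NE; apply: etrans (measureU P mE1 mE2 E12) _.
  apply: etrans (congr2 _ (ind _ _) (ind _ _)) _; rewrite !neg !pos.
  rewrite [P [set w | U1 w < 0]]n1 [P [set w | 0 < U1 w]]p1.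
  rewrite [P [set w | U2 w < 0]]n2 [P [set w | 0 < U2 w]]p2.
  by rewrite -!EFinM -EFinD; congr EFin; field.
by split; [rewrite NE; exact: measurableU|rewrite quarter].
Qed.

(** Unless the noise or the path is exceptional, the increments have the signs of
    their Gaussian parts. *)
Lemma turn_prob_cvg eta : 0 < eta -> exists2 d0, 0 < d0 &
  forall delta, 0 < delta <= d0 ->
  `|path_prob P X (turn_event j0 1 delta) - 2^-1| <= eta.
Proof.
move=> eta0; have eta3 : 0 < eta / 3 by rewrite divr_gt0.
have [K [S [K0 mS PS SP]]] := increments_near_noise lipF solX j0 (ltr0n R 2) eta3.
have [e0 e00 e0P] := small_step K0 eta3.
exists (Num.min 1 e0); first by rewrite lt_min ltr01.
move=> delta; rewrite le_min => /and3P[dl0 d1 de0].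
have d0 := ltW dl0; have dd : delta < delta + delta by rewrite ltrDl.
have [mN <-] := noise_product_sign dl0; set N := [set w | _] in mN *.
pose U1 w := noise A W j0 0 delta w; pose U2 w := noise A W j0 delta (delta + delta) w.
have mU1 : measurable_fun [set: T] U1 := measurable_noise A BW j0 (lexx 0) dl0.
have mU2 : measurable_fun [set: T] U2 := measurable_noise A BW j0 d0 dd.
pose B1 := [set w | `|U1 w| <= K * (delta - 0)].
pose B2 := [set w | `|U2 w| <= K * (delta + delta - delta)].
have mB1 : measurable B1 by exact: measurable_norm_le_set.
have mB2 : measurable B2 by exact: measurable_norm_le_set.
have e0d : c0 * K * Num.sqrt delta <= eta / 3 by apply: e0P; rewrite dl0.
have PB1 : (P B1 <= (eta / 3)%:E)%E.
  by apply: (le_trans (noise_small BW A0 (lexx 0) dl0 K0)); rewrite lee_fin subr0.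
have PB2 : (P B2 <= (eta / 3)%:E)%E.
  by apply: (le_trans (noise_small BW A0 d0 dd K0)); rewrite lee_fin addrK.
have mSC := measurableC mS.
have mB12 := measurableU _ _ mB1 mB2.
have mbad := measurableU _ _ mSC mB12.
have bad : fine (P (~` S `|` (B1 `|` B2))) <= eta.
  rewrite -lee_fin fineK ?fin_num_measure//.
  apply: (le_trans (measureU2 P mSC mB12)).
  apply: (@le_trans _ _ ((eta / 3)%:E + ((eta / 3)%:E + (eta / 3)%:E))%E).
    by apply: leeD => //; apply: (le_trans (measureU2 P mB1 mB2)); exact: leeD.
  by rewrite -!EFinD lee_fin; lra.
apply: le_trans bad; rewrite /path_prob; apply: prob_diff_le => //.
  exact: mDlt.
have dd2 : delta + delta <= 2 by rewrite (_ : 2 = 1 + 1)// lerD.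
have dl2 : delta <= 2 by apply: le_trans dd2; rewrite lerDl.
apply: filterS2 (SP 0 delta (lexx 0) d0 dl2) (SP _ _ d0 (ltW dd) dd2) => w E1 E2.
move=> /not_orP[/contrapT Sw /not_orP[/negP b1 /negP b2]].
move: (E1 Sw) (E2 Sw) b1 b2; rewrite subr0 addrK -!ltNge.
rewrite /turn_event /turn /N /= !add0r mul1r /U1 /U2.
set u1 := noise _ _ _ _ _ _; set u2 := noise _ _ _ _ _ _.
set v1 := _ - X 0 w j0 0; set v2 := _ - X delta w j0 0.
exact: product_sign_near.
Qed.

End turn_probability.

(** * Mean run lengths of a single path *)

Section runs.
Context {R : realType} (x : R -> R) (delta : R).

Definition sign_change (n : nat) : bool :=
  (0 < n)%N && (increment x delta n.+1 * increment x delta n < 0).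

Definition sign_changes (N : nat) : nat := \sum_(n < N) sign_change n.

Section run_ends.
Hypothesis recur : forall n, exists m, (n < m)%N && sign_change m.

Fixpoint run_index (k : nat) : nat :=
  if k is k'.+1 then ex_minn (recur (run_index k')) else 0%N.

Lemma run_indexS k : [/\ (run_index k < run_index k.+1)%N, sign_change (run_index k.+1) &
  forall n, (run_index k < n)%N -> sign_change n -> (run_index k.+1 <= n)%N].
Proof.
rewrite /=; case: ex_minnP => n /andP[kn sn] nmin; split => // n' kn' sn'.
by apply: nmin; rewrite kn'.
Qed.

(** The infimum over the empty set does not occur, as sign changes recur. *)
Lemma run_endE k : run_end x delta k = (run_index k)%:R%:E.
Proof.
elim: k => [//|k IH]; have [kS sS minS] := run_indexS k.
rewrite [LHS]/=; apply/le_anti/andP; split.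
  apply: ereal_inf_lbound; exists (run_index k.+1) => //; split.
  - by case/andP: sS.
  - by rewrite IH lte_fin ltr_nat.
  - by case/andP: sS.
apply: le_ereal_inf_tmp => _ [n [n0 kn sn] <-]; rewrite lee_fin ler_nat minS//.
  by move: kn; rewrite IH lte_fin ltr_nat.
by rewrite /sign_change n0.
Qed.

Lemma sign_changes_run k : sign_changes (run_index k).+1 = k.
Proof.
elim: k => [|k IH]; first by rewrite /sign_changes big_ord_recl big_ord0.
have [kS sS minS] := run_indexS k.
rewrite /sign_changes big_ord_recr/= -/(run_index k.+1) sS addn1; congr _.+1.
rewrite -[RHS]IH /sign_changes -[LHS](big_mkord xpredT (fun n => nat_of_bool (sign_change n))).
rewrite (big_cat_nat (n := (run_index k).+1))//= big_mkord.
rewrite [X in (_ + X)%N](_ : _ = 0%N) ?addn0//.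
rewrite big_nat_cond big1// => n /andP[/andP[kn nk] _].
by apply/eqP; rewrite eqb0; apply/negP => /(minS _ kn); rewrite leqNgt nk.
Qed.

Lemma mean_run_lengthE J : mean_run_length x delta J = ((run_index J)%:R / J%:R)%:E.
Proof.
rewrite /mean_run_length mulrC EFinM; congr (_ * _)%E.
rewrite (eq_big_nat _ _ (F2 := fun j => ((run_index j)%:R - (run_index j.-1)%:R)%:E)); last first.
  by move=> j _; rewrite /run_length !run_endE.
rewrite sumEFin; congr EFin.
rewrite big_add1/= (telescope_sumr (fun j => (run_index j)%:R))//.
by rewrite subr0.
Qed.

End run_ends.
Let freq N : R := (sign_changes N)%:R / N%:R.

Lemma cvg_invn : (n%:R^-1 : R) @[n --> \oo] --> (0 : R).
Proof. by rewrite -(cvg_shiftS (fun n => n%:R^-1 : R)); exact: cvg_harmonic. Qed.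

Lemma sign_changes_le N : (sign_changes N <= N)%N.
Proof.
elim: N => [|N IH]; first by rewrite /sign_changes big_ord0.
rewrite /sign_changes big_ord_recr/= -addn1 leq_add//; exact: leq_b1.
Qed.

(** Finitely many sign changes would have frequency 0. *)
Lemma sign_changes_recur (p : R) : 0 < p -> freq N @[N --> \oo] --> p ->
  forall n, exists m, (n < m)%N && sign_change m.
Proof.
move=> p0 cp n; apply: contrapT => no.
have bound N : (sign_changes N <= n.+1)%N.
  have {}no m : (n < m)%N -> sign_change m = false.
    by move=> nm; apply/negP => sm; apply: no; exists m; rewrite nm.
  elim: N => [|N IH]; first by rewrite /sign_changes big_ord0.
  have [nN|Nn] := ltnP n N; first by rewrite /sign_changes big_ord_recr/= no// addn0.
  exact: leq_trans (sign_changes_le _) _.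
have c0 : (n.+1)%:R / N%:R @[N --> \oo] --> (0 : R).
  by rewrite -(mulr0 n.+1%:R); apply: cvgM; [exact: cvg_cst|exact: cvg_invn].
have : p <= 0.
  apply: (ler_cvg_to cp c0); apply: nearW => N.
  by rewrite /freq ler_wpM2r// ler_nat.
by rewrite leNgt p0.
Qed.

(** Up to the [k]-th occurrence of an event there are [k] occurrences, so the
    mean waiting time is inverse to the frequency. *)
Lemma mean_run_length_cvg (p : R) : 0 < p -> freq N @[N --> \oo] --> p ->
  mean_run_length x delta J @[J --> \oo] --> (p^-1)%:E.
Proof.
move=> p0 cp; have H := sign_changes_recur p0 cp.
under eq_cvg do rewrite (mean_run_lengthE H).
apply/cvg_EFin; first by apply: nearW.
rewrite /comp/=.
have cr : freq (run_index H J).+1 @[J --> \oo] --> p.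
  apply: (cvg_comp (fun J => (run_index H J).+1) freq _ cp).
  apply/cvgnyPge => M; exists M => // J /= MJ; apply: (leq_trans MJ).
  elim: J {MJ} => // J IH; have [lt _ _] := run_indexS H J.
  by rewrite ltnS; exact: leq_trans IH lt.
have -> : (fun J => (run_index H J)%:R / J%:R) =
  (fun J => (freq (run_index H J).+1)^-1 - J%:R^-1).
  apply/funext => J; rewrite /freq sign_changes_run invf_div -natr1 mulrDl.
  by rewrite mul1r addrK.
rewrite -[X in _ --> X]subr0; apply: cvgB.
  by apply: cvgV => //; rewrite gt_eqF.
exact: cvg_invn.
Qed.

End runs.

(** The bound [4^-1] keeps the frequencies away from zero, where the inverse is
    Lipschitz. *)
Lemma mean_run_length_limit (R : realType) (x : R -> R) :
  (forall eta, 0 < eta -> exists2 d0, 0 < d0 & forall delta, 0 < delta <= d0 ->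
    exists2 p : R, `|p - 2^-1| <= eta &
      (sign_changes x delta N)%:R / N%:R @[N --> \oo] --> p) ->
  mean_run_length_limit_is_2 x.
Proof.
move=> H.
have lim eta : 0 < eta <= 4^-1 -> \forall delta \near (0 : R)^'+, exists p : R,
    [/\ `|p - 2^-1| <= eta, 0 < p, 4^-1 <= p &
     mean_run_length x delta J @[J --> \oo] --> (p^-1)%:E].
  move=> /andP[eta0 eta4]; have [d0 d00 dP] := H eta eta0.
  near=> delta; have [|p pe cp] := dP delta.
    by apply/andP; split; near: delta; [exact: nbhs_right_gt|exact: nbhs_right_le].
  have p4 : 4^-1 <= p by move: pe; rewrite ler_norml => /andP[? _]; lra.
  have p0 : 0 < p by apply: lt_le_trans p4; rewrite invr_gt0.
  exists p; split => //; exact: mean_run_length_cvg.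
split.
  have := lim 4^-1; rewrite lexx invr_gt0 ltr0n => /(_ isT).
  by apply: filterS => delta [p [_ _ _ cp]]; apply/cvg_ex; exists (p^-1)%:E.
apply/fine_cvgP; split.
  have := lim 4^-1; rewrite lexx invr_gt0 ltr0n => /(_ isT).
  by apply: filterS => delta [p [_ _ _ cp]]; rewrite (cvg_lim _ cp).
apply/cvgrPdist_lt => e e0.
have m0 : 0 < Num.min 4^-1 (e / 9) <= (4^-1 : R).
  by rewrite ge_min lexx lt_min invr_gt0 ltr0n divr_gt0.
apply: filterS (lim _ m0) => delta [p [pe p0 p4 cp]].
rewrite /= (cvg_lim _ cp)//=.
have -> : 2 - p^-1 = (p - 2^-1) * (2 / p) by field; rewrite gt_eqF.
rewrite normrM (ger0_norm (_ : 0 <= 2 / p)) ?divr_ge0 ?ltW//.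
have : `|p - 2^-1| <= e / 9 by apply: (le_trans pe); rewrite ge_min lexx orbT.
move=> h; have p8 : 2 / p <= 8 by rewrite ler_pdivrMr//; lra.
by apply: (le_lt_trans (ler_wpM2l (normr_ge0 _) p8)); lra.
Unshelve. all: by end_near.
Qed.

Section sign_change_frequency.
Context {R : realType} {d : nat} (j0 : 'I_d) (x : R -> 'cV[R]_d) (delta : R).
Let z t : R := x t j0 0.

(** The increment with index [n.+2] starts at the time [n.+1 * delta], so that the
   sign changes with the indices 0 and 1 are not turns at positive times. *)
Lemma sign_change_turn n :
  sign_change z delta n.+2 = (turn j0 1 delta (n.+1%:R * delta) x < 0).
Proof.
have S k : k.+1%:R * delta = k%:R * delta + delta by rewrite -natr1 mulrDl mul1r.
by rewrite /sign_change /turn /increment /z /= mul1r mulrC !S.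
Qed.

Lemma sign_changes_turn_count N : exists2 c : R, 0 <= c <= 1 &
  (sign_changes z delta N.+2)%:R = c + N%:R - turn_count j0 (-1) delta N x.
Proof.
exists (sign_change z delta 1)%:R; first by rewrite ler0n lern1 leq_b1.
rewrite /sign_changes !big_ord_recl/= /sign_change/= add0n natrD -addrA; congr (_ + _).
rewrite natr_sum /turn_count.
apply/eqP; rewrite eq_sym subr_eq -big_split/= eq_sym.
rewrite (eq_bigr (fun=> 1)); first by rewrite sumr_const card_ord.
move=> n _; have := sign_change_turn n; rewrite /sign_change/= => ->.
have -> : turn j0 (-1) delta (n.+1%:R * delta) x = - turn j0 1 delta (n.+1%:R * delta) x.
  by rewrite /turn mulN1r mul1r.
by rewrite oppr_le0; case: ltP => _; rewrite ?addr0 ?add0r.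
Qed.

Lemma sign_changes_le_turn_count N :
  (sign_changes z delta N.+2)%:R <= 1 + turn_count j0 1 delta N x.
Proof.
rewrite /sign_changes !big_ord_recl/= {1}/sign_change/= add0n natrD lerD//.
  by rewrite lern1 leq_b1.
rewrite natr_sum; apply: ler_sum => n _; rewrite ler_nat.
have := sign_change_turn n; rewrite /sign_change/= => ->.
by case: ltgtP.
Qed.

(** The upper bounds for both signs enclose the frequency in intervals of
    arbitrarily small length, which makes it a Cauchy sequence. *)
Lemma sign_change_frequency (q : R -> R) (Q : R -> Prop) :
  (forall e, Q e -> 0 <= q e <= 1) ->
  (forall eps, 0 < eps -> exists2 e, Q e & exists N0, forall n, (N0 <= n)%N ->
     turn_count j0 1 delta n x <= (q e + eps) * n%:R /\
     turn_count j0 (-1) delta n x <= (1 - q e + eps) * n%:R) ->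
  exists2 p : R, (sign_changes z delta N)%:R / N%:R @[N --> \oo] --> p &
    forall eps, 0 < eps -> exists2 e, Q e & `|p - q e| <= eps.
Proof.
move=> q01 H; pose f N : R := (sign_changes z delta N)%:R / N%:R.
have near_q eps : 0 < eps -> exists2 e, Q e & \forall N \near \oo, `|f N - q e| <= eps.
  move=> eps0; have eps20 : 0 < eps / 2 by rewrite divr_gt0.
  have [e Qe [N0 N0P]] := H _ eps20; exists e => //.
  exists (maxn N0 (Num.truncn (2 / (eps / 2))).+1).+2 => // -[//|[//|N]] /=.
  rewrite !ltnS geq_max => /andP[NN0 Nbig].
  have [u1 u2] := N0P N NN0; have [c c01 E] := sign_changes_turn_count N.
  have U := sign_changes_le_turn_count N.
  have N2 : 2 <= eps / 2 * N%:R.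
    rewrite mulrC -ler_pdivrMr//; apply: (le_trans (ltW (truncnS_gt _))).
    by rewrite ler_nat.
  have NS : N.+2%:R = N%:R + 2 :> R by rewrite -addn2 natrD.
  have N20 : 0 < N.+2%:R :> R by rewrite ltr0n.
  have -> : f N.+2 - q e = ((sign_changes z delta N.+2)%:R - q e * N.+2%:R) / N.+2%:R.
    by rewrite mulrBl mulfK// gt_eqF.
  rewrite normrM normfV (gtr0_norm N20) ler_pdivrMr// NS.
  have /andP[q0 q1] := q01 e Qe; have /andP[c0' c1'] := c01.
  move: u1 u2 E U N2; set s := (sign_changes _ _ _)%:R; set N' : R := N%:R.
  set t1 := turn_count _ _ _ _ _; set t2 := turn_count _ _ _ _ _.
  rewrite !mulrDl mulNr mul1r => u1 u2 E U N2.
  rewrite ler_norml !mulrDr; apply/andP; split; lra.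
have cf : cvgn f.
  apply: cauchy_cvg; apply: cauchy_exP => eps eps0.
  have eps20 : 0 < eps / 2 by rewrite divr_gt0.
  have [e _ h] := near_q _ eps20; exists (q e).
  apply: filterS h => N h; rewrite /ball/= distrC (le_lt_trans h)//; lra.
exists (limn f); first exact: cf.
move=> eps eps0; have [e Qe h] := near_q eps eps0; exists e => //.
have cn : `|f N - q e| @[N --> \oo] --> `|limn f - q e|.
  by apply: cvg_norm; apply: cvgB => //; exact: cvg_cst.
by apply: (ler_cvg_to cn (cvg_cst eps)).
Qed.

End sign_change_frequency.

(** * Typical paths *)

Section typical_paths.
Context {R : realType} {dsp} {T : measurableType dsp} (P : probability T R).
Context {d m : nat} (F : 'cV[R]_d -> 'cV[R]_d) (A : 'M[R]_(d, m)).
Variable W : R -> T -> 'cV[R]_m.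
Hypotheses (BW : standard_brownian_motion P W) (lipF : locally_lipschitz F).

(** The exceptional paths form a set that is measurable in path space, so that it
    can be carried over to other solutions. *)
Lemma typical_paths (X : R -> T -> 'cV[R]_d) (mu : probability (borel_cV R d) R) j0 j1 :
  sde_solution P F A W X -> independent_of_process P (X 0) W -> stationary P X ->
  has_law P (X 0) mu -> ergodicity_condition P mu X -> A j0 j1 != 0 ->
  exists N : set (path_space R d),
  [/\ measurable N, P [set w | N (X ^~ w)] = 0%E &
    forall x, half_line_continuous x -> ~ N x ->
    mean_run_length_limit_is_2 (fun t => x t j0 0)].
Proof.
move=> solX X0W statX lawX0 ergX A0.
have [N [mN PN H]] := all_turn_frequencies BW lipF solX X0W statX lawX0 ergX j0.
exists N; split => // x cx Nx; apply: mean_run_length_limit => eta eta0.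
have eta20 : 0 < eta / 2 by rewrite divr_gt0.
have [d0 d00 dP] := turn_prob_cvg BW lipF solX A0 eta20.
exists (d0 / 2); first by rewrite divr_gt0.
move=> delta /andP[dl0 dld].
pose q e := path_prob P X (turn_event j0 1 e).
have qD e : 0 < e -> path_prob P X (turn_event j0 (-1) e) = 1 - q e.
  move=> e0; have := turn_probD BW lipF solX X0W statX A0 e0.
  by rewrite -/(q e) => /(canRL (addKr _)) ->; rewrite addrC.
have [||p cp pq] := @sign_change_frequency _ _ j0 x delta q (fun e => 0 < e < 2 * delta).
- move=> e /andP[e0 _]; have p0 sg : 0 <= path_prob P X (turn_event j0 sg e).
    by apply: fine_ge0.
  by rewrite p0/= -subr_ge0 -qD.
- move=> eps eps0; have [e ed eP] := H x cx Nx delta eps dl0 eps0.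
  exists e => //; have [N1 N1P] := eP 1 (or_introl erefl).
  have [N2 N2P] := eP (-1) (or_intror erefl).
  exists (maxn N1 N2) => n; rewrite geq_max => /andP[n1 n2].
  by split; [exact: N1P|rewrite -qD ?N2P//; case/andP: ed].
exists p => //; have [e /andP[e0 ed] pe] := pq _ eta20.
have qe : `|q e - 2^-1| <= eta / 2.
  by apply: dP; rewrite e0/= ltW// (lt_le_trans ed)// mulrC -ler_pdivlMr.
have -> : p - 2^-1 = (p - q e) + (q e - 2^-1) by rewrite addrA subrK.
by apply: (le_trans (ler_normD _ _)); rewrite (splitr eta) lerD.
Qed.

Lemma ae_path_event (X : R -> T -> 'cV[R]_d) (N : set (path_space R d))
    (Q : (R -> 'cV[R]_d) -> Prop) :
  sde_solution P F A W X -> measurable N -> P [set w | N (X ^~ w)] = 0%E ->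
  (forall x, half_line_continuous x -> ~ N x -> Q x) ->
  {ae P, forall w, Q (X ^~ w)}.
Proof.
move=> solX mN PN H; exists [set w | N (X ^~ w)]; split => //.
  exact: (measurable_path_event solX).
move=> w nQ; apply: contrapT => nN; apply: nQ; apply: H => //.
by apply: continuous_path_max; case: solX.
Qed.

End typical_paths.

Theorem theorem2p3 (R : realType) (dsp : measure_display)
    (T : measurableType dsp) (P : probability T R) (d m : nat)
    (F : 'cV[R]_d.+1 -> 'cV[R]_d.+1) (A : 'M[R]_(d.+1, m.+1))
    (W : R -> T -> 'cV[R]_m.+1) (mu : probability (borel_cV R d.+1) R)
    (X : R -> T -> 'cV[R]_d.+1)
    (W_brownian : standard_brownian_motion P W)
    (F_lipschitz : locally_lipschitz F)
    (Fd_growth : polynomial_growth (fun x => F x ord_max 0))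
    (Ad_gt0 : 0 < Num.sqrt (\sum_(j < m.+1) A ord_max j ^+ 2))
    (solvable : sde_solvable P F A W)
    (mu_invariant : sde_invariant_probability P F A W mu)
    (X_solution : sde_solution P F A W X)
    (X0_indep : independent_of_process P (X 0) W)
    (X0_law : has_law P (X 0) mu)
    (X_ergodic : ergodicity_condition P mu X) :
  {ae P, forall w, mean_run_length_limit_is_2 (fun t => X t w ord_max 0)} /\
  {ae mu, forall x : 'cV[R]_d.+1, forall Xx : R -> T -> 'cV[R]_d.+1,
    sde_solution P F A W Xx -> {ae P, forall w, Xx 0 w = x} ->
    {ae P, forall w, mean_run_length_limit_is_2 (fun t => Xx t w ord_max 0)}}.
Proof.
have [j1 A0] : exists j1, A ord_max j1 != 0.
  apply: contrapT => no; move: Ad_gt0; rewrite big1 ?sqrtr0 ?ltxx// => j _.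
  have [->|Aj] := eqVneq (A ord_max j) 0; first by rewrite expr0n.
  by case: no; exists j.
have statX := mu_invariant X X_solution X0_indep X0_law.
have [N [mN PN H]] := typical_paths W_brownian F_lipschitz X_solution X0_indep
  statX X0_law X_ergodic A0.
split; first exact: (ae_path_event X_solution mN PN H).
have [M [mM M0 kM]] := path_event_null W_brownian F_lipschitz X_solution X0_indep
  statX X0_law mN PN.
exists M; split => // x nx; apply: kM => kx; apply: nx => Xx solXx Xx0.
apply: (ae_path_event solXx mN _ H).
by rewrite (path_kernel_start W_brownian F_lipschitz solXx mN Xx0).
Qed.
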